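(* Let $u_0\in C^0([0,1])$. For $a\in[0,1)$ let $u^a$ be the solution of $$\partial_t u-\partial_x((x-a)\partial_x u)=0 \ \text{ in } (a,1)\times(0,\infty),\quad u(1,t)=0,\quad (x-a)\partial_x u(x,t)\big|_{x=a}=0,\quad u(x,0)=u_0(x)\ \text{ for } x\in(a,1).$$ Assume that there exist $\delta>0$ and $\beta\in[0,1)$ such that $$|U_1^0(a)|\ge\delta\quad\text{for all } a\in[0,\beta],\qquad\text{where } U_1^0(a)=\int_0^{j_1}u_0\Big(a+(1-a)\frac{s^2}{j_1^2}\Big)\,s\,J_0(s)\,ds .$$ Then there exists $T(u_0,\beta)>0$ such that for every $t_1>T(u_0,\beta)$ there is a constant $C>0$ such that for all $t\in[T(u_0,\beta),t_1]$ $$|a_2-a_1|\le C\,|\partial_xu^{a_2}(1,t)-\partial_xu^{a_1}(1,t)|\qquad\text{for all } a_1,a_2\in[0,\beta].$$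
   Context: $J_0(z)=\sum_{k\ge0}\frac{(-1)^k}{(k!)^2}(z/2)^{2k}$ is the Bessel function of the first kind of order $0$ and $j_1$ is its smallest positive zero. The solution $u^a$ is $u^a(\cdot,t)=e^{tA}u_0$ (with $u_0$ restricted to $(a,1)$), where $A u=\partial_x((x-a)\partial_x u)$ on $L^2(a,1)$ has domain consisting of those $u\in L^2(a,1)$ with $\int_a^1(x-a)|\partial_xu|^2dx<\infty$, $u(1)=0$ and $(x-a)\partial_x u\in H^1(a,1)$. $A$ generates an analytic contraction semigroup, and for $t>0$ the equation and boundary conditions hold in the classical sense. *)

(* Defs.v *)
From HB Require Import structures.
From mathcomp Require Import all_boot all_order all_algebra.
From mathcomp Require Import all_classical all_reals all_analysis.

Set Implicit Arguments.
Unset Strict Implicit.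
Unset Printing Implicit Defensive.

Import Order.TTheory GRing.Theory Num.Theory.
Import numFieldNormedType.Exports.

Local Open Scope classical_set_scope.
Local Open Scope ring_scope.

Definition besselJ0 (R : realType) (z : R) : R :=
  limn (series (fun k : nat => (-1) ^+ k / (k`!%:R ^+ 2) * (z / 2) ^+ (2 * k))).

Definition smallest_positive_zero (R : realType) (f : R -> R) (z : R) : Prop :=
  [/\ 0 < z, f z = 0 & forall y, 0 < y -> f y = 0 -> z <= y].

Definition U10 (R : realType) (j1 : R) (u0 : R -> R) (a : R) : R :=
  \int[lebesgue_measure]_(s in `[0, j1])
    (u0 (a + (1 - a) * (s ^+ 2 / j1 ^+ 2)) * s * besselJ0 s).

(* Elements of L^2(a,1) are represented by functions R -> R, of which only the
   values on ]a, 1[, up to null sets, are relevant. *)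
Definition L2 (R : realType) (a : R) (f : R -> R) : Prop :=
  measurable_fun `]a, 1[%classic f /\
  (\int[lebesgue_measure]_(x in `]a, 1%R[) (f x ^+ 2)%:E < +oo)%E.

Definition L2norm (R : realType) (a : R) (f : R -> R) : R :=
  Num.sqrt (\int[lebesgue_measure]_(x in `]a, 1[) (f x ^+ 2)).

Definition ae_eq1 (R : realType) (a : R) (f g : R -> R) : Prop :=
  ae_eq lebesgue_measure `]a, 1[%classic f g.

Definition test_function (R : realType) (a : R) (phi : R -> R) : Prop :=
  (forall (n : nat) (x : R), derivable (derive1n n phi) x 1) /\
  exists c d : R,
    [/\ a < c, d < 1 & forall x, x \notin `[c, d] -> phi x = 0].

Definition weak_derivative (R : realType) (a : R) (f g : R -> R) : Prop :=
  [/\ locally_integrable `]a, 1[ f, locally_integrable `]a, 1[ g &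
    forall phi, test_function a phi ->
      \int[lebesgue_measure]_(x in `]a, 1[) (f x * derive1 phi x) =
      - \int[lebesgue_measure]_(x in `]a, 1[) (g x * phi x)].

Definition H1 (R : realType) (a : R) (f : R -> R) : Prop :=
  L2 a f /\ exists2 g, L2 a g & weak_derivative a f g.

(* The condition u(1) = 0 for a class u, read on its representative that is
   continuous up to 1. *)
Definition vanishes_at_1 (R : realType) (a : R) (f : R -> R) : Prop :=
  exists f' : R -> R,
    [/\ {within `]a, 1], continuous f'}, ae_eq1 a f f' & f' 1 = 0].

Definition dom_A (R : realType) (a : R) (f : R -> R) : Prop :=
  L2 a f /\
  exists fx : R -> R,
    [/\ weak_derivative a f fx,
        (\int[lebesgue_measure]_(x in `]a, 1%R[)
            ((x - a) * fx x ^+ 2)%:E < +oo)%E,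
        vanishes_at_1 a f &
        H1 a (fun x => (x - a) * fx x)].

(* The graph of A f = ((x - a) f')'. It is a relation because weak derivatives
   are determined only almost everywhere. *)
Definition graph_A (R : realType) (a : R) (f g : R -> R) : Prop :=
  [/\ dom_A a f, L2 a g &
    exists2 fx, weak_derivative a f fx &
      weak_derivative a (fun x => (x - a) * fx x) g].

(* Strongly continuous semigroups of bounded operators on L^2(a,1). Linearity
   and boundedness make each S t compatible with almost everywhere equality. *)
Record C0_semigroup (R : realType) (a : R)
    (S : R -> (R -> R) -> (R -> R)) : Prop := {
  sg_L2 : forall t f, 0 <= t -> L2 a f -> L2 a (S t f);
  sg_linear : forall t (c : R) f g, 0 <= t -> L2 a f -> L2 a g ->
    ae_eq1 a (S t (fun x => c * f x + g x)) (fun x => c * S t f x + S t g x);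
  sg_bounded : forall t, 0 <= t ->
    exists M : R, forall f, L2 a f -> L2norm a (S t f) <= M * L2norm a f;
  sg_0 : forall f, L2 a f -> ae_eq1 a (S 0 f) f;
  sg_add : forall s t f, 0 <= s -> 0 <= t -> L2 a f ->
    ae_eq1 a (S (s + t) f) (S s (S t f));
  sg_continuous : forall f, L2 a f ->
    L2norm a (fun x => S h f x - f x) @[h --> 0^'+] --> (0 : R)
}.

Definition generator (R : realType) (a : R) (S : R -> (R -> R) -> (R -> R))
    (f g : R -> R) : Prop :=
  [/\ L2 a f, L2 a g &
    L2norm a (fun x => h^-1 * (S h f x - f x) - g x) @[h --> 0^'+] --> (0 : R)].

Definition is_exp_A (R : realType) (a : R)
    (S : R -> (R -> R) -> (R -> R)) : Prop :=
  C0_semigroup a S /\ forall f g, generator a S f g <-> graph_A a f g.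

(* For t > 0, the representative u x t of e^{tA} u0 is the one that is
   continuous on ]a, 1]. *)
Record is_solution (R : realType) (a : R) (u0 : R -> R)
    (u : R -> R -> R) : Prop := {
  sol_semigroup : exists2 S, is_exp_A a S &
    forall t, 0 <= t -> ae_eq1 a (u ^~ t) (S t u0);
  sol_continuous : forall t, 0 < t -> {within `]a, 1], continuous (u ^~ t)};
  sol_derivable : forall x t, a < x < 1 -> 0 < t ->
    [/\ derivable (u x) t 1, derivable (u ^~ t) x 1 &
        derivable (fun y => (y - a) * derive1 (u ^~ t) y) x 1];
  sol_equation : forall x t, a < x < 1 -> 0 < t ->
    derive1 (u x) t - derive1 (fun y => (y - a) * derive1 (u ^~ t) y) x = 0;
  sol_dirichlet : forall t, 0 < t -> u 1 t = 0;
  sol_flux : forall t, 0 < t ->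
    (x - a) * derive1 (u ^~ t) x @[x --> a^'+] --> (0 : R);
  sol_initial : forall x, a < x < 1 -> u x 0 = u0 x
}.

(* At the right endpoint, the space derivative is one-sided. *)
Definition left_derivative (R : realType) (f : R -> R) (x : R) : R :=
  lim (h^-1 * (f (x + h) - f x) @[h --> 0^'-]).

(* Main.v *)
Require Import Defs.
From HB Require Import structures.
From mathcomp Require Import all_boot all_order all_algebra.
From mathcomp Require Import all_classical all_reals all_analysis.
From mathcomp Require Import measurable_realfun ring lra.

(** The change of variable [x = a + (1 - a) y] turns the problem on ]a, 1[ into
    the problem on ]0, 1[ observed at time [t / (1 - a)], with initial datum
    [y |-> u0 (a + (1 - a) y)]. The operator [(y u')'] on ]0, 1[ has an explicit
    inverse [K], a symmetric and negative integral operator: [(f, g)] is in the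
    graph exactly when [f] is almost everywhere the double primitive [Kfun] of
    [g] ([graph_A_of_Kfun], [Kfun_of_graph_A]). The rescaled semigroups thus all
    have generator [K^-1], and a semigroup is determined by its generator
    ([sgo_unique]), so one semigroup [S] on the space of square integrable
    functions on ]0, 1[ describes all the solutions.

    The left derivative of [K q] at 1 is the integral of [q]. Writing
    [S tau g = K q] and [S tau 1 = K w], the symmetry of [S] gives
    [ip q 1 = ip g w]: the flux at 1 is the pairing of the datum with one
    function [w] that depends on [a] through [tau = t / (1 - a)] only
    ([left_derivative_solution], [ip_inverse_sgo]). For large [tau] this function
    is governed by the first eigenvector [phi y = J0 (j1 sqrt y)], for which
    [K phi = - phi / m] with [m = j1^2 / 4]. On the orthogonal of [phi] the decay
    rate is at least 2, while [m < 2]. Indeed [- ip f (K f)] is the integral of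
    [F x ^ 2 / x], where [F x], the primitive of [f], is the inner product of [f]
    with the indicator of [0, x], whose squared norm is [x]. By Bessel's
    inequality, orthogonal unit vectors share at most the integral of [x / x],
    that is 1, and [phi] takes [1 / m > 1 / 2] of it ([spectral_gap]). Hence
    [w = - m c e^(- m tau) phi + K (K z)], where [c] is positive and [z] is of
    order [e^(- 2 tau)] ([sgo_asymptotics]).

    The flux is therefore a nonzero constant times
    [(1 - a)^-2 e^(- m t / (1 - a)) W a], plus a remainder, where [W a] is a
    multiple of [(1 - a) U10 a] ([U10E]) and so stays away from 0. Functions in
    the range of [K], such as [phi], are Lipschitz when the source is bounded;
    moving [a] into such a function shows that [W] is Lipschitz although [u0] is
    only continuous ([pairing_lipschitz]). The exponential factor decreases in [a]
    with a logarithmic slope of order [t]: for [t] large it beats the variation of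
    [W], and the remainder, whose Lipschitz constant is of order
    [(1 + t) e^(- 2 t / (1 - a))], is negligible because [m < 2]
    ([expansion_lower_bound]).

    Square integrable functions are used as they are, not as classes, so the
    Hilbert space arguments run in a complete space with a semi-inner product, in
    which equality is replaced by a difference of norm zero. Differentiation in
    time is replaced by [le_of_small_increments], applied to real functions built
    from a semigroup. *)

Import Order.TTheory GRing.Theory Num.Theory.
Import numFieldNormedType.Exports.

Local Open Scope classical_set_scope.
Local Open Scope ring_scope.

Set Implicit Arguments.
Unset Strict Implicit.
Unset Printing Implicit Defensive.

(** * Semi-inner product spaces *)

Lemma le_of_sqr (R : realType) (x y : R) : 0 <= y -> x ^+ 2 <= y ^+ 2 -> x <= y.
Proof. by move=> y0 xy; rewrite leNgt; apply/negP => yx; nra. Qed.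

Lemma sqr_le (R : realType) (x y : R) : 0 <= x -> x <= y -> x ^+ 2 <= y ^+ 2.
Proof. by move=> x0 xy; nra. Qed.

(** Definiteness is not required: two functions equal almost everywhere are
    different vectors at distance zero. *)
Record semi_inner_product (R : realType) (V : lmodType R) (ip : V -> V -> R) :
    Prop := {
  ipC : forall f g, ip f g = ip g f;
  ip_linear : forall c f g h, ip (c *: f + g) h = c * ip f h + ip g h;
  ip_ge0 : forall f, 0 <= ip f f
}.

Section SemiInner.
Variables (R : realType) (V : lmodType R) (ip : V -> V -> R).
Hypothesis ipP : semi_inner_product ip.

Definition nrm f := Num.sqrt (ip f f).
Definition null_eq f g := nrm (f - g) = 0.

Lemma nrmE f : nrm f = Num.sqrt (ip f f). Proof. by []. Qed.

Lemma ipDl f g h : ip (f + g) h = ip f h + ip g h.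
Proof. by have := ip_linear ipP 1 f g h; rewrite scale1r mul1r. Qed.

Lemma ip0l h : ip 0 h = 0.
Proof. by have := ip_linear ipP 1 0 0 h; rewrite scale1r mul1r addr0 => ?; lra. Qed.

Lemma ipZl c f h : ip (c *: f) h = c * ip f h.
Proof. by have := ip_linear ipP c f 0 h; rewrite addr0 ip0l addr0. Qed.

Lemma ipNl f h : ip (- f) h = - ip f h.
Proof. by rewrite -scaleN1r ipZl mulN1r. Qed.

Lemma ipBl f g h : ip (f - g) h = ip f h - ip g h.
Proof. by rewrite ipDl ipNl. Qed.

Lemma ipDr f g h : ip h (f + g) = ip h f + ip h g.
Proof. by rewrite ipC// ipDl !(ipC ipP h). Qed.

Lemma ipZr c f h : ip h (c *: f) = c * ip h f.
Proof. by rewrite ipC// ipZl (ipC ipP h). Qed.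

Lemma ipNr f h : ip h (- f) = - ip h f.
Proof. by rewrite ipC// ipNl (ipC ipP h). Qed.

Lemma ipBr f g h : ip h (f - g) = ip h f - ip h g.
Proof. by rewrite ipDr ipNr. Qed.

Definition ipE := (ipDl, ipDr, ipBl, ipBr, ipZl, ipZr, ipNl, ipNr).

Lemma nrm_ge0 f : 0 <= nrm f. Proof. exact: sqrtr_ge0. Qed.

Lemma sqr_nrm f : nrm f ^+ 2 = ip f f.
Proof. by rewrite sqr_sqrtr// ip_ge0. Qed.

(** The discriminant of the nonnegative polynomial [ip (f + x g) (f + x g)] in
    [x]; the degenerate case [ip g g = 0] uses a large multiple of [g]. *)
Lemma sqr_ip_le f g : ip f g ^+ 2 <= ip f f * ip g g.
Proof.
have H x : 0 <= ip f f + 2 * x * ip f g + x ^+ 2 * ip g g.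
  have := ip_ge0 ipP (f + x *: g); rewrite !ipE (ipC ipP g f); lra.
have g0 := ip_ge0 ipP g; have f0 := ip_ge0 ipP f.
have [gz|gN0] := eqVneq (ip g g) 0.
  rewrite gz mulr0; have [->|N] := eqVneq (ip f g) 0; first by rewrite expr0n.
  have := H (- (ip f f + 1) / (2 * ip f g)); rewrite gz mulr0 addr0.
  have -> : 2 * (- (ip f f + 1) / (2 * ip f g)) * ip f g = - (ip f f + 1).
    by field.
  lra.
have gp : 0 < ip g g by rewrite lt_neqAle eq_sym gN0.
have := H (- ip f g / ip g g).
have -> : ip f f + 2 * (- ip f g / ip g g) * ip f g +
   (- ip f g / ip g g) ^+ 2 * ip g g = (ip f f * ip g g - ip f g ^+ 2) / ip g g.
  by field.
by rewrite ler_pdivlMr// mul0r subr_ge0.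
Qed.

Lemma sqr_nrm_subZ f x g :
  nrm (f - x *: g) ^+ 2 = nrm f ^+ 2 - 2 * x * ip f g + x ^+ 2 * nrm g ^+ 2.
Proof. by rewrite !sqr_nrm !ipE (ipC ipP g f); ring. Qed.

Lemma sqr_nrmD f g :
  nrm (f + g) ^+ 2 = nrm f ^+ 2 + 2 * ip f g + nrm g ^+ 2.
Proof. by rewrite !sqr_nrm !ipE (ipC ipP g f); ring. Qed.

Lemma ip_le_nrm f g : `|ip f g| <= nrm f * nrm g.
Proof.
rewrite -(ler_pXn2r (n := 2))//; last first.
- by rewrite nnegrE mulr_ge0// nrm_ge0.
- by rewrite exprMn !sqr_nrm real_normK ?num_real// sqr_ip_le.
Qed.

Lemma ip_le f g : ip f g <= nrm f * nrm g.
Proof. exact: le_trans (ler_norm _) (ip_le_nrm f g). Qed.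

Lemma ip_ge f g : - (nrm f * nrm g) <= ip f g.
Proof. by have := ip_le_nrm f g; rewrite ler_norml => /andP[]. Qed.

Lemma nrmD f g : nrm (f + g) <= nrm f + nrm g.
Proof.
rewrite -(ler_pXn2r (n := 2))//; last first.
- by rewrite nnegrE addr_ge0// nrm_ge0.
- by rewrite nnegrE nrm_ge0.
rewrite sqrrD !sqr_nrm !ipE (ipC ipP g f).
have := ip_le f g; lra.
Qed.

Lemma nrmN f : nrm (- f) = nrm f.
Proof. by rewrite /nrm ipNl ipNr opprK. Qed.

Lemma nrmC f g : nrm (f - g) = nrm (g - f).
Proof. by rewrite -nrmN opprB. Qed.

Lemma nrmZ c f : nrm (c *: f) = `|c| * nrm f.
Proof.
by rewrite /nrm ipZl ipZr mulrA -expr2 sqrtrM ?sqr_ge0// sqrtr_sqr.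
Qed.

Lemma nrmB f g : nrm (f - g) <= nrm f + nrm g.
Proof. by rewrite -(nrmN g) nrmD. Qed.

Lemma nrm_dist f g h : nrm (f - h) <= nrm (f - g) + nrm (g - h).
Proof. by rewrite -[f - h](subrKA g) nrmD. Qed.

Lemma nrm0 : nrm 0 = 0.
Proof. by rewrite /nrm ip0l sqrtr0. Qed.

Lemma null_eq_ip f g : (forall h, ip f h = ip g h) -> null_eq f g.
Proof.
by move=> H; rewrite /null_eq /nrm ipBl !H subrr sqrtr0.
Qed.

Lemma ip_null_eq f g : null_eq f g -> forall h, ip f h = ip g h.
Proof.
move=> H h; apply/eqP; rewrite -subr_eq0 -ipBl -normr_eq0 eq_le normr_ge0 andbT.
by apply: le_trans (ip_le_nrm _ _) _; rewrite H mul0r.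
Qed.

Lemma null_eqP f g : null_eq f g <-> forall h, ip f h = ip g h.
Proof. by split; [exact: ip_null_eq|exact: null_eq_ip]. Qed.

Lemma null_eq_refl f : null_eq f f. Proof. exact/null_eqP. Qed.

Lemma null_eq_sym f g : null_eq f g -> null_eq g f.
Proof. by rewrite !null_eqP => H h; rewrite H. Qed.

Lemma null_eq_trans f g h : null_eq f g -> null_eq g h -> null_eq f h.
Proof. by rewrite !null_eqP => H1 H2 k; rewrite H1 H2. Qed.

Lemma ip_null_eqr f g : null_eq f g -> forall h, ip h f = ip h g.
Proof. by move=> H h; rewrite !(ipC ipP h) (ip_null_eq H). Qed.

Lemma nrm_null_eq f g : null_eq f g -> nrm f = nrm g.
Proof. by move=> H; rewrite /nrm (ip_null_eq H) (ip_null_eqr H). Qed.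

Lemma null_eqB f f' g g' : null_eq f f' -> null_eq g g' -> null_eq (f - g) (f' - g').
Proof. by rewrite !null_eqP => H1 H2 h; rewrite !ipE H1 H2. Qed.

Lemma null_eqD f f' g g' : null_eq f f' -> null_eq g g' -> null_eq (f + g) (f' + g').
Proof. by rewrite !null_eqP => H1 H2 h; rewrite !ipE H1 H2. Qed.

Lemma null_eqZ c f f' : null_eq f f' -> null_eq (c *: f) (c *: f').
Proof. by rewrite !null_eqP => H1 h; rewrite !ipE H1. Qed.

Lemma null_eq_small f g : (forall e, 0 < e -> nrm (f - g) <= e) -> null_eq f g.
Proof.
move=> H; apply/eqP; rewrite eq_le nrm_ge0 andbT.
by apply/ler_addgt0Pr => e e0; rewrite add0r H.
Qed.

Definition complete_ip :=
  forall x : nat -> V,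
    (forall e, 0 < e -> exists n0, forall m n, (n0 <= m)%N -> (n0 <= n)%N ->
      nrm (x m - x n) <= e) ->
    exists l, forall e, 0 < e -> exists n0, forall n, (n0 <= n)%N ->
      nrm (x n - l) <= e.

(** The class of a function acts linearly on equivalence classes; a choice of
    representatives is linear up to vectors of norm zero only. *)
Definition null_linear (T : V -> V) :=
  forall c f g, null_eq (T (c *: f + g)) (c *: T f + T g).

Section NullLinear.
Variable T : V -> V.
Hypothesis linT : null_linear T.

Lemma null_linear0 : null_eq (T 0) 0.
Proof.
apply/null_eqP => h; have /null_eqP/(_ h) := linT 1 0 0.
by rewrite scale1r addr0 !ipE mul1r ip0l => ?; lra.
Qed.

Lemma ip_TZ c f h : ip (T (c *: f)) h = c * ip (T f) h.
Proof.
have /null_eqP/(_ h) := linT c f 0; rewrite addr0 !ipE => ->.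
by rewrite (ip_null_eq null_linear0) ip0l addr0.
Qed.

Lemma ip_TD f g h : ip (T (f + g)) h = ip (T f) h + ip (T g) h.
Proof. by have /null_eqP/(_ h) := linT 1 f g; rewrite !ipE scale1r mul1r. Qed.

Lemma ip_TB f g h : ip (T (f - g)) h = ip (T f) h - ip (T g) h.
Proof. by rewrite ip_TD -scaleN1r ip_TZ mulN1r. Qed.

Lemma null_TB f g : null_eq (T (f - g)) (T f - T g).
Proof. by apply/null_eqP => h; rewrite ip_TB !ipE. Qed.

Lemma null_TD f g : null_eq (T (f + g)) (T f + T g).
Proof. by apply/null_eqP => h; rewrite ip_TD !ipE. Qed.

Lemma null_TZ c f : null_eq (T (c *: f)) (c *: T f).
Proof. by apply/null_eqP => h; rewrite ip_TZ !ipE. Qed.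

Lemma null_eq_bounded_map M f g : (forall f, nrm (T f) <= M * nrm f) ->
  null_eq f g -> null_eq (T f) (T g).
Proof.
move=> bdT fg; rewrite /null_eq -(nrm_null_eq (null_TB f g)).
by apply/eqP; rewrite eq_le nrm_ge0 andbT (le_trans (bdT _))// fg mulr0.
Qed.

End NullLinear.

End SemiInner.

(** * Two elementary principles *)

(** Increments of size [o(h)], uniformly in the starting point, add up to
    arbitrarily little over a subdivision of [0, t] into equal small steps. *)
Lemma le_of_small_increments (R : realType) (th : R -> R) (t : R) : 0 <= t ->
  (forall e, 0 < e -> exists2 d, 0 < d & forall s h, 0 <= s -> 0 < h < d ->
     s + h <= t -> th (s + h) - th s <= e * h) ->
  th t <= th 0.
Proof.
rewrite le_eqVlt => /predU1P[<-//|t0] H.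
apply/ler_addgt0Pr => e e0.
have et0 : 0 < e / t by rewrite divr_gt0.
have [d d0 {}H] := H _ et0.
have [n nP] : exists n : nat, t / d < n.+1%:R.
  exists (Num.truncn (t / d)); rewrite truncnS_gt//.
pose h := t / n.+1%:R.
have h0 : 0 < h by rewrite divr_gt0.
have hd : h < d by rewrite ltr_pdivrMr// mulrC -ltr_pdivrMr.
have tE : t = n.+1%:R * h by rewrite mulrC divfK.
have K k : (k <= n.+1)%N -> th (k%:R * h) <= th 0 + e / t * (k%:R * h).
  elim: k => [_|k IH kn]; first by rewrite mul0r mulr0 addr0.
  (* At most [e / t] times the elapsed time is gained on each step. *)
  have := IH (ltnW kn); have := H (k%:R * h) h.
  rewrite mulr_ge0 ?(ltW h0)// h0 hd -natr1 mulrDl mul1r => /(_ isT isT).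
  have -> : k%:R * h + h <= t.
    by rewrite tE -{2}[h]mul1r -mulrDl natr1 ler_pM2r// ler_nat.
  move=> /(_ isT); rewrite mulrDr; lra.
by have := K n.+1 (leqnn _); rewrite -tE divfK// gt_eqF.
Qed.

Lemma eps_scale (R : realType) (C e : R) : 0 <= C -> 0 < e ->
  exists2 e', 0 < e' <= 1 & e' * C <= e.
Proof.
move=> C0 e0; have D0 : 0 < C + 1 + e by lra.
exists (e / (C + 1 + e)).
  by rewrite divr_gt0//= ler_pdivrMr// mul1r; lra.
rewrite mulrAC ler_pdivrMr//; nra.
Qed.

Section UniformBoundedness.
Variables (R : realType) (V : lmodType R) (ip : V -> V -> R).
Hypothesis ipP : semi_inner_product ip.
Hypothesis complV : complete_ip ip.
Local Notation nrm := (nrm ip).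

(** The operator norm as a supremum over the unit ball, and a point of the ball
    that nearly attains it. *)
Lemma near_maximizer (T : V -> V) (m : R) : null_linear ip T ->
  (exists M, forall f, nrm (T f) <= M * nrm f) -> 0 <= m ->
  (exists f, m * nrm f < nrm (T f)) ->
  exists M x, [/\ forall f, nrm (T f) <= M * nrm f, nrm x <= 1,
    2 / 3 * M <= nrm (T x) & m <= M].
Proof.
move=> linT [B bdT] m0 [f0 f0P].
have ub : ubound [set nrm (T f) | f in [set f | nrm f <= 1]] (Num.max B 0).
  move=> _ [f /= f1 <-]; apply: le_trans (bdT _) _.
  have := nrm_ge0 ip f; rewrite le_max; case: (leP B 0) => B0 n0.
    by apply/orP; right; rewrite mulr_le0_ge0.
  by apply/orP; left; rewrite ler_piMr// ltW.
have hs : has_sup [set nrm (T f) | f in [set f | nrm f <= 1]].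
  by split; [exists (nrm (T 0)), 0 => //=; rewrite (nrm0 ipP)|exists (Num.max B 0)].
pose M := sup [set nrm (T f) | f in [set f | nrm f <= 1]].
have TM f : nrm (T f) <= M * nrm f.
  have [f0'|fN0] := eqVneq (nrm f) 0.
    by rewrite f0' mulr0; apply: le_trans (bdT _) _; rewrite f0' mulr0.
  have fp : 0 < nrm f by rewrite lt_neqAle eq_sym fN0 nrm_ge0.
  rewrite -ler_pdivrMr//.
  have -> : nrm (T f) / nrm f = nrm (T ((nrm f)^-1 *: f)).
    by rewrite (nrm_null_eq ipP (null_TZ ipP linT _ _)) (nrmZ ipP) gtr0_norm
      ?invr_gt0// mulrC.
  apply: sup_ubound; first exact: hs.2.
  by exists ((nrm f)^-1 *: f) => //=; rewrite (nrmZ ipP) gtr0_norm ?invr_gt0// mulVf.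
have f00 : 0 < nrm f0.
  rewrite lt_neqAle nrm_ge0 andbT eq_sym; apply/negP => /eqP f00.
  by have := bdT f0; rewrite f00 mulr0 leNgt; move: f0P; rewrite f00 mulr0 => ->.
have mM : m <= M.
  by rewrite -(ler_pM2r f00) (le_trans (ltW f0P)).
have [M0|M0] := ltP 0 M; last first.
  exists M, 0; split => //; first by rewrite (nrm0 ipP).
  by rewrite (le_trans _ (nrm_ge0 _ _))//; lra.
have [|_ [x /= x1 <-] xP] := sup_adherent (eps := M / 3) _ hs.
  by rewrite divr_gt0.
exists M, x; split => //; move: xP; rewrite -/M; lra.
Qed.

(** The steps [4^-n x_n], with [x_n] almost maximising [T n] and with signs
    chosen so that no step cancels the earlier ones, sum to a point at which
    every [T n] is large. *)
Lemma gliding_hump (T : nat -> V -> V) :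
  (forall n, null_linear ip (T n)) ->
  (forall n, exists M, forall f, nrm (T n f) <= M * nrm f) ->
  (forall n, exists f, 16 ^+ n * nrm f < nrm (T n f)) ->
  exists x, forall n, 4 ^+ n / 3 <= nrm (T n x).
Proof.
move=> linT bdT bigT.
have /choice[M /choice[x xP]] : forall n, exists M x,
    [/\ forall f, nrm (T n f) <= M * nrm f, nrm x <= 1,
    2 / 3 * M <= nrm (T n x) & 16 ^+ n <= M].
  by move=> n; apply: near_maximizer.
pose xi n := (4^-1) ^+ n *: x n.
pose y := fix y n := if n is k.+1 then
  (if nrm (T k (xi k)) <= nrm (T k (y k + xi k)) then y k + xi k else y k - xi k)
  else 0.
have q0 n : 0 < (4^-1 : R) ^+ n by rewrite exprn_gt0.
have xi_le n : nrm (xi n) <= (4^-1) ^+ n.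
  have [_ x1 _ _] := xP n.
  by rewrite /xi (nrmZ ipP) gtr0_norm// ler_piMr// ltW.
have stepy n : nrm (y n.+1 - y n) <= (4^-1) ^+ n.
  rewrite /=; case: ifP => _; rewrite addrAC subrr add0r ?(nrmN ipP)//.
have bigy n : nrm (T n (xi n)) <= nrm (T n (y n.+1)).
  (* One of [y + xi] and [y - xi] has a large image: their images differ by twice that of [xi]. *)
  rewrite /=; case: ifPn => //; rewrite -ltNge => small.
  have : nrm (T n (xi n) + T n (xi n)) <=
      nrm (T n (y n + xi n)) + nrm (T n (y n - xi n)).
    apply: le_trans (nrmB ipP _ _).
    rewrite le_eqVlt; apply/orP; left; apply/eqP/nrm_null_eq => //.
    apply/(null_eqP ipP) => h.
    by rewrite !(ipE ipP) (ip_TD ipP (linT n)) (ip_TB ipP (linT n)); ring.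
  rewrite -mulr2n -scaler_nat (nrmZ ipP) normr_nat; lra.
have tail m p : nrm (y (p + m)%N - y m) <= 4 / 3 * ((4^-1) ^+ m - (4^-1) ^+ (p + m)).
  elim: p => [|p IH]; first by rewrite add0n !subrr (nrm0 ipP) mulr0.
  rewrite addSn; apply: le_trans (nrm_dist ipP _ (y (p + m)%N) _) _.
  have := stepy (p + m)%N; rewrite exprS; lra.
have tail' m n : (m <= n)%N -> nrm (y n - y m) <= 4 / 3 * (4^-1) ^+ m.
  move=> mn; have := tail m (n - m)%N; rewrite subnK//; have := q0 n; lra.
have [|l lP] := complV (x := y).
  move=> e e0.
  have [n0 n0P] : exists n0, (4^-1 : R) ^+ n0 < e / 3.
    have : (4^-1 : R) ^+ n @[n --> \oo] --> (0 : R).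
      by apply: cvg_expr; rewrite ger0_norm//; lra.
    move=> /cvgrPdist_lt/(_ (e / 3)); rewrite divr_gt0// => /(_ isT) [n0 _ n0P].
    by exists n0; have := n0P n0 (leqnn _); rewrite /= sub0r normrN gtr0_norm.
  exists n0 => m n n0m n0n.
  apply: le_trans (nrm_dist ipP _ (y n0) _) _; rewrite (nrmC ipP (y n0)).
  have := tail' _ _ n0m; have := tail' _ _ n0n; lra.
have lE n : nrm (l - y n) <= 4 / 3 * (4^-1) ^+ n.
  apply/ler_addgt0Pr => e e0; have [n0 n0P] := lP _ e0.
  apply: le_trans (nrm_dist ipP _ (y (maxn n0 n)) _) _.
  rewrite addrC lerD ?tail' ?leq_maxr//.
  by rewrite (nrmC ipP) n0P// leq_maxl.
exists l => n.
have [TM x1 Tx Mn] := xP n.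
have M0 : 0 <= M n by apply: le_trans Mn; rewrite exprn_ge0.
(* The later steps change the image by at most half of [2 / 3 * M n * 4^-n]. *)
have h1 : nrm (T n (y n.+1)) <= nrm (T n l) + M n * (4 / 3 * (4^-1) ^+ n.+1).
  have -> : nrm (T n (y n.+1)) = nrm (T n l - T n (l - y n.+1)).
    apply/nrm_null_eq => //; apply/(null_eqP ipP) => h.
    by rewrite !(ipE ipP) (ip_TB ipP (linT n)); ring.
  apply: le_trans (nrmB ipP _ _) _; rewrite lerD2l.
  by apply: le_trans (TM _) _; rewrite ler_wpM2l.
have h2 : (4^-1) ^+ n * (2 / 3 * M n) <= nrm (T n (xi n)).
  by rewrite (nrm_null_eq ipP (null_TZ ipP (linT n) _ _)) (nrmZ ipP)
    gtr0_norm// ler_pM2l.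
have h3 : 4 ^+ n <= M n * (4^-1) ^+ n.
  have -> : (4 : R) ^+ n = 16 ^+ n * (4^-1) ^+ n.
    by rewrite -exprMn; congr (_ ^+ _); lra.
  by rewrite ler_pM2r.
have := bigy n; move: h1; rewrite exprS; lra.
Qed.

End UniformBoundedness.

(** * Semigroups whose generator has a given inverse *)

Section Semigroup.
Variables (R : realType) (V : lmodType R) (ip : V -> V -> R).
Hypothesis ipP : semi_inner_product ip.
Hypothesis complV : complete_ip ip.
Local Notation nrm := (nrm ip).
Local Notation "f === g" := (null_eq ip f g) (at level 70).

(** The bounded inverse of a negative self-adjoint operator with dense domain.
    Working with it avoids partially defined operators: the domain is its range. *)
Record negative_inverse (K : V -> V) (B : R) : Prop := {
  ninv_linear : null_linear ip K;
  ninv_bounded : forall f, nrm (K f) <= B * nrm f;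
  ninv_sym : forall f g, ip (K f) g = ip f (K g);
  ninv_le0 : forall f, ip f (K f) <= 0;
  ninv_inj : forall f, nrm (K f) = 0 -> nrm f = 0
}.

(** Strongly continuous semigroups whose generator is the inverse of [K]: the
    last two fields are the two inclusions between the graphs. *)
Record semigroup_of (K : V -> V) (S : R -> V -> V) : Prop := {
  sgo_linear : forall t, 0 <= t -> null_linear ip (S t);
  sgo_bounded : forall t, 0 <= t -> exists M, forall f, nrm (S t f) <= M * nrm f;
  sgo_0 : forall f, S 0 f === f;
  sgo_add : forall s t f, 0 <= s -> 0 <= t -> S (s + t) f === S s (S t f);
  sgo_cont : forall f e, 0 < e -> exists2 d, 0 < d &
    forall h, 0 < h < d -> nrm (S h f - f) <= e;
  sgo_deriv : forall g e, 0 < e -> exists2 d, 0 < d &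
    forall h, 0 < h < d -> nrm (h^-1 *: (S h (K g) - K g) - g) <= e;
  sgo_range : forall f g, (forall e, 0 < e -> exists2 d, 0 < d &
    forall h, 0 < h < d -> nrm (h^-1 *: (S h f - f) - g) <= e) -> f === K g
}.

Variables (K : V -> V) (B : R).
Hypothesis KP : negative_inverse K B.

Let linK := ninv_linear KP.
Let KE := (ip_TB ipP linK, ip_TD ipP linK, ip_TZ ipP linK).

Lemma ninv_eq f g : f === g -> K f === K g.
Proof. exact: (null_eq_bounded_map ipP linK (ninv_bounded KP)). Qed.

Lemma ninv_eq_inj f g : K f === K g -> f === g.
Proof.
by move=> fg; apply: (ninv_inj KP); rewrite (nrm_null_eq ipP (null_TB ipP linK _ _)).
Qed.

(** The distance from [f] to the range of [K] is attained in the limit by a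
    minimising sequence, Cauchy by the parallelogram law; the difference between
    [f] and the limit is orthogonal to the range, hence in the kernel of [K]. *)
Lemma dense_range f e : 0 < e -> exists g, nrm (f - K g) <= e.
Proof.
move=> e0.
pose D := [set nrm (f - K g) ^+ 2 | g in [set: V]].
have hD : has_inf D.
  by split; [exists (nrm (f - K 0) ^+ 2), 0|exists 0 => _ [g _ <-]; exact: sqr_ge0].
pose d := inf D.
have dD g : d <= nrm (f - K g) ^+ 2 by apply: (ge_inf hD.2); exists g.
have /choice[g gP] : forall n : nat, exists g,
    nrm (f - K g) ^+ 2 < d + n.+1%:R^-1.
  move=> n; have [|_ [g _ <-] gP] := inf_adherent (eps := n.+1%:R^-1) _ hD.
    by rewrite invr_gt0.
  by exists g.
(* The parallelogram law for [f - K a] and [f - K b]. *)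
have para a b : nrm (K a - K b) ^+ 2 =
    2 * nrm (f - K a) ^+ 2 + 2 * nrm (f - K b) ^+ 2 -
    4 * nrm (f - K (2^-1 *: (a + b))) ^+ 2.
  have -> : nrm (K a - K b) = nrm ((f - K a) - (f - K b)).
    by rewrite (nrmC ipP); congr (nrm _); rewrite opprB [RHS]addrC addrA subrK.
  have -> : 4 * nrm (f - K (2^-1 *: (a + b))) ^+ 2 =
      nrm ((f - K a) + (f - K b)) ^+ 2.
    have -> : nrm ((f - K a) + (f - K b)) = nrm (2 *: (f - K (2^-1 *: (a + b)))).
      apply: (nrm_null_eq ipP); apply/(null_eqP ipP) => h.
      by rewrite !(ipE ipP) !KE; field.
    by rewrite (nrmZ ipP) normr_nat exprMn; ring.
  by rewrite !(sqr_nrm ipP) !(ipE ipP); ring.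
have cauchy e1 : 0 < e1 -> exists n0, forall m n, (n0 <= m)%N -> (n0 <= n)%N ->
    nrm (K (g m) - K (g n)) <= e1.
  move=> e10; pose N := Num.truncn (4 / e1 ^+ 2).
  have NP : 4 / e1 ^+ 2 < N.+1%:R by rewrite truncnS_gt.
  have NP' : 4 * N.+1%:R^-1 < e1 ^+ 2.
    rewrite ltr_pdivrMr// mulrC -ltr_pdivrMr// exprn_gt0//.
  have inv n : (N <= n)%N -> (n.+1%:R^-1 : R) <= N.+1%:R^-1.
    by move=> Nn; rewrite lef_pV2 ?posrE// ler_nat.
  exists N => m n /inv Nm /inv Nn.
  rewrite -(ler_pXn2r (n := 2)) ?nnegrE ?(nrm_ge0 ip) ?ltW//.
  rewrite para; have := gP m; have := gP n.
  have := dD (2^-1 *: (g m + g n)).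
  move: Nm Nn NP'; move: (m.+1%:R^-1) (n.+1%:R^-1) (N.+1%:R^-1) => im i_n iN.
  lra.
have [l lP] := complV cauchy.
have dn0 : 0 <= d by apply: lb_le_inf hD.1 _ => _ [x _ <-]; exact: sqr_ge0.
have sd := sqr_sqrtr dn0.
have s0 := sqrtr_ge0 d.
have fl2 : nrm (f - l) ^+ 2 <= d.
  rewrite -sd; apply: sqr_le; first exact: nrm_ge0.
  apply/ler_addgt0Pr => e1 e10.
  have e20 : 0 < e1 / 2 by rewrite divr_gt0.
  have [n0 n0P] := lP _ e20.
  pose N := Num.truncn (4 / e1 ^+ 2).
  have NP : 4 / e1 ^+ 2 < N.+1%:R by rewrite truncnS_gt.
  pose n := maxn n0 N.
  have nP : (n.+1%:R^-1 : R) <= (e1 / 2) ^+ 2.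
    apply: (@le_trans _ _ N.+1%:R^-1).
      by rewrite lef_pV2 ?posrE// ler_nat ltnS leq_maxr.
    rewrite invf_ple ?posrE ?exprn_gt0//; apply: le_trans (ltW NP).
    by rewrite expr_div_n invf_div -natrX.
  apply: le_trans (nrm_dist ipP _ (K (g n)) _) _.
  have := n0P n (leq_maxl _ _).
  suff : nrm (f - K (g n)) <= Num.sqrt d + e1 / 2 by lra.
  apply: le_of_sqr; first by rewrite addr_ge0// ltW.
  apply: le_trans (ltW (gP n)) _; rewrite sqrrD sd.
  have := mulr_ge0 s0 (ltW e20); move: (_%:R^-1) nP => ? ?; lra.
have orth h : ip (f - l) (K h) = 0.
  have H x : 0 <= - 2 * x * ip (f - l) (K h) + x ^+ 2 * nrm (K h) ^+ 2.
    suff : nrm (f - l) ^+ 2 <= nrm (f - l - x *: K h) ^+ 2.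
      by rewrite (sqr_nrm_subZ ipP); lra.
    apply: le_trans fl2 _.
    rewrite -sd; apply: sqr_le => //.
    apply/ler_addgt0Pr => e1 e10; have [n0 n0P] := lP _ e10.
    have := n0P _ (leqnn _) => lg.
    apply: (@le_trans _ _ (nrm (f - K (g n0 + x *: h)))).
      by apply: le_of_sqr; [exact: nrm_ge0|rewrite sd dD].
    have -> : nrm (f - K (g n0 + x *: h)) = nrm ((f - l - x *: K h) - (K (g n0) - l)).
      apply: (nrm_null_eq ipP); apply/(null_eqP ipP) => k.
      by rewrite !(ipE ipP) !KE; ring.
    by apply: le_trans (nrmB ipP _ _) _; rewrite lerD2l.
  apply/eqP/negPn/negP => N0.
  have np : 0 <= nrm (K h) ^+ 2 by exact: sqr_ge0.
  have D0 : 0 < nrm (K h) ^+ 2 + 1 by lra.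
  have := H (ip (f - l) (K h) / (nrm (K h) ^+ 2 + 1)).
  set a := ip _ _ in N0 *; set b := nrm _ ^+ 2 in np D0 *.
  have -> : - 2 * (a / (b + 1)) * a + (a / (b + 1)) ^+ 2 * b =
      - (a ^+ 2 * (b + 2) / (b + 1) ^+ 2) by field; rewrite gt_eqF.
  have : 0 < a ^+ 2 * (b + 2) / (b + 1) ^+ 2.
    rewrite divr_gt0 ?exprn_gt0// mulr_gt0//; last lra.
    by rewrite lt_neqAle sqr_ge0 eq_sym sqrf_eq0 N0.
  lra.
have fl0 : nrm (f - l) = 0.
  apply: (ninv_inj KP); rewrite nrmE (ninv_sym KP).
  have -> : ip (f - l) (K (K (f - l))) = 0 by exact: orth.
  by rewrite sqrtr0.
have [n0 n0P] := lP _ e0; exists (g n0).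
apply: le_trans (nrm_dist ipP _ l _) _.
by rewrite fl0 add0r (nrmC ipP) n0P.
Qed.

End Semigroup.

(** * Local boundedness and decay *)

Section SemigroupLemmas.
Variables (R : realType) (V : lmodType R) (ip : V -> V -> R).
Hypothesis ipP : semi_inner_product ip.
Hypothesis complV : complete_ip ip.
Local Notation nrm := (nrm ip).
Local Notation "f === g" := (null_eq ip f g) (at level 70).
Variables (K : V -> V) (B : R).
Hypothesis KP : negative_inverse ip K B.

Let linK := ninv_linear KP.
Let eqK := ninv_eq ipP KP.

Section OneSemigroup.
Variable S : R -> V -> V.
Hypothesis SP : semigroup_of ip K S.

Let linS t (t0 : 0 <= t) := sgo_linear SP t0.

Lemma sgo_eq t f g : 0 <= t -> f === g -> S t f === S t g.
Proof.
move=> t0; have [M bM] := sgo_bounded SP t0.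
exact: (null_eq_bounded_map ipP (linS t0) bM).
Qed.

Lemma sgo_addC s t f : 0 <= s -> 0 <= t -> S s (S t f) === S t (S s f).
Proof.
move=> s0 t0; apply: (null_eq_trans ipP (null_eq_sym ipP (sgo_add SP _ s0 t0))).
by rewrite addrC; exact: (sgo_add SP).
Qed.

(** Otherwise some operators [S h] with [h] tending to 0 have rapidly growing
    norms, and a gliding hump contradicts the continuity of an orbit at 0. *)
Lemma sgo_bounded_near0 : exists2 d, 0 < d &
  exists M, forall s f, 0 <= s <= d -> nrm (S s f) <= M * nrm f.
Proof.
apply: contrapT => nbd.
have /choice[h hP] : forall n : nat, exists h, 0 < h < n.+1%:R^-1 /\
    exists f, 16 ^+ n * nrm f < nrm (S h f).
  move=> n; apply: contrapT => H; apply: nbd.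
  have n0 : 0 < (n.+1%:R^-1 : R) by rewrite invr_gt0.
  exists (n.+1%:R^-1 / 2); first by rewrite divr_gt0.
  exists (16 ^+ n) => s f /andP[s0 sn]; rewrite leNgt; apply/negP => big.
  move: s0; rewrite le_eqVlt => /predU1P[s0|s0].
    move: big; rewrite -s0 (nrm_null_eq ipP (sgo_0 SP f)) ltNge => /negP; apply.
    by rewrite ler_peMl ?nrm_ge0// exprn_ege1 ?ler1n//.
  apply: H; exists s; split; last by exists f.
  by rewrite s0/= (le_lt_trans sn)// ltr_pdivrMr// ltr_pMr// ltr1n.
have h0 n : 0 <= h n by have [/andP[/ltW]] := hP n.
have [|x xP] := gliding_hump ipP complV (fun n => linS (h0 n)) _ (fun n => (hP n).2).
  by move=> n; exact: (sgo_bounded SP).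
have [d d0 dP] := sgo_cont SP x ltr01.
pose C := Num.truncn (3 * (nrm x + 1) + d^-1).
have CP : 3 * (nrm x + 1) + d^-1 < C.+1%:R by rewrite truncnS_gt.
have d'0 : 0 < d^-1 by rewrite invr_gt0.
have [/andP[hC0 hCd] _] := hP C.
have hd : h C < d.
  apply: lt_trans hCd _; rewrite invf_plt ?posrE//; move: CP d'0 (nrm_ge0 ip x).
  by move: (C.+1%:R) (d^-1) (nrm x) => c d1 nx; lra.
have := dP (h C); rewrite hC0 hd => /(_ isT).
have := xP C.
have C4 : (C.+1%:R : R) <= 4 ^+ C.
  elim: (C) => [//|k IH]; rewrite exprS -natr1.
  have : 1 <= (4 : R) ^+ k by rewrite exprn_ege1 ?ler1n//.
  lra.
have := nrmD ipP (S (h C) x - x) x; rewrite subrK.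
move: (C.+1%:R) CP C4 => c ? ?; lra.
Qed.

(** The bound near 0 is propagated by the semigroup law. *)
Lemma sgo_locally_bounded t : exists2 M, 0 <= M &
  forall s f, 0 <= s <= t -> nrm (S s f) <= M * nrm f.
Proof.
have [d d0 [M MP]] := sgo_bounded_near0.
pose M' := Num.max M 1.
have M1 : 1 <= M' by rewrite le_max lexx orbT.
have M'P s f : 0 <= s <= d -> nrm (S s f) <= M' * nrm f.
  move=> /MP/le_trans; apply; rewrite ler_wpM2r ?nrm_ge0//.
  by rewrite le_max lexx.
have H n s f : 0 <= s <= n.+1%:R * d -> nrm (S s f) <= M' ^+ n.+1 * nrm f.
  elim: n s f => [|n IH] s f; first by rewrite mul1r expr1; exact: M'P.
  case/andP=> s0; have [sd|sd] := leP s d => sn.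
    apply: le_trans (M'P _ _ _) _; first by rewrite s0.
    by rewrite ler_wpM2r ?nrm_ge0// ler_eXnr.
  have sd0 : 0 <= s - d by lra.
  rewrite -(subrK d s) (nrm_null_eq ipP (sgo_add SP _ sd0 (ltW d0))).
  apply: le_trans (IH _ _ _) _.
    by rewrite sd0/=; move: sn; rewrite -[in _.+2%:R]natr1 mulrDl; lra.
  rewrite [M' ^+ n.+2]exprSr -mulrA ler_wpM2l ?exprn_ge0//; first lra.
  by apply: M'P; lra.
exists (M' ^+ (Num.truncn (t / d)).+1); first by rewrite exprn_ge0//; lra.
move=> s f /andP[s0 st]; apply: H; rewrite s0/=; apply: le_trans st _.
by rewrite -ler_pdivrMr// ltW// truncnS_gt.
Qed.

(** The difference quotient of [S t (K g)] at 0 is [S t] applied to the one of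
    [K g], so [S t (K g)] is in the domain with image [S t g]. *)
Lemma sgo_commutes t g : 0 <= t -> S t (K g) === K (S t g).
Proof.
move=> t0; apply: (sgo_range SP) => e e0.
have [M M0 MP] := sgo_locally_bounded t.
have [e' /andP[e'0 _] e'P] := eps_scale M0 e0.
have [d d0 dP] := sgo_deriv SP g e'0.
exists d => // h /andP[h0 hd].
have h0' := ltW h0.
have -> : nrm (h^-1 *: (S h (S t (K g)) - S t (K g)) - S t g) =
    nrm (S t (h^-1 *: (S h (K g) - K g) - g)).
  apply: (nrm_null_eq ipP); apply/(null_eqP ipP) => k.
  rewrite !(ipE ipP) (ip_TB ipP (linS t0)) (ip_TZ ipP (linS t0)).
  by rewrite (ip_TB ipP (linS t0)) (ip_null_eq ipP (sgo_addC _ h0' t0)).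
apply: le_trans (MP _ _ _) _; first by rewrite t0 lexx.
by apply: le_trans e'P; rewrite mulrC ler_wpM2r// dP// h0 hd.
Qed.

(** The derivative of an orbit in the domain, with an error uniform in the
    starting time. *)
Lemma sgo_step t g e : 0 < e -> exists2 d, 0 < d &
  forall s h, 0 <= s <= t -> 0 < h < d ->
    nrm (S (s + h) (K g) - S s (K g) - h *: S s g) <= e * h.
Proof.
move=> e0; have [M M0 MP] := sgo_locally_bounded t.
have [e' /andP[e'0 _] e'P] := eps_scale M0 e0.
have [d d0 dP] := sgo_deriv SP g e'0.
exists d => // s h /andP[s0 st] /andP[h0 hd].
have -> : nrm (S (s + h) (K g) - S s (K g) - h *: S s g) =
    nrm (S s (h *: (h^-1 *: (S h (K g) - K g) - g))).
  apply: (nrm_null_eq ipP); apply/(null_eqP ipP) => k.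
  rewrite !(ipE ipP) (ip_TZ ipP (linS s0)) (ip_TB ipP (linS s0)).
  rewrite (ip_TZ ipP (linS s0)) (ip_TB ipP (linS s0)).
  rewrite (ip_null_eq ipP (sgo_add SP _ s0 (ltW h0))).
  by field; rewrite gt_eqF.
apply: le_trans (MP _ _ _) _; first by rewrite s0 st.
have : nrm (h^-1 *: (S h (K g) - K g) - g) <= e' by apply: dP; rewrite h0 hd.
rewrite (nrmZ ipP) (gtr0_norm h0) => H.
rewrite mulrCA [e * h]mulrC; apply: (ler_wpM2l (ltW h0)).
by apply: le_trans e'P; rewrite mulrC ler_wpM2r.
Qed.

(** The squared norm [|S t (K g)|^2] has derivative
    [2 ip (S t g) (S t (K g))], at most [- 2 la] times itself. *)
Lemma sgo_decay_range la g t : 0 <= la -> 0 <= t ->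
  (forall s, 0 <= s -> ip (S s g) (K (S s g)) <= - la * nrm (K (S s g)) ^+ 2) ->
  expR (2 * la * t) * nrm (S t (K g)) ^+ 2 <= nrm (K g) ^+ 2.
Proof.
move=> la0 t0 gap.
pose th s := expR (2 * la * s) * nrm (S s (K g)) ^+ 2.
suff : th t <= th 0.
  by rewrite /th mulr0 expR0 mul1r (nrm_null_eq ipP (sgo_0 SP _)).
apply: le_of_small_increments => // e e0.
have [M M0 MP] := sgo_locally_bounded t.
pose G := M * nrm (K g); pose G1 := M * nrm g.
have G0 : 0 <= G by rewrite mulr_ge0 ?nrm_ge0.
have G10 : 0 <= G1 by rewrite mulr_ge0 ?nrm_ge0.
pose W := expR (2 * la * t).
have W0 : 0 < W by exact: expR_gt0.
have C0 : 0 <= W * (2 * G + (G1 + 1) ^+ 2).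
  by rewrite mulr_ge0 ?(ltW W0)// addr_ge0 ?sqr_ge0// mulr_ge0.
have [e' /andP[e'0 e'1] e'P] := eps_scale C0 e0.
have [d d0 dP] := sgo_step t g e'0.
exists (Num.min d e'); first by rewrite lt_min d0 e'0.
move=> s h s0 /andP[h0]; rewrite lt_min => /andP[hd he'] sht.
pose x := S s (K g); pose r := S (s + h) (K g) - x - h *: S s g.
have rP : nrm r <= e' * h by apply: dP; rewrite ?s0 ?h0//=; lra.
have xG : nrm x <= G by apply: MP; rewrite s0/=; lra.
have gG : nrm (S s g) <= G1 by apply: MP; rewrite s0/=; lra.
have xE : S (s + h) (K g) = x + (h *: S s g + r).
  by rewrite /r [h *: _ + _]addrC subrK [x + _]addrC subrK.
have xK : x === K (S s g) by exact: sgo_commutes.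
have q : ip (S s g) x <= - la * nrm x ^+ 2.
  by rewrite (ip_null_eqr ipP xK) (nrm_null_eq ipP xK) gap.
have n1 : nrm (S (s + h) (K g)) ^+ 2 <=
    (1 - 2 * la * h) * nrm x ^+ 2 + h * e' * (2 * G + (G1 + 1) ^+ 2).
  rewrite xE (sqr_nrmD ipP).
  have z1 : nrm (h *: S s g + r) <= h * (G1 + 1).
    apply: le_trans (nrmD ipP _ _) _; rewrite (nrmZ ipP) (gtr0_norm h0).
    have := nrm_ge0 ip r; nra.
  have z2 : nrm (h *: S s g + r) ^+ 2 <= h * e' * (G1 + 1) ^+ 2.
    apply: le_trans (sqr_le (nrm_ge0 _ _) z1) _.
    by rewrite exprMn ler_wpM2r ?sqr_ge0// expr2 ler_wpM2l// ltW.
  have z3 : ip x r <= G * (e' * h).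
    by apply: le_trans (ip_le ipP _ _) _; rewrite ler_pM ?nrm_ge0.
  rewrite (ipDr ipP) (ipZr ipP) (ipC ipP x (S s g)).
  have := ler_wpM2l (ltW h0) q; move: z2 z3.
  by move: (nrm _ ^+ 2) (nrm x ^+ 2) (ip x r) (ip _ x) => *; lra.
have lah : 0 <= 2 * la * h by rewrite !mulr_ge0// ltW.
(* The exponential weight compensates the decrease by the factor [1 - 2 la h]. *)
have ex : expR (2 * la * h) * (1 - 2 * la * h) <= 1.
  have := expR_ge1Dx (- (2 * la * h)); rewrite expRN => H.
  by rewrite mulrC -ler_pdivlMr ?expR_gt0// mul1r.
have WW : expR (2 * la * (s + h)) <= W.
  by rewrite ler_expR ler_wpM2l// mulr_ge0.
have h3 : expR (2 * la * (s + h)) * (h * e' * (2 * G + (G1 + 1) ^+ 2)) <= e * h.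
  have z0 : 0 <= h * e' * (2 * G + (G1 + 1) ^+ 2).
    by rewrite mulr_ge0 ?(mulr_ge0 (ltW h0) (ltW e'0))// addr_ge0 ?sqr_ge0// mulr_ge0.
  apply: le_trans (ler_wpM2r z0 WW) _.
  have -> : W * (h * e' * (2 * G + (G1 + 1) ^+ 2)) =
    (e' * (W * (2 * G + (G1 + 1) ^+ 2))) * h by ring.
  by rewrite ler_wpM2r// ltW.
have h4 : expR (2 * la * (s + h)) * ((1 - 2 * la * h) * nrm x ^+ 2) <=
    expR (2 * la * s) * nrm x ^+ 2.
  rewrite mulrDr expRD -mulrA ler_wpM2l ?expR_ge0// mulrA.
  by rewrite -{2}[nrm x ^+ 2]mul1r ler_wpM2r ?sqr_ge0.
have := ler_wpM2l (expR_ge0 (2 * la * (s + h))) n1.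
rewrite /th -/x [X in _ <= X -> _]mulrDr; move: h3 h4.
set p1 := expR _ * _; set p2 := expR _ * (_ * _); set p3 := expR _ * nrm x ^+ 2.
by set p4 := expR _ * _; move=> *; lra.
Qed.

(** On the range of [K] this is the decay estimate with rate 0; the range is
    dense and [S t] is bounded. *)
Lemma sgo_contraction t f : 0 <= t -> nrm (S t f) <= nrm f.
Proof.
move=> t0; have [M M0 MP] := sgo_locally_bounded t.
have H g : nrm (S t (K g)) <= nrm (K g).
  apply: le_of_sqr; first exact: nrm_ge0.
  have := sgo_decay_range (g := g) (lexx 0) t0.
  by rewrite mulr0 mul0r expR0 mul1r; apply => s s0; rewrite oppr0 mul0r (ninv_le0 KP).
apply/ler_addgt0Pr => e e0.
have M1 : 0 <= M + 1 by lra.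
have [e' /andP[e'0 e'1] e'P] := eps_scale M1 e0.
have [g gP] := dense_range ipP complV KP f e'0.
have h1 : nrm (S t f) <= nrm (S t (K g)) + nrm (S t (f - K g)).
  have -> : nrm (S t f) = nrm (S t (K g) + S t (f - K g)).
    apply: (nrm_null_eq ipP); apply/(null_eqP ipP) => k.
    by rewrite !(ipE ipP) (ip_TB ipP (linS t0)); ring.
  exact: nrmD.
have h2 : nrm (S t (f - K g)) <= M * e'.
  apply: le_trans (MP _ _ _) _; first by rewrite t0/=.
  by rewrite ler_wpM2l.
have h3 : nrm (K g) <= nrm f + e'.
  have := nrmB ipP f (f - K g); rewrite opprB addrCA subrr addr0 => h; lra.
have := H g; lra.
Qed.

Lemma sgo_cstep t g e : 0 < e -> exists2 d, 0 < d &
  forall s h, 0 <= s <= t -> 0 < h < d -> exists2 r,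
    S (s + h) (K g) = S s (K g) + (h *: S s g + r) & nrm r <= e * h.
Proof.
move=> e0; have [d d0 dP] := sgo_step t g e0.
exists d => // s h st hd.
by exists (S (s + h) (K g) - S s (K g) - h *: S s g);
  [rewrite [h *: _ + _]addrC subrK [S s _ + _]addrC subrK|exact: dP].
Qed.

End OneSemigroup.
End SemigroupLemmas.

(** * Symmetry, smoothing and large time asymptotics *)

Section SemigroupLemmas2.
Variables (R : realType) (V : lmodType R) (ip : V -> V -> R).
Hypothesis ipP : semi_inner_product ip.
Hypothesis complV : complete_ip ip.
Local Notation nrm := (nrm ip).
Local Notation "f === g" := (null_eq ip f g) (at level 70).
Variables (K : V -> V) (B : R).
Hypothesis KP : negative_inverse ip K B.

Let linK := ninv_linear KP.
Let eqK := ninv_eq ipP KP.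

(** For [f] and [g] in the range of [K], [s |-> ip (S1 (t - s) f) (S2 s g)] has
    derivative zero, both generators being the same symmetric operator. *)
Lemma sgo_sym_le S1 S2 f g t : semigroup_of ip K S1 -> semigroup_of ip K S2 ->
  0 <= t -> ip (K f) (S2 t (K g)) <= ip (S1 t (K f)) (K g).
Proof.
move=> SP1 SP2 t0.
pose th s := ip (S1 (t - s) (K f)) (S2 s (K g)).
suff : th t <= th 0.
  rewrite /th subrr subr0 (ip_null_eq ipP (sgo_0 SP1 _)).
  by rewrite (ip_null_eqr ipP (sgo_0 SP2 _)).
apply: le_of_small_increments => // e e0.
have C0 : 0 <= nrm (K f) + nrm (K g) by rewrite addr_ge0// nrm_ge0.
have [e' /andP[e'0 _] e'P] := eps_scale C0 e0.
have [d1 d10 H1] := sgo_cstep ipP complV SP1 t f e'0.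
have [d2 d20 H2] := sgo_cstep ipP complV SP2 t g e'0.
exists (Num.min d1 d2); first by rewrite lt_min d10.
move=> s h s0 /andP[h0]; rewrite lt_min => /andP[hd1 hd2] sht.
pose r := t - (s + h).
have r0 : 0 <= r by rewrite subr_ge0.
have [||r1 r1E r1P] := H1 r h; [rewrite r0/= /r; lra|by rewrite h0|].
have [||r2 r2E r2P] := H2 s h; [rewrite s0/=; lra|by rewrite h0|].
have -> : th (s + h) - th s = ip (S1 r (K f)) r2 - ip r1 (S2 s (K g)).
  rewrite /th -/r r2E.
  have -> : t - s = r + h by rewrite /r; lra.
  have E : ip (S1 r (K f)) (S2 s g) = ip (S1 r f) (S2 s (K g)).
    rewrite (ip_null_eq ipP (sgo_commutes ipP complV SP1 f r0)).
    by rewrite (ip_null_eqr ipP (sgo_commutes ipP complV SP2 g s0)) (ninv_sym KP).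
  by rewrite r1E !(ipE ipP) E; ring.
have := ip_le ipP (S1 r (K f)) r2; have := ip_ge ipP r1 (S2 s (K g)).
have c1 := sgo_contraction ipP complV KP SP1 (K f) r0.
have c2 := sgo_contraction ipP complV KP SP2 (K g) s0.
have := ler_pM (nrm_ge0 _ _) (nrm_ge0 _ _) c1 r2P.
have := ler_pM (nrm_ge0 _ _) (nrm_ge0 _ _) r1P c2.
have := ler_wpM2r (ltW h0) e'P; lra.
Qed.

Lemma sgo_sym S1 S2 f g t : semigroup_of ip K S1 -> semigroup_of ip K S2 ->
  0 <= t -> ip (S1 t f) g = ip f (S2 t g).
Proof.
move=> SP1 SP2 t0.
have symK a b : ip (S1 t (K a)) (K b) = ip (K a) (S2 t (K b)).
  apply/eqP; rewrite eq_le sgo_sym_le// andbT.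
  by rewrite (ipC ipP) (ipC ipP (K a)) sgo_sym_le.
apply/eqP; rewrite -subr_eq0 -normr_eq0 eq_le normr_ge0 andbT.
apply/ler_addgt0Pr => e e0; rewrite add0r.
have nf := nrm_ge0 ip f; have ng := nrm_ge0 ip g.
have C0 : 0 <= 2 * (nrm g + nrm f + 1) by lra.
have [e' /andP[e'0 e'1] e'P] := eps_scale C0 e0.
have [a aP] := dense_range ipP complV KP f e'0.
have [b bP] := dense_range ipP complV KP g e'0.
have KaP : nrm (K a) <= nrm f + 1.
  have := nrmB ipP f (f - K a); rewrite opprB addrCA subrr addr0; lra.
have lin1 := sgo_linear SP1 t0; have lin2 := sgo_linear SP2 t0.
have -> : ip (S1 t f) g - ip f (S2 t g) = ip (S1 t (f - K a)) g +
    ip (S1 t (K a)) (g - K b) - ip (f - K a) (S2 t g) - ip (K a) (S2 t (g - K b)).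
  rewrite (ip_null_eqr ipP (null_TB ipP lin2 _ _)) (ip_TB ipP lin1) !(ipE ipP) symK.
  ring.
have c1 x := sgo_contraction ipP complV KP SP1 x t0.
have c2 x := sgo_contraction ipP complV KP SP2 x t0.
have b1 := ip_le_nrm ipP (S1 t (f - K a)) g.
have b2 := ip_le_nrm ipP (S1 t (K a)) (g - K b).
have b3 := ip_le_nrm ipP (f - K a) (S2 t g).
have b4 := ip_le_nrm ipP (K a) (S2 t (g - K b)).
have d1 : nrm (S1 t (f - K a)) * nrm g <= e' * nrm g.
  by rewrite ler_wpM2r// (le_trans (c1 _)).
have d2 : nrm (S1 t (K a)) * nrm (g - K b) <= (nrm f + 1) * e'.
  by rewrite ler_pM ?nrm_ge0// (le_trans (c1 _)).
have d3 : nrm (f - K a) * nrm (S2 t g) <= e' * nrm g.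
  by rewrite ler_pM ?nrm_ge0.
have d4 : nrm (K a) * nrm (S2 t (g - K b)) <= (nrm f + 1) * e'.
  by rewrite ler_pM ?nrm_ge0// (le_trans (c2 _)).
apply: le_trans (ler_normB _ _) _; apply: le_trans (lerD (ler_normB _ _) (lexx _)) _.
have := ler_normD (ip (S1 t (f - K a)) g) (ip (S1 t (K a)) (g - K b)); lra.
Qed.

(** Two semigroups with generator [K^-1] are adjoint to each other, in
    particular each is adjoint to itself. *)
Lemma sgo_unique S1 S2 f t : semigroup_of ip K S1 -> semigroup_of ip K S2 ->
  0 <= t -> S1 t f === S2 t f.
Proof.
move=> SP1 SP2 t0; apply/(null_eqP ipP) => h.
by rewrite (sgo_sym f h SP1 SP2 t0) (sgo_sym f h SP2 SP2 t0).
Qed.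

Section OneSemigroup.
Variable S : R -> V -> V.
Hypothesis SP : semigroup_of ip K S.

Let linS t (t0 : 0 <= t) := sgo_linear SP t0.
Let contr t f := sgo_contraction ipP complV KP SP f (t := t).
Let commK t f := sgo_commutes ipP complV SP f (t := t).
Let addS s t f := sgo_add SP (s := s) (t := t) f.
Let eqS t f g := sgo_eq ipP SP (t := t) (f := f) (g := g).

Lemma ip_sgo f g t : 0 <= t -> ip (S t f) g = ip f (S t g).
Proof. by move=> t0; exact: sgo_sym. Qed.

Lemma ip_sgo_half f g t : 0 <= t -> ip (S t f) g = ip (S (t / 2) f) (S (t / 2) g).
Proof.
move=> t0; have t20 : 0 <= t / 2 by rewrite divr_ge0.
by rewrite -ip_sgo// -(ip_null_eq ipP (addS _ t20 t20)) -splitr.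
Qed.

(** The dissipated energy [- ip (S t g) (K (S t g))] has derivative
    [- 2 |S t g|^2], and [|S t g|] decreases. *)
Lemma sgo_energy g t : 0 <= t ->
  2 * nrm (S t g) ^+ 2 * t - ip (S t g) (K (S t g)) <= - ip g (K g).
Proof.
move=> t0; pose b := nrm (S t g) ^+ 2.
pose th s := 2 * b * s - ip (S s g) (K (S s g)).
suff : th t <= th 0.
  rewrite /th mulr0 sub0r (ip_null_eq ipP (sgo_0 SP _)).
  by rewrite (ip_null_eqr ipP (eqK (sgo_0 SP _))).
apply: le_of_small_increments => // e e0.
have C0 : 0 <= 2 * nrm g by rewrite mulr_ge0// nrm_ge0.
have [e' /andP[e'0 _] e'P] := eps_scale C0 e0.
have [d d0 H] := sgo_cstep ipP complV SP t g e'0.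
exists d => // s h s0 /andP[h0 hd] sht.
have [||r rE rP] := H s h; [rewrite s0/=; lra|by rewrite h0|].
pose x := S s g; pose x' := S (s + h) g.
have sh0 : 0 <= s + h by lra.
have Kx : K x' === K x + (h *: x + r).
  apply: (null_eq_trans ipP (null_eq_sym ipP (commK _ sh0))).
  rewrite rE; apply: (null_eqD ipP); first exact: commK.
  exact: null_eq_refl.
have -> : th (s + h) - th s = 2 * b * h - (h * ip x' x + ip x' r) -
    (h * ip x x + ip x r).
  have E : ip x' (K x') = ip x' (K x) + (h * ip x' x + ip x' r).
    by rewrite (ip_null_eqr ipP Kx) !(ipE ipP).
  have E2 : ip x' (K x) = ip x (K x) + (h * ip x x + ip x r).
    by rewrite -(ninv_sym KP) (ipC ipP) (ip_null_eqr ipP Kx) !(ipE ipP).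
  by rewrite /th -/x -/x' E E2; ring.
have bx : b <= ip x x.
  rewrite -(sqr_nrm ipP); apply: sqr_le; first exact: nrm_ge0.
  have st : 0 <= t - s by lra.
  by rewrite -(subrK s t) (nrm_null_eq ipP (addS _ st s0)) contr.
have bx' : b <= ip x' x.
  have h20 : 0 <= h / 2 by rewrite divr_ge0// ltW.
  have -> : ip x' x = nrm (S (s + h / 2) g) ^+ 2.
    rewrite (sqr_nrm ipP) /x' addrC (ip_null_eq ipP (addS _ (ltW h0) s0)).
    rewrite ip_sgo_half ?ltW// addrC (ip_null_eq ipP (addS _ h20 s0)).
    by rewrite (ip_null_eqr ipP (addS _ h20 s0)).
  apply: sqr_le; first exact: nrm_ge0.
  have st : 0 <= t - (s + h / 2) by lra.
  have st2 : 0 <= s + h / 2 by lra.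
  by rewrite -(subrK (s + h / 2) t) (nrm_null_eq ipP (addS _ st st2)) contr.
have r1 : - (nrm g * (e' * h)) <= ip x' r.
  apply: le_trans (ip_ge ipP _ _); rewrite lerN2 ler_pM ?nrm_ge0//.
  exact: contr.
have r2 : - (nrm g * (e' * h)) <= ip x r.
  apply: le_trans (ip_ge ipP _ _); rewrite lerN2 ler_pM ?nrm_ge0//.
  exact: contr.
have := ler_wpM2r (ltW h0) e'P.
have := ler_wpM2l (ltW h0) bx; have := ler_wpM2l (ltW h0) bx'.
move: r1 r2; move: (ip x' r) (ip x r) (ip x x) (ip x' x) (nrm g) => *; lra.
Qed.

Lemma sgo_energy_le g s t : 0 <= s <= t ->
  - ip (S t g) (K (S t g)) <= - ip (S s g) (K (S s g)).
Proof.
case/andP=> s0 st; have ts : 0 <= t - s by lra.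
have E : S t g === S (t - s) (S s g) by rewrite -{1}(subrK s t); exact: addS.
rewrite (ip_null_eq ipP E) (ip_null_eqr ipP (eqK E)).
have := sgo_energy (S s g) ts.
have := mulr_ge0 (sqr_ge0 (nrm (S (t - s) (S s g)))) ts; lra.
Qed.

(** Half of the derivative of [|S s (K g)|^2] is [ip (S s g) (K (S s g))],
    which increases with [s]. *)
Lemma sgo_energy_range g t : 0 <= t ->
  2 * t * - ip (S t g) (K (S t g)) <= nrm (K g) ^+ 2.
Proof.
move=> t0; pose E := - ip (S t g) (K (S t g)).
pose th s := 2 * E * s + nrm (S s (K g)) ^+ 2.
suff : th t <= th 0.
  rewrite /th mulr0 add0r (nrm_null_eq ipP (sgo_0 SP _)).
  have := sqr_ge0 (nrm (S t (K g))); rewrite -/E; lra.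
apply: le_of_small_increments => // e e0.
have C0 : 0 <= 2 * nrm (K g) by rewrite mulr_ge0// nrm_ge0.
have [e' /andP[e'0 _] e'P] := eps_scale C0 e0.
have [d d0 H] := sgo_cstep ipP complV SP t g e'0.
exists d => // s h s0 /andP[h0 hd] sht.
have [||r rE rP] := H s h; [rewrite s0/=; lra|by rewrite h0|].
pose x := S s (K g); pose x' := S (s + h) (K g).
have sh0 : 0 <= s + h by lra.
have h20 : 0 <= h / 2 by rewrite divr_ge0// ltW.
have sh20 : 0 <= s + h / 2 by lra.
(* The increment of [|S s (K g)|^2] involves the energy at times [s] and [s + h / 2]. *)
have e1 : E <= - ip (S s g) x.
  rewrite (ip_null_eqr ipP (commK _ s0)); apply: sgo_energy_le; lra.
have e2 : E <= - ip (S s g) x'.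
  suff -> : ip (S s g) x' = ip (S (s + h / 2) g) (K (S (s + h / 2) g)).
    by apply: sgo_energy_le; lra.
  rewrite (ipC ipP) /x' addrC (ip_null_eq ipP (addS _ (ltW h0) s0)).
  rewrite ip_sgo_half ?ltW// -(ip_null_eq ipP (addS _ h20 s0)).
  rewrite -(ip_null_eqr ipP (addS _ h20 s0)) [h / 2 + s]addrC.
  by rewrite (ip_null_eq ipP (commK _ sh20)) (ipC ipP).
have -> : th (s + h) - th s =
    2 * E * h + (h * ip (S s g) x + ip r x) + (h * ip (S s g) x' + ip r x').
  have E1 : nrm x' ^+ 2 = ip x x' + (h * ip (S s g) x' + ip r x').
    by rewrite (sqr_nrm ipP) {1}/x' rE !(ipE ipP).
  have E2 : ip x x' = nrm x ^+ 2 + (h * ip (S s g) x + ip r x).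
    by rewrite (sqr_nrm ipP) (ipC ipP x) /x' rE !(ipE ipP).
  by rewrite /th -/x -/x' E1 E2; ring.
have r1 : ip r x <= nrm (K g) * (e' * h).
  apply: le_trans (ip_le ipP _ _) _; rewrite mulrC ler_pM ?nrm_ge0//.
  exact: contr.
have r2 : ip r x' <= nrm (K g) * (e' * h).
  apply: le_trans (ip_le ipP _ _) _; rewrite mulrC ler_pM ?nrm_ge0//.
  exact: contr.
have := ler_wpM2r (ltW h0) e'P.
have := ler_wpM2l (ltW h0) e1; have := ler_wpM2l (ltW h0) e2.
move: r1 r2; move: (ip r x') (ip r x) (ip _ x) (ip _ x') (nrm _) => *; lra.
Qed.

(** Over [0, t / 2] the squared norm of [S s (K g)] dissipates energy at a rate
    at least that at time [t / 2]; over [t / 2, t] that energy itself dissipates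
    [|S s g|^2], which decreases. *)
Lemma sgo_smoothing g t : 0 <= t -> t * nrm (S t g) <= nrm (K g).
Proof.
move=> t0; apply: le_of_sqr; first exact: nrm_ge0.
have t20 : 0 <= t / 2 by rewrite divr_ge0.
have := sgo_energy_range g t20.
have := sgo_energy (S (t / 2) g) t20.
rewrite -(nrm_null_eq ipP (addS _ t20 t20)) -splitr.
have := ninv_le0 KP (S (t / 2) (S (t / 2) g)).
set E := ip (S _ g) _; set E' := ip _ _; set b := nrm (S t g) => E'0 h1 h2.
have h3 : b ^+ 2 * t <= - E by lra.
have := ler_wpM2l t0 h3; rewrite exprMn; lra.
Qed.

(** The smoothing bound makes [S t (g n)] a Cauchy sequence as soon as [K (g n)]
    converges to [f]. *)
Lemma sgo_in_range f t : 0 < t -> exists q, S t f === K q.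
Proof.
move=> t0; have t0' := ltW t0.
have /choice[g gP] : forall n : nat, exists g, nrm (f - K g) <= n.+1%:R^-1.
  by move=> n; apply: (dense_range ipP complV KP); rewrite invr_gt0.
have inv (e : R) : 0 < e -> exists N, forall n, (N <= n)%N -> n.+1%:R^-1 <= e.
  move=> e0; exists (Num.truncn e^-1) => n Nn.
  rewrite invf_ple ?posrE//; apply: (@le_trans _ _ (Num.truncn e^-1).+1%:R).
    by rewrite ltW// truncnS_gt.
  by rewrite ler_nat.
have [|q qP] := complV (x := fun n => S t (g n)).
  move=> e e0.
  have [|N NP] := inv (t * e / 2); first by rewrite divr_gt0// mulr_gt0.
  exists N => m n Nm Nn.
  rewrite -(nrm_null_eq ipP (null_TB ipP (linS t0') _ _)) -(ler_pM2l t0).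
  apply: le_trans (sgo_smoothing _ t0') _.
  rewrite (nrm_null_eq ipP (null_TB ipP linK _ _)).
  apply: le_trans (nrm_dist ipP _ f _) _; rewrite (nrmC ipP (K _) f).
  have := gP m; have := gP n; have := NP _ Nm; have := NP _ Nn.
  by move: (n.+1%:R^-1) (m.+1%:R^-1) => *; lra.
exists q; apply: (null_eq_small) => e e0.
have [N1 N1P] := inv (e / 2) (divr_gt0 e0 (ltr0Sn _ _)).
have C0 : 0 <= `|B| by [].
have [e' /andP[e'0 _] e'P] := eps_scale C0 (divr_gt0 e0 (ltr0Sn _ 1)).
have [N2 N2P] := qP _ e'0.
pose n := maxn N1 N2.
apply: le_trans (nrm_dist ipP _ (S t (K (g n))) _) _.
have h1 : nrm (S t f - S t (K (g n))) <= e / 2.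
  rewrite -(nrm_null_eq ipP (null_TB ipP (linS t0') _ _)).
  apply: le_trans (contr _ t0') _; apply: le_trans (gP n) _.
  by rewrite N1P// leq_maxl.
have h2 : nrm (S t (K (g n)) - K q) <= e / 2.
  have -> : nrm (S t (K (g n)) - K q) = nrm (K (S t (g n) - q)).
    apply: (nrm_null_eq ipP); apply/(null_eqP ipP) => k.
    by rewrite !(ipE ipP) (ip_TB ipP linK) (ip_null_eq ipP (commK _ t0')).
  apply: le_trans (ninv_bounded KP _) _; apply: le_trans e'P.
  apply: le_trans (ler_wpM2r (nrm_ge0 _ _) (ler_norm B)) _.
  by rewrite mulrC ler_wpM2r// N2P// leq_maxr.
lra.
Qed.

Lemma sgo_in_range_iter n f t : 0 < t -> exists q, S t f === iter n K q.
Proof.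
elim: n f t => [|n IH] f t t0; first by exists (S t f); exact: null_eq_refl.
have t20 : 0 < t / 2 by rewrite divr_gt0.
have [q qP] := sgo_in_range f t20; have [q' q'P] := IH q _ t20.
exists q'; rewrite (splitr t).
apply: (null_eq_trans ipP (addS _ (ltW t20) (ltW t20))).
apply: (null_eq_trans ipP (eqS (ltW t20) qP)).
by apply: (null_eq_trans ipP (commK _ (ltW t20))); rewrite iterS; exact: eqK.
Qed.

Lemma sgo_commutes_iter n f t : 0 <= t -> S t (iter n K f) === iter n K (S t f).
Proof.
move=> t0; elim: n => [|n IH]; first exact: null_eq_refl.
by rewrite iterS; apply: (null_eq_trans ipP (commK _ t0)); exact: eqK.
Qed.

(** Both sides equal [ip (S (t / 2) f) (K^-1 (S (t / 2) u))]. *)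
Lemma ip_inverse_sgo f u q w t : 0 < t ->
  S t f === K q -> S t u === K w -> ip q u = ip f w.
Proof.
move=> t0 fq uw; have t20 : 0 < t / 2 by rewrite divr_gt0.
have t20' := ltW t20.
have split2 x p y : S (t / 2) x === K p -> S t x === K y -> y === S (t / 2) p.
  move=> xp xy; apply: (ninv_eq_inj ipP KP).
  apply: (null_eq_trans ipP (null_eq_sym ipP xy)).
  rewrite {1}(splitr t); apply: (null_eq_trans ipP (addS _ t20' t20')).
  by apply: (null_eq_trans ipP (eqS t20' xp)); exact: commK.
have [p fp] := sgo_in_range f t20; have [v uv] := sgo_in_range u t20.
rewrite (ip_null_eq ipP (split2 _ _ _ fp fq)) (ip_null_eqr ipP (split2 _ _ _ uv uw)).
rewrite ip_sgo// (ip_null_eqr ipP uv) -(ninv_sym KP) -(ip_null_eq ipP fp).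
by rewrite ip_sgo.
Qed.

(** The speed [S s g] of the orbit has norm at most [|g|]. *)
Lemma sgo_lipschitz g t : 0 <= t -> nrm (S t (K g) - K g) <= t * nrm g.
Proof.
move=> t0; pose k := S t (K g) - K g.
pose th s := ip (S s (K g) - K g) k - s * (nrm g * nrm k).
have : th t <= th 0.
  apply: le_of_small_increments => // e e0.
  have [e' /andP[e'0 _] e'P] := eps_scale (nrm_ge0 ip k) e0.
  have [d d0 H] := sgo_cstep ipP complV SP t g e'0.
  exists d => // s h s0 /andP[h0 hd] sht.
  have [||r rE rP] := H s h; [rewrite s0/=; lra|by rewrite h0|].
  have -> : th (s + h) - th s = h * ip (S s g) k + ip r k - h * (nrm g * nrm k).
    by rewrite /th rE !(ipE ipP); ring.
  have h1 : ip (S s g) k <= nrm g * nrm k.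
    apply: le_trans (ip_le ipP _ _) _; rewrite ler_wpM2r ?nrm_ge0//.
    exact: contr.
  have h2 : ip r k <= e' * h * nrm k.
    by apply: le_trans (ip_le ipP _ _) _; rewrite ler_wpM2r ?nrm_ge0.
  have := ler_wpM2l (ltW h0) h1; have := ler_wpM2r (ltW h0) e'P; lra.
have -> : th 0 = 0.
  by rewrite /th mul0r subr0 (ipBl ipP) (ip_null_eq ipP (sgo_0 SP _)) subrr.
rewrite /th -/k -(sqr_nrm ipP) subr_le0 => kk.
have [k0|k0] := eqVneq (nrm k) 0; first by rewrite k0 mulr_ge0// nrm_ge0.
have kp : 0 < nrm k by rewrite lt_neqAle eq_sym k0 nrm_ge0.
by rewrite -(ler_pM2r kp) -expr2 -mulrA.
Qed.

Section Eigenvector.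
Variables (phi : V) (mu : R).
Hypothesis mu0 : 0 < mu.
Hypothesis phiE : K phi === - mu^-1 *: phi.
Hypothesis phi0 : 0 < nrm phi.

(** The function [s |-> e^(mu s) ip (S s phi) psi] has derivative zero. *)
Lemma ip_sgo_eigen_le psi t : 0 <= t ->
  expR (mu * t) * ip (S t phi) psi <= ip phi psi.
Proof.
move=> t0; pose g := - mu *: phi.
have gE : K g === phi.
  apply: (null_eq_trans ipP (null_TZ ipP linK _ _)).
  apply: (null_eq_trans ipP (null_eqZ ipP _ phiE)).
  rewrite scalerA mulrNN mulfV ?gt_eqF// scale1r; exact: null_eq_refl.
pose th s := expR (mu * s) * ip (S s phi) psi.
suff : th t <= th 0.
  by rewrite /th mulr0 expR0 mul1r (ip_null_eq ipP (sgo_0 SP _)).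
apply: le_of_small_increments => // e e0.
have np := nrm_ge0 ip psi; have nph := ltW phi0.
pose W := expR (mu * t).
have W0 : 0 < W by exact: expR_gt0.
have C0 : 0 <= W * (mu ^+ 2 * nrm phi * nrm psi + nrm psi).
  by apply: mulr_ge0; [exact: ltW|apply: addr_ge0 => //; do 2! apply: mulr_ge0 => //; exact: sqr_ge0].
have [e' /andP[e'0 e'1] e'P] := eps_scale C0 e0.
have [d d0 H] := sgo_cstep ipP complV SP t g e'0.
exists (Num.min d (Num.min e' mu^-1)).
  by rewrite !lt_min d0 e'0 invr_gt0 mu0.
move=> s h s0 /andP[h0]; rewrite !lt_min => /and3P[hd he' hmu] sht.
have [||r rE rP] := H s h; [rewrite s0/=; lra|by rewrite h0|].
have sh0 : 0 <= s + h by lra.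
have muh : mu * h <= 1 by rewrite mulrC -ler_pdivlMr// mul1r ltW.
have muh0 : 0 <= mu * h by rewrite mulr_ge0// ltW.
have xE : ip (S (s + h) phi) psi = (1 - mu * h) * ip (S s phi) psi + ip r psi.
  rewrite -(ip_null_eq ipP (eqS sh0 gE)) rE !(ipE ipP).
  rewrite (ip_null_eq ipP (eqS s0 gE)) (ip_TZ ipP (linS s0)); ring.
pose X := ip (S s phi) psi.
have XP : `|X| <= nrm phi * nrm psi.
  apply: le_trans (ip_le_nrm ipP _ _) _; rewrite ler_wpM2r//.
  exact: contr.
have rpsi : `|ip r psi| <= e' * h * nrm psi.
  by apply: le_trans (ip_le_nrm ipP _ _) _; rewrite ler_wpM2r.
pose p := expR (mu * h).
have p1 : 1 + mu * h <= p by exact: expR_ge1Dx.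
have p2 : p * (1 - mu * h) <= 1.
  have := expR_ge1Dx (- (mu * h)); rewrite expRN => h1.
  by rewrite mulrC -ler_pdivlMr ?expR_gt0// mul1r.
have p3 : 1 - (mu * h) ^+ 2 <= p * (1 - mu * h).
  have h1 : 0 <= 1 - mu * h by lra.
  have := ler_wpM2r h1 p1; lra.
have -> : th (s + h) - th s = expR (mu * s) * ((p * (1 - mu * h) - 1) * X) +
    expR (mu * (s + h)) * ip r psi.
  by rewrite /th xE [mu * (s + h)]mulrDr expRD -/p -/X; ring.
have w1 : expR (mu * s) <= W by rewrite ler_expR ler_pM2l//; lra.
have w2 : expR (mu * (s + h)) <= W by rewrite ler_expR ler_pM2l.
have b1 : expR (mu * s) * ((p * (1 - mu * h) - 1) * X) <=
    W * (mu ^+ 2 * h * e' * (nrm phi * nrm psi)).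
  apply: le_trans (ler_norm _) _; rewrite normrM (gtr0_norm (expR_gt0 _)).
  apply: ler_pM; [exact: expR_ge0|exact: normr_ge0|exact: w1|].
  rewrite normrM; apply: ler_pM => //.
  rewrite ler_norml; apply/andP; split; last first.
    apply: (@le_trans _ _ 0); first lra.
    by rewrite !mulr_ge0 ?sqr_ge0// ltW.
  have : (mu * h) ^+ 2 <= mu ^+ 2 * h * e'.
    rewrite exprMn -mulrA ler_wpM2l ?sqr_ge0// expr2 ler_wpM2l//; exact: ltW.
  lra.
have b2 : expR (mu * (s + h)) * ip r psi <= W * (e' * h * nrm psi).
  apply: le_trans (ler_norm _) _; rewrite normrM (gtr0_norm (expR_gt0 _)).
  by apply: ler_pM; [exact: expR_ge0|exact: normr_ge0|exact: w2|].
have := ler_wpM2r (ltW h0) e'P; lra.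
Qed.

Lemma ip_sgo_eigen psi t : 0 <= t ->
  ip (S t phi) psi = expR (- (mu * t)) * ip phi psi.
Proof.
move=> t0.
have -> : ip phi psi = expR (mu * t) * ip (S t phi) psi.
  apply/eqP; rewrite eq_le ip_sgo_eigen_le// andbT.
  by have := ip_sgo_eigen_le (- psi) t0; rewrite !(ipNr ipP) mulrN lerN2.
by rewrite mulrA -expRD addNr expR0 mul1r.
Qed.

Lemma sgo_eigen t : 0 <= t -> S t phi === expR (- (mu * t)) *: phi.
Proof.
by move=> t0; apply/(null_eqP ipP) => h; rewrite ip_sgo_eigen// (ipZl ipP).
Qed.

Lemma ip_iter_eigen n z : ip (iter n K z) phi = (- mu^-1) ^+ n * ip z phi.
Proof.
elim: n => [|n IH]; first by rewrite mul1r.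
by rewrite iterS (ninv_sym KP) (ip_null_eqr ipP phiE) (ipZr ipP) IH exprS mulrA.
Qed.

Variable la : R.
Hypothesis la0 : 0 <= la.
Hypothesis gap : forall g, ip g phi = 0 -> ip g (K g) <= - la * nrm (K g) ^+ 2.

Lemma sgo_decay g t : ip g phi = 0 -> 0 <= t ->
  nrm (S t (K g)) <= expR (- (la * t)) * nrm (K g).
Proof.
move=> gphi t0; rewrite expRN mulrC ler_pdivlMr ?expR_gt0//.
apply: le_of_sqr; first exact: nrm_ge0.
rewrite exprMn mulrC -expRM_natl mulrA.
have := sgo_decay_range ipP complV SP (g := g) la0 t0.
apply=> s s0; apply: gap.
by rewrite ip_sgo// (ip_null_eqr ipP (sgo_eigen s0)) (ipZr ipP) gphi mulr0.
Qed.

(** The component of [u] along [phi] evolves explicitly. The other one is smoothed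
    into the range of [K^4] at time 1. One of these four powers of [K] is inverted,
    two are kept apart so that the values of the remainder lie in the range of
    [K^2], and the last one gives the decay of [z]. *)
Lemma sgo_asymptotics u : exists C z, forall t, 1 <= t ->
  [/\ S t u === K (- (mu * (ip u phi / nrm phi ^+ 2)) *: (expR (- (mu * t)) *: phi)
         + K (K (z t))),
     nrm (z t) <= C * expR (- (la * t)) &
     forall t', t <= t' -> nrm (K (K (z t')) - K (K (z t))) <=
       C * expR (- (la * t)) * (t' - t)].
Proof.
pose c := ip u phi / nrm phi ^+ 2; pose v := u - c *: phi.
have vphi : ip v phi = 0.
  by rewrite /v !(ipE ipP) /c (sqr_nrm ipP) divfK ?subrr// -(sqr_nrm ipP) expf_neq0// gt_eqF.
have [q qP] := sgo_in_range_iter 4 v (ltr01).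
have qphi : ip q phi = 0.
  have : ip (iter 4 K q) phi = 0.
    by rewrite -(ip_null_eq ipP qP) ip_sgo// (ip_null_eqr ipP (sgo_eigen ler01))
      (ipZr ipP) vphi mulr0.
  move=> /eqP; rewrite ip_iter_eigen mulf_eq0 expf_eq0/= oppr_eq0 invr_eq0.
  by rewrite (gt_eqF mu0)/= => /eqP.
pose z t := S (t - 1) (K q).
have B0 : 0 <= `|B| + 1 by rewrite addr_ge0.
have B1 : 1 <= `|B| + 1 by rewrite lerDr.
have KB f : nrm (K f) <= (`|B| + 1) * nrm f.
  apply: le_trans (ninv_bounded KP f) _; rewrite ler_wpM2r ?nrm_ge0//.
  by apply: le_trans (ler_norm _) _; rewrite lerDl.
pose D := expR la * nrm (K q).
have D0 : 0 <= D by rewrite mulr_ge0 ?nrm_ge0// expR_ge0.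
have zD t : 1 <= t -> nrm (z t) <= D * expR (- (la * t)).
  move=> t1; apply: le_trans (sgo_decay qphi _) _; first lra.
  rewrite /D mulrAC -expRD ler_wpM2r ?nrm_ge0// ler_expR; lra.
exists ((`|B| + 1) * D), z => t t1.
have t10 : 0 <= t - 1 by lra.
have z' : nrm (z t) <= (`|B| + 1) * D * expR (- (la * t)).
  apply: le_trans (zD _ t1) _; rewrite ler_wpM2r ?expR_ge0//.
  by rewrite ler_peMl.
split => //.
- have E : S t u === S t (c *: phi) + S t v.
    have t0 : 0 <= t by lra.
    have -> : u = c *: phi + v by rewrite /v addrC subrK.
    exact: (null_TD ipP (linS t0)).
  apply: (null_eq_trans ipP E); apply: (null_eq_sym ipP).
  apply: (null_eq_trans ipP (null_TD ipP linK _ _)); apply: (null_eqD ipP).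
    apply/(null_eqP ipP) => k; have t0 : 0 <= t by lra.
    rewrite (ip_TZ ipP linK) (ip_TZ ipP linK) (ip_null_eq ipP phiE) (ipZl ipP).
    by rewrite (ip_TZ ipP (linS t0)) ip_sgo_eigen// -/c; field; rewrite gt_eqF.
  apply: (null_eq_sym ipP).
  have -> : S t v = S ((t - 1) + 1) v by rewrite subrK.
  apply: (null_eq_trans ipP (addS _ t10 ler01)).
  apply: (null_eq_trans ipP (eqS t10 qP)).
  apply: (null_eq_trans ipP (sgo_commutes_iter 4 q t10)).
  rewrite /= /z; do 3! apply: eqK; apply: (null_eq_sym ipP); exact: commK.
- move=> t' tt'; have t'0 : 0 <= t' - t by lra.
  have E : z t' === S (t' - t) (z t).
    have -> : z t' = S ((t' - t) + (t - 1)) (K q) by rewrite /z subrKA.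
    exact: addS.
  have E2 : K (K (z t')) === S (t' - t) (K (K (z t))).
    apply: (null_eq_trans ipP (eqK (eqK E))).
    apply: (null_eq_sym ipP); exact: (sgo_commutes_iter 2).
  rewrite (nrm_null_eq ipP (null_eqB ipP E2 (null_eq_refl ipP (K (K (z t)))))).
  apply: le_trans (sgo_lipschitz _ t'0) _; rewrite mulrC ler_wpM2r//.
  apply: le_trans (KB _) _; rewrite -mulrA ler_wpM2l//; exact: zD.
Qed.

End Eigenvector.
End OneSemigroup.
End SemigroupLemmas2.

(** * The space of square integrable functions *)

Local Notation mu := lebesgue_measure.

Section RealIntegrable.
Variable R : realType.
Local Notation TR := (measurableTypeR R).
Implicit Types (f g : R -> R) (D : set R).

(** Integrability for the Lebesgue measure, with the measurable structure of the
    real line fixed once. *)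
Definition intR D f := mu.-integrable D (EFin \o f).

Lemma intR_measurable D f : intR D f -> measurable_fun D f.
Proof. by move=> /measurable_int/measurable_EFinP. Qed.

Lemma intR_le D f g : measurable D -> measurable_fun D f ->
  (forall x, D x -> `|f x| <= g x) -> intR D g -> intR D f.
Proof.
move=> mD mf fg ig.
refine (@le_integrable _ TR R mu D _ (EFin \o f) (EFin \o g) _ _ ig) => //.
- by apply/measurable_EFinP.
- by move=> x Dx /=; rewrite lee_fin (le_trans (fg x Dx))// ler_norm.
Qed.

Lemma intRD D f g : measurable D -> intR D f -> intR D g ->
  intR D (fun x => f x + g x).
Proof. by move=> mD; exact: (@integrableD _ TR R mu D mD (EFin \o f) (EFin \o g)). Qed.

Lemma intRZ D (c : R) f : measurable D -> intR D f -> intR D (fun x => c * f x).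
Proof. by move=> mD; exact: (@integrableZl _ TR R mu D mD c (EFin \o f)). Qed.

Lemma intRB D f g : measurable D -> intR D f -> intR D g ->
  intR D (fun x => f x - g x).
Proof. by move=> mD; exact: (@integrableB _ TR R mu D mD (EFin \o f) (EFin \o g)). Qed.

Lemma intR_norm D f : intR D f -> intR D (fun x => `|f x|).
Proof. exact: (@integrable_norm _ TR R mu D f). Qed.

Lemma intRS D E f : measurable D -> measurable E -> D `<=` E -> intR E f -> intR D f.
Proof. by move=> mD mE; exact: (@integrableS _ TR R mu E D (EFin \o f)). Qed.

Lemma intR_eq D f g : measurable D -> (forall x, D x -> f x = g x) ->
  intR D f -> intR D g.
Proof.
move=> mD fg; apply: (@eq_integrable _ TR R mu D mD) => x; rewrite inE => Dx /=.
by rewrite fg.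
Qed.

Lemma intR_bounded D f (M : R) : measurable D -> (mu D < +oo)%E ->
  measurable_fun D f -> (forall x, D x -> `|f x| <= M) -> intR D f.
Proof.
move=> mD fD mf fM.
apply: (@measurable_bounded_integrable _ TR R mu f D mD fD mf).
exists M; split; first by rewrite num_real.
by move=> y My x /= xD; apply: le_trans (ltW My); exact: fM.
Qed.

Lemma EFin_Rintegral D f : measurable D -> intR D f ->
  (\int[mu]_(x in D) f x)%:E = (\int[mu]_(x in D) (f x)%:E)%E.
Proof.
move=> mD fi; rewrite fineK//.
exact: (@integrable_fin_num _ TR R mu D mD (EFin \o f)).
Qed.

Lemma RintD D f g : measurable D -> intR D f -> intR D g ->
  \int[mu]_(x in D) (f x + g x) = \int[mu]_(x in D) f x + \int[mu]_(x in D) g x.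
Proof. by move=> mD; exact: (@RintegralD _ TR R mu D f g mD). Qed.

Lemma RintB D f g : measurable D -> intR D f -> intR D g ->
  \int[mu]_(x in D) (f x - g x) = \int[mu]_(x in D) f x - \int[mu]_(x in D) g x.
Proof. by move=> mD; exact: (@RintegralB _ TR R mu D f g mD). Qed.

Lemma RintZ D (c : R) f : measurable D -> intR D f ->
  \int[mu]_(x in D) (c * f x) = c * \int[mu]_(x in D) f x.
Proof. by move=> mD; exact: (@RintegralZl _ TR R mu D f c mD). Qed.

Lemma Rint_eq D f g : (forall x, D x -> f x = g x) ->
  \int[mu]_(x in D) f x = \int[mu]_(x in D) g x.
Proof. by move=> fg; apply: eq_Rintegral => x; rewrite inE; exact: fg. Qed.

Lemma Rint_le D f g : measurable D -> intR D f -> intR D g ->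
  (forall x, D x -> f x <= g x) -> \int[mu]_(x in D) f x <= \int[mu]_(x in D) g x.
Proof. by move=> mD; exact: (@le_Rintegral _ TR R mu D f g mD). Qed.

Lemma Rint_le_norm D f g : measurable D -> measurable_fun D f ->
  (forall x, D x -> `|f x| <= g x) -> intR D g ->
  `|\int[mu]_(x in D) f x| <= \int[mu]_(x in D) g x.
Proof.
move=> mD mf fg gi; have fi := intR_le mD mf fg gi.
apply: le_trans (@le_normr_Rintegral _ TR R mu D f mD fi) _.
by apply: Rint_le => //; exact: intR_norm.
Qed.

Lemma Rint_cst (c d r : R) : c <= d ->
  \int[mu]_(x in (`]c, d[%classic : set R)) r = r * (d - c).
Proof.
move=> cd; have E : fine (mu (`]c, d[%classic : set R)) = d - c.
  rewrite lebesgue_measure_itv/= lte_fin.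
  case: ltP => [//|dc]; apply/esym/eqP; rewrite subr_eq0 eq_le dc; exact: cd.
have -> := @Rintegral_cst _ TR R mu `]c, d[%classic (measurable_itv _) r.
by congr (_ * _); exact: E.
Qed.

End RealIntegrable.

Section L2Space.
Variables (R : realType) (a : R).
Implicit Types f g : R -> R.
Local Notation I := (`]a, 1[%classic : set R).

Lemma measurable_I : measurable I. Proof. by []. Qed.

Lemma measure_I_lty : (mu I < +oo)%E.
Proof. by rewrite lebesgue_measure_itv/=; case: ifP => // _; rewrite -EFinB ltry. Qed.

Lemma L2P f : L2 a f <-> measurable_fun I f /\ intR I (fun x => f x ^+ 2).
Proof.
split=> -[mf H]; split => //.
  apply/integrableP; split.
    by apply/measurable_EFinP; exact: measurable_funX.
  under eq_integral => x _ do rewrite /= ger0_norm ?sqr_ge0//.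
  exact: H.
have /integrableP[_] := H.
by under eq_integral => x _ do rewrite /= ger0_norm ?sqr_ge0//.
Qed.

Lemma L2_measurable f : L2 a f -> measurable_fun I f. Proof. by case. Qed.

Lemma L2_mulr_integrable f g : L2 a f -> L2 a g -> intR I (fun x => f x * g x).
Proof.
move=> /L2P[mf if2] /L2P[mg ig2].
apply: (intR_le (g := fun x => f x ^+ 2 + g x ^+ 2)) => //.
- exact: measurable_funM.
- by move=> x _; rewrite ler_norml; apply/andP; split; nra.
- exact: intRD.
Qed.

Lemma L2_lin (c : R) f g : L2 a f -> L2 a g -> L2 a (fun x => c * f x + g x).
Proof.
move=> Lf Lg; have /L2P[mf if2] := Lf; have /L2P[mg ig2] := Lg.
apply/L2P; split.
  by apply: measurable_funD => //; apply: measurable_funM => //; exact: measurable_cst.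
apply: (intR_eq (f := fun x => c ^+ 2 * f x ^+ 2 + (2 * c * (f x * g x) + g x ^+ 2))) => //.
  by move=> x _; ring.
apply: intRD => //; first exact: intRZ.
by apply: intRD => //; apply: intRZ => //; exact: L2_mulr_integrable.
Qed.

Lemma L2_bounded f (M : R) : measurable_fun I f ->
  (forall x, a < x < 1 -> `|f x| <= M) -> L2 a f.
Proof.
move=> mf fM; apply/L2P; split => //.
apply: (intR_bounded (M := M ^+ 2)) => //; first exact: measure_I_lty.
- exact: measurable_funX.
- move=> x /= xI; rewrite normrX; apply: sqr_le => //.
  by apply: fM; move: xI; rewrite in_itv.
Qed.

Lemma L2_cst (c : R) : L2 a (fun=> c).
Proof. by apply: (L2_bounded (M := `|c|)) => //; exact: measurable_cst. Qed.

Lemma L2_eq f g : (forall x, a < x < 1 -> f x = g x) -> L2 a f -> L2 a g.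
Proof.
move=> fg /L2P[mf if2]; apply/L2P; split.
  by apply: eq_measurable_fun mf => x; rewrite inE/= in_itv/=; exact: fg.
by apply: intR_eq if2 => // x /=; rewrite in_itv/= => /fg ->.
Qed.

Lemma L2_integrable f : L2 a f -> intR I f.
Proof.
move=> /L2_mulr_integrable/(_ (L2_cst 1)); apply: intR_eq => // x _.
by rewrite mulr1.
Qed.

Definition L2b : {pred (R -> R^o)} := [pred f : R -> R^o | `[< L2 a f >]].

Lemma L2b_submod : submod_closed L2b.
Proof.
split; first by apply/asboolP; exact: (L2_cst 0).
by move=> c f g /asboolP Lf /asboolP Lg; apply/asboolP; exact: L2_lin.
Qed.

HB.instance Definition _ := GRing.isSubmodClosed.Build R (R -> R^o) L2b L2b_submod.

(** Square integrable functions form a subspace of all functions. The codomain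
    [R^o] makes the function space a module over [R]. *)
Record L2space := MkL2 { L2val :> R -> R^o; L2valP : L2val \in L2b }.
HB.instance Definition _ := [isSub for L2val].
HB.instance Definition _ := [Choice of L2space by <:].
HB.instance Definition _ := [SubChoice_isSubLmodule of L2space by <:].

Definition toL2 f (Lf : L2 a f) : L2space := MkL2 (asboolT Lf).

Lemma L2space_L2 (f : L2space) : L2 a f.
Proof. by have /asboolP := L2valP f. Qed.

Definition L2ip (f g : L2space) : R := \int[mu]_(x in I) (f x * g x).

Lemma L2ip_semi_inner : semi_inner_product L2ip.
Proof.
split.
- by move=> f g; apply: eq_Rintegral => x _; rewrite mulrC.
- move=> c f g h; rewrite /L2ip.
  rewrite -RintegralZl//; last exact: (L2_mulr_integrable (L2space_L2 f) (L2space_L2 h)).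
  rewrite -RintegralD//.
  + by apply: eq_Rintegral => x _; rewrite /= /GRing.add /=; rewrite mulrDl mulrA.
  + apply: intRZ => //.
    exact: (L2_mulr_integrable (L2space_L2 f) (L2space_L2 h)).
  + exact: (L2_mulr_integrable (L2space_L2 g) (L2space_L2 h)).
- by move=> f; apply: Rintegral_ge0 => x _; rewrite -expr2 sqr_ge0.
Qed.

Lemma nrm_L2norm (f : L2space) : nrm L2ip f = L2norm a f.
Proof. by rewrite /nrm /L2norm; congr Num.sqrt; apply: eq_Rintegral => x _; rewrite expr2. Qed.

End L2Space.

(** * Completeness *)

Lemma cvg_geometric_steps (R : realType) (u : nat -> R) (C r : R) :
  0 <= r < 1 -> (forall k, `|u k.+1 - u k| <= C * r ^+ k) -> cvgn u.
Proof.
move=> /andP[r0 r1] uP.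
have : cvgn (series (telescope u)).
  apply: normed_cvg; apply: (@series_le_cvg _ _ (geometric C r)).
  - by move=> n; exact: normr_ge0.
  - by move=> n /=; exact: le_trans (uP n).
  - by move=> n /=; exact: uP.
  - by apply: is_cvg_geometric_series; rewrite ger0_norm.
rewrite telescopeK => /cvg_ex[l ul]; apply/cvg_ex; exists (l + u 0%N).
have E : (fun n => (u n - u 0%N) + u 0%N) = u by apply/funext => n; rewrite subrK.
by rewrite -[X in X @ _ --> _]E; apply: cvgD => //; exact: cvg_cst.
Qed.

Lemma limn_einf_le (R : realType) (u : (\bar R)^nat) (M : \bar R) n0 :
  (forall n, (n0 <= n)%N -> (u n <= M)%E) -> (limn_einf u <= M)%E.
Proof.
move=> uM; apply: le_trans (limn_einf_sup u) _.
apply: (@le_trans _ _ (ereal_sup (u @` [set n | (n0 <= n)%N]))).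
  by apply: ereal_inf_lbound; exists [set n | (n0 <= n)%N] => //; exists n0.
by apply: ge_ereal_sup => _ [n n0n <-]; exact: uM.
Qed.

Section Completeness.
Variables (R : realType) (a : R).
Local Notation I := (`]a, 1[%classic : set R).
Local Notation V := (L2space a).
Local Notation ip := (@L2ip R a).
Local Notation TR := (measurableTypeR R).

Lemma L2_measurable_val (f : V) : measurable_fun I f.
Proof. exact: L2_measurable (L2space_L2 f). Qed.

Lemma sqr_nrmE (f : V) : ((nrm ip f ^+ 2)%:E = \int[mu]_(x in I) (f x ^+ 2)%:E)%E.
Proof.
rewrite (sqr_nrm (L2ip_semi_inner a)) EFin_Rintegral//.
by apply: L2_mulr_integrable; exact: L2space_L2.
Qed.

(** A sequence with summable increments converges almost everywhere, because
    [\sum_k 2^k (y_(k+1) - y_k)^2] has a finite integral. *)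
Lemma ae_cvg_fast_cauchy (y : nat -> V) :
  (forall k, nrm ip (y k.+1 - y k) <= 4^-1 ^+ k) ->
  {ae mu, forall x : TR, I x -> cvgn (fun k => y k x : R)}.
Proof.
move=> yP.
pose F k x : \bar R := (2 ^+ k * (y k.+1 x - y k x) ^+ 2)%:E.
have mF k : measurable_fun I (F k).
  apply/measurable_EFinP; apply: measurable_funM; first exact: measurable_cst.
  by apply: measurable_funX; apply: measurable_funB; exact: L2_measurable_val.
have F0 k x : (0 <= F k x)%E by rewrite lee_fin mulr_ge0 ?sqr_ge0// exprn_ge0.
pose H x := (\sum_(0 <= k <oo) F k x)%E.
have intF k : (\int[mu]_(x in I) F k x <= (2 / (2 ^ k.+1)%:R)%:E)%E.
  have -> : (\int[mu]_(x in I) F k x =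
      (2 ^+ k)%:E * \int[mu]_(x in I) ((y k.+1 x - y k x) ^+ 2)%:E)%E.
    under eq_integral => x _ do rewrite /F EFinM.
    apply: (@ge0_integralZl_EFin _ TR R mu I) => //.
    - by move=> x _; rewrite lee_fin sqr_ge0.
    - apply/measurable_EFinP.
      by apply: measurable_funX; apply: measurable_funB; exact: L2_measurable_val.
  have -> : (\int[mu]_(x in I) ((y k.+1 x - y k x) ^+ 2)%:E = (nrm ip (y k.+1 - y k) ^+ 2)%:E)%E.
    by rewrite sqr_nrmE.
  rewrite -EFinM lee_fin.
  have h1 : nrm ip (y k.+1 - y k) ^+ 2 <= (16^-1) ^+ k.
    apply: le_trans (sqr_le (nrm_ge0 _ _) (yP k)) _.
    by rewrite -exprM mulnC exprM; have -> : (4^-1 : R) ^+ 2 = 16^-1 by rewrite exprVn -natrX.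
  apply: le_trans (ler_wpM2l _ h1) _; first by rewrite exprn_ge0.
  rewrite -exprMn natrX exprS invfM mulrA mulfV// mul1r -exprVn.
  by apply: lerXn2r; rewrite ?nnegrE//; lra.
have H_fin : (\int[mu]_(x in I) H x < +oo)%E.
  rewrite /H (@integral_nneseries _ TR R mu I _ F)//.
  apply: (@le_lt_trans _ _ 2%:E); last by rewrite ltry.
  apply: le_trans (epsilon_trick0 xpredT (_ : 0 <= 2)); last by [].
  apply: lee_nneseries => // k _ _.
  by apply: integral_ge0.
have iH : mu.-integrable I H.
  apply/integrableP; split.
    apply: (@ge0_emeasurable_sum _ TR R I F xpredT) => // *; exact: mF.
  under eq_integral => x _ do rewrite gee0_abs ?nneseries_ge0//.
  exact: H_fin.
have := @integrable_ae _ TR R mu I (measurable_I a) H iH.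
apply: filterS => x /= Hx Ix; have {}Hx := Hx Ix.
have Hr : H x = (fine (H x))%:E by rewrite fineK.
have h0 : 0 <= fine (H x) by rewrite fine_ge0// nneseries_ge0.
apply: (@cvg_geometric_steps _ _ (Num.sqrt (fine (H x))) (Num.sqrt 2^-1)).
  rewrite sqrtr_ge0/= -[ltRHS]sqrtr1 ltr_sqrt//; lra.
move=> k.
have Hk : 2 ^+ k * (y k.+1 x - y k x) ^+ 2 <= fine (H x).
  rewrite -lee_fin -Hr -/(F k x).
  apply: le_trans (nneseries_lim_ge k.+1 (fun n _ _ => F0 n x)).
  rewrite big_nat_recr//= leeDr// sume_ge0//.
apply: le_of_sqr; first by rewrite mulr_ge0 ?exprn_ge0 ?sqrtr_ge0.
rewrite real_normK ?num_real// exprMn sqr_sqrtr// -exprM mulnC exprM sqr_sqrtr//.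
by rewrite exprVn ler_pdivlMr ?exprn_gt0// mulrC.
Qed.

(** A fast Cauchy subsequence converges almost everywhere; the limit is square
    integrable and is the limit in norm by Fatou's lemma. *)
Lemma L2_complete : complete_ip ip.
Proof.
move=> x xC; have ipP := L2ip_semi_inner a.
have /choice[N NP] : forall k : nat, exists N, forall m n, (N <= m)%N -> (N <= n)%N ->
    nrm ip (x m - x n) <= 4^-1 ^+ k.
  by move=> k; apply: xC; rewrite exprn_gt0.
pose N' k := (\sum_(i < k.+1) N i + k)%N.
have NN' k : (N k <= N' k)%N by rewrite /N' big_ord_recr/= -addnA addnCA leq_addr.
have N'S k : (N' k <= N' k.+1)%N by rewrite /N' [in leqRHS]big_ord_recr/= addnS -addnA leqW// leq_add2l leq_addl.
have kN' k : (k <= N' k)%N by rewrite leq_addl.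
pose y k := x (N' k).
have yP k : nrm ip (y k.+1 - y k) <= 4^-1 ^+ k.
  by apply: NP; [apply: leq_trans (N'S k)|]; exact: NN'.
pose l (t : R) : R := fine (limn_esup (fun k => (y k t)%:E)).
have ml : measurable_fun I l.
  apply: (@measurableT_comp _ _ _ _ _ _ fine); first exact: fine_measurable.
  apply: (@measurable_fun_limn_esup _ TR R I (fun k t => (y k t)%:E)) => k.
  by apply/measurable_EFinP; exact: L2_measurable_val.
have lP : {ae mu, forall t : TR, I t -> (fun k => y k t : R) @ \oo --> (l t : R)}.
  apply: filterS (ae_cvg_fast_cauchy yP) => t /= yt It.
  have /cvg_ex[z yz] := yt It.
  suff -> : l t = z by exact: yz.
  have yzE : (fun k => (y k t : R)%:E) @ \oo --> z%:E.
    by apply/cvg_EFin => //; exact: nearW.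
  by rewrite /l (cvg_limn_einf_sup yzE).2.
have dist n e : 0 <= e -> (exists n0, forall k, (n0 <= k)%N -> nrm ip (x n - x k) <= e) ->
    (\int[mu]_(t in I) ((x n t - l t) ^+ 2)%:E <= (e ^+ 2)%:E)%E.
  move=> e0 [n0 n0P].
  pose f k (t : TR) : \bar R := ((x n t - y k t) ^+ 2)%:E.
  have mf k : measurable_fun I (f k).
    apply/measurable_EFinP; apply: measurable_funX; apply: measurable_funB;
    exact: L2_measurable_val.
  have -> : (\int[mu]_(t in I) ((x n t - l t) ^+ 2)%:E =
      \int[mu]_(t in I) limn_einf (f^~ t))%E.
    apply: (@ae_eq_integral _ TR R mu I) => //.
    - apply/measurable_EFinP; apply: measurable_funX; apply: measurable_funB => //.
      exact: L2_measurable_val.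
    - have -> : (fun t => limn_einf (f^~ t)) = (fun t => - limn_esup (fun k => - f k t))%E by [].
      apply: (@measurableT_comp _ _ _ _ _ _ (-%E)) => //.
      apply: (@measurable_fun_limn_esup _ TR R I (fun k t => - f k t)%E) => k.
      by apply: (@measurableT_comp _ _ _ _ _ _ (-%E)) => //; exact: mf.
    - apply: filterS lP => t /= yt It; have {}yt := yt It.
      suff /cvg_limn_einf_sup[-> _] : f^~ t @ \oo --> ((x n t - l t) ^+ 2)%:E by [].
      apply/cvg_EFin; first exact: nearW.
      have -> : fine \o f^~ t = (fun k => (x n t - y k t) * (x n t - y k t)) by
        apply/funext => k /=; rewrite expr2.
      by rewrite expr2; apply: cvgM; apply: cvgB => //; exact: cvg_cst.
  apply: le_trans (@fatou _ TR R mu I _ f mf _) _ => //.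
    by move=> k t _; rewrite lee_fin sqr_ge0.
  apply: (@limn_einf_le _ _ _ n0) => k n0k.
  have -> : (\int[mu]_(t in I) f k t = (nrm ip (x n - y k) ^+ 2)%:E)%E.
    by rewrite sqr_nrmE.
  rewrite lee_fin; apply: sqr_le; first exact: nrm_ge0.
  by apply: n0P; exact: leq_trans (kN' k).
have Ll : L2 a l.
  have [n0 n0P] := xC 1 ltr01.
  have := @dist n0 1 ler01 (ex_intro _ n0 (fun k => n0P n0 k (leqnn _))).
  move=> fin; have Lxl : L2 a (fun t => x n0 t - l t).
    split; last by apply: le_lt_trans fin _; rewrite ltry.
    by apply: measurable_funB => //; exact: L2_measurable_val.
  apply: (L2_eq (f := fun t => (-1) * (x n0 t - l t) + x n0 t)).
    by move=> t _; ring.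
  by apply: L2_lin => //; exact: L2space_L2.
exists (toL2 Ll) => e e0; have [n0 n0P] := xC _ e0.
exists n0 => n n0n.
have := dist n e (ltW e0) (ex_intro _ n0 (fun k => n0P n k n0n)).
have -> : (\int[mu]_(t in I) ((x n t - l t) ^+ 2)%:E =
    (nrm ip (x n - toL2 Ll) ^+ 2)%:E)%E by rewrite sqr_nrmE.
by rewrite lee_fin => /le_of_sqr; apply; exact: ltW.
Qed.

End Completeness.

(** * Primitives *)

Section Primitive.
Variables (R : realType) (a : R).
Hypothesis a1 : a < 1.
Local Notation I := (`]a, 1[%classic : set R).
Local Notation TR := (measurableTypeR R).
Implicit Types g k : R -> R.

(** Extension by zero, which lets primitives integrate over closed intervals. *)
Definition ext g : R -> R := g \_ I.

Lemma extE g t : a < t < 1 -> ext g t = g t.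
Proof. by move=> tI; rewrite /ext patchE mem_set//= in_itv. Qed.

Lemma ext0 g t : ~~ (a < t < 1) -> ext g t = 0.
Proof. by move=> tI; rewrite /ext patchE memNset//= in_itv/=; apply/negP. Qed.

Lemma intR_ext D g : measurable D -> intR I g -> intR D (ext g).
Proof.
move=> mD gi; rewrite /intR -restrict_EFin.
apply/(@integrable_restrict _ TR R mu I (measurable_I a) D mD (EFin \o g)).
apply: intRS gi => //; first exact: measurableI.
Qed.

Lemma measurable_ext g : intR I g -> measurable_fun setT (ext g).
Proof. by move=> gi; apply: intR_measurable; exact: intR_ext. Qed.

Lemma Rint_ext D g : I `<=` D -> \int[mu]_(x in D) ext g x = \int[mu]_(x in I) g x.
Proof.
by move=> ID; rewrite /ext -Rintegral_mkcondr; congr (Rintegral _ _ _); apply: setIidr.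
Qed.

Definition Prim g x := \int[mu]_(t in `[a, x]) ext g t.

Lemma PrimB g x y : intR I g -> a <= x <= y ->
  Prim g y - Prim g x = \int[mu]_(t in `]x, y]) ext g t.
Proof.
move=> gi /andP[ax xy]; rewrite /Prim Rintegral_itvB//; exact: intR_ext.
Qed.

Lemma Prim_a g : Prim g a = 0.
Proof. by rewrite /Prim set_itv1 Rintegral_set1. Qed.

Lemma Prim_1 g : Prim g 1 = \int[mu]_(x in I) g x.
Proof. by rewrite /Prim Rint_ext//; exact: subset_itv_oo_cc. Qed.

Lemma Prim_continuous g : intR I g -> {within `[a, 1], continuous (Prim g)}.
Proof.
move=> gi; apply: (@parameterized_integral_continuous _ a 1 (ext g)); first exact: ltW.
exact: intR_ext.
Qed.

Lemma measurable_Prim g : intR I g -> measurable_fun I (Prim g).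
Proof.
move=> gi; apply: (@measurable_funS _ _ _ _ `[a, 1%R]%classic) => //.
  exact: subset_itv_oo_cc.
by apply: subspace_continuous_measurable_fun => //; exact: Prim_continuous.
Qed.

Lemma PrimB_le g k x y : a <= x <= y -> intR I g -> intR I k ->
  (forall t, a < t < 1 -> `|g t| <= k t) ->
  `|Prim g y - Prim g x| <= Prim k y - Prim k x.
Proof.
move=> axy gi ki gk; rewrite !PrimB//; apply: Rint_le_norm => //.
- by apply: measurable_funTS; exact: measurable_ext.
- move=> t _; have [tI|tI] := boolP (a < t < 1); first by rewrite !extE// gk.
  by rewrite !ext0// normr0.
- exact: intR_ext.
Qed.

Lemma Prim_nondecreasing k x y : a <= x <= y -> intR I k ->
  (forall t, a < t < 1 -> 0 <= k t) -> Prim k x <= Prim k y.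
Proof.
move=> axy ki k0; rewrite -subr_ge0 PrimB//; apply: Rintegral_ge0 => t _.
by have [tI|tI] := boolP (a < t < 1); [rewrite extE// k0|rewrite ext0].
Qed.

Lemma PrimB_le_int g x y : a <= x <= y -> y <= 1 -> intR I g ->
  `|Prim g y - Prim g x| <= \int[mu]_(t in I) `|g t|.
Proof.
move=> axy y1 gi; have gn := intR_norm gi.
apply: le_trans (PrimB_le axy gi gn _) _; first by [].
have /andP[ax xy] := axy.
have := Prim_nondecreasing (x := a) (y := x) (k := fun t => `|g t|).
have := Prim_nondecreasing (x := y) (y := 1) (k := fun t => `|g t|).
rewrite Prim_a -Prim_1 lexx ax y1 (le_trans ax xy) => /(_ isT gn (fun t _ => normr_ge0 _)) + /(_ isT gn (fun t _ => normr_ge0 _)).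
lra.
Qed.

Lemma intR_mul_Prim g k : intR I g -> intR I k ->
  intR I (fun s => g s * (Prim k 1 - Prim k s)).
Proof.
move=> gi ki; have mP := measurable_Prim ki; have mg := intR_measurable gi.
pose M := \int[mu]_(t in I) `|k t|.
apply: (intR_le (g := fun s => M * `|g s|)) => //.
- by apply: measurable_funM => //; apply: measurable_funB => //; exact: measurable_cst.
- move=> s /=; rewrite in_itv/= => /andP[sa s1].
  by rewrite normrM mulrC ler_wpM2r// PrimB_le_int// !ltW.
- by apply: intRZ => //; exact: intR_norm.
Qed.

Lemma Prim_eq g k x : {ae mu, forall t : TR, I t -> g t = k t} -> intR I g -> intR I k ->
  Prim g x = Prim k x.
Proof.
move=> gk gi ki; rewrite /Prim /Rintegral; congr fine.
apply: (@ae_eq_integral _ TR R mu `[a, x]) => //.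
- by apply/measurable_EFinP; apply: intR_measurable; exact: intR_ext.
- by apply/measurable_EFinP; apply: intR_measurable; exact: intR_ext.
- apply: filterS gk => t gk _; congr EFin; rewrite /ext !patchE.
  by case: ifPn => //; rewrite inE => /gk.
Qed.

Lemma Prim_linear (c : R) g k x : intR I g -> intR I k ->
  Prim (fun t => c * g t + k t) x = c * Prim g x + Prim k x.
Proof.
move=> gi ki; rewrite /Prim -RintZ//; last exact: intR_ext.
rewrite -RintD//; [|by apply: intRZ => //; exact: intR_ext|exact: intR_ext].
apply: Rint_eq => t _; rewrite /ext !patchE; case: ifP => // _.
by rewrite mulr0 addr0.
Qed.

(** Fubini's theorem on the triangle [s <= x]. *)
Lemma Rint_mul_Prim k g : intR I k -> intR I g ->
  \int[mu]_(x in I) (k x * Prim g x) =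
  \int[mu]_(s in I) (g s * (Prim k 1 - Prim k s)).
Proof.
move=> ki gi.
pose F (z : TR * TR) : R := if z.2 <= z.1 then ext k z.1 * ext g z.2 else 0.
have mk : measurable_fun [set: TR] (ext k) by exact: measurable_ext.
have mg : measurable_fun [set: TR] (ext g) by exact: measurable_ext.
have mF : measurable_fun [set: TR * TR] F.
  apply: measurable_fun_ifT.
  - by apply: measurable_fun_ler; [exact: measurable_snd|exact: measurable_fst].
  - apply: measurable_funM.
    + by apply: (@measurableT_comp _ _ _ _ _ _ (ext k)) => //; exact: measurable_fst.
    + by apply: (@measurableT_comp _ _ _ _ _ _ (ext g)) => //; exact: measurable_snd.
  - exact: measurable_cst.
have kT : intR setT (ext k) by exact: intR_ext.
have gT : intR setT (ext g) by exact: intR_ext.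
pose Cg := \int[mu]_(y in [set: R]) `|ext g y|.
have gN : (\int[mu]_(y in [set: TR]) `|ext g y|%:E = Cg%:E)%E.
  by rewrite [RHS]EFin_Rintegral//; exact: intR_norm.
have Cg0 : 0 <= Cg by exact: Rintegral_ge0.
have iF : (mu \x mu)%E.-integrable setT (EFin \o F).
  apply/integrable12ltyP; first by apply/measurable_EFinP.
  apply: (@le_lt_trans _ _ (\int[mu]_(x in [set: TR]) (Cg * `|ext k x|)%:E)%E).
    apply: (@ge0_le_integral _ TR R mu setT) => //.
    - by move=> x _; exact: integral_ge0.
    - apply: (@measurable_fun_fubini_tonelli_F _ _ TR TR R mu (abse \o (EFin \o F))) => //.
        by apply: measurableT_comp => //; apply/measurable_EFinP.
      by move=> x; exact: abse_ge0.
    - apply/measurable_EFinP; apply: measurable_funM; first exact: measurable_cst.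
      by apply: measurableT_comp.
    move=> x _.
    have -> : ((Cg * `|ext k x|)%:E = \int[mu]_(y in [set: TR]) (`|ext k x| * `|ext g y|)%:E)%E.
      under [RHS]eq_integral => y _ do rewrite EFinM.
      rewrite mulrC EFinM -gN; symmetry; apply: (@ge0_integralZl_EFin _ TR R mu setT) => //.
      by apply/measurable_EFinP; apply: measurableT_comp.
    apply: (@ge0_le_integral _ TR R mu setT) => //.
      - apply: measurableT_comp => //; apply/measurable_EFinP.
        apply: (@measurableT_comp _ _ _ TR (TR * TR)%type R F setT (pair x)) => //.
      - apply/measurable_EFinP; apply: measurable_funM => //.
        by apply: measurableT_comp.
      move=> y _; rewrite /F /=; case: ifP => _; last by rewrite normr0 lee_fin mulr_ge0.
      by rewrite normrM.
  rewrite -EFin_Rintegral ?ltry//.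
  by apply: intRZ => //; exact: intR_norm.
have := Fubini iF.
have -> : (\int[mu]_x \int[mu]_y (EFin \o F) (x, y) =
    (\int[mu]_(x in I) (k x * Prim g x))%:E)%E.
  have -> : (\int[mu]_(x in I) (k x * Prim g x)) =
    \int[mu]_x (ext (fun x => k x * Prim g x)) x by rewrite Rint_ext.
  have E x : (\int[mu]_y (EFin \o F) (x, y) = (ext (fun x => k x * Prim g x) x)%:E)%E.
    have [xI|xI] := boolP (a < x < 1); last first.
      rewrite ext0// /F /= ext0//.
      under eq_integral => y _ do rewrite mul0r if_same.
      exact: integral0.
    rewrite (extE _ xI).
    transitivity (\int[mu]_(y in `[a, x]) (k x * ext g y)%:E)%E; last first.
      rewrite -EFin_Rintegral//; last by apply: intRZ => //; exact: intR_ext.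
      by congr EFin; rewrite RintZ//; exact: intR_ext.
    rewrite [RHS]integral_mkcond; apply: eq_integral => y _.
    rewrite /F /= (extE _ xI) patchE; case: ifPn => yx.
      case: ifPn => //; rewrite notin_setE /= in_itv/= yx andbT => /negP; rewrite -ltNge => ya.
      by rewrite ext0 ?mulr0// negb_and -leNgt (ltW ya).
    by rewrite memNset//= in_itv/= (negbTE yx) andbF.
  under eq_integral => x _ do rewrite E.
  rewrite -EFin_Rintegral//.
  apply: intR_ext => //.
  have := @integrable_fubini_F _ _ TR TR R mu mu (EFin \o F) iF.
  rewrite /fubini_F.
  have -> : (fun x => \int[mu]_y (EFin \o F) (x, y))%E =
     EFin \o ext (fun x => k x * Prim g x) by apply/funext => x; exact: E.
  move=> iT; apply: (intR_eq (f := ext (fun x => k x * Prim g x))) => //.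
    by move=> x /=; rewrite in_itv/= => xI; rewrite extE.
  by apply: intRS iT.
have -> : (\int[mu]_y \int[mu]_x (EFin \o F) (x, y) =
    (\int[mu]_(s in I) (g s * (Prim k 1 - Prim k s)))%:E)%E.
  have -> : (\int[mu]_(s in I) (g s * (Prim k 1 - Prim k s))) =
    \int[mu]_x (ext (fun s => g s * (Prim k 1 - Prim k s))) x by rewrite Rint_ext.
  have E y : (\int[mu]_x (EFin \o F) (x, y) =
      (ext (fun s => g s * (Prim k 1 - Prim k s)) y)%:E)%E.
    have [yI|yI] := boolP (a < y < 1); last first.
      rewrite ext0// /F /= ext0//.
      under eq_integral => x _ do rewrite mulr0 if_same.
      exact: integral0.
    rewrite (extE _ yI); have /andP[ay y1] := yI.
    transitivity (\int[mu]_(x in `[y, 1%R]) (g y * ext k x)%:E)%E; last first.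
      rewrite -EFin_Rintegral//; last by apply: intRZ => //; exact: intR_ext.
      congr EFin; rewrite RintZ//; last exact: intR_ext.
      by rewrite PrimB ?ltW ?ay// -Rintegral_itv_obnd_cbnd//; exact: intR_ext.
    rewrite [RHS]integral_mkcond; apply: eq_integral => x _.
    rewrite /F /= (extE _ yI) patchE [ext k x * _]mulrC; case: ifPn => yx.
      case: ifPn => //; rewrite notin_setE /= in_itv/= yx/= => /negP; rewrite -ltNge => x1.
      by rewrite ext0 ?mulr0// negb_and -!leNgt (ltW x1) orbT.
    by rewrite memNset//= in_itv/= (negbTE yx).
  under eq_integral => x _ do rewrite E.
  rewrite -EFin_Rintegral//.
  by apply: intR_ext => //; exact: intR_mul_Prim.
by move=> H; apply: EFin_inj; exact: H.
Qed.

End Primitive.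

(** * Evaluation functionals of primitives *)

Lemma derivable_LR (R : realType) (F : R -> R) (c d : R) : c <= d ->
  (forall t, c <= t <= d -> derivable F t 1) -> derivable_oo_LRcontinuous F c d.
Proof.
move=> cd dF; have cF t : c <= t <= d -> {for t, continuous F}.
  by move=> /dF/derivable1_diffP/differentiable_continuous.
split.
- by move=> t; rewrite in_itv/= => /andP[ct td]; apply: dF; rewrite !ltW.
- by apply: cvg_at_right_filter; apply: cF; rewrite lexx.
- by apply: cvg_at_left_filter; apply: cF; rewrite lexx andbT.
Qed.

Section AlmostEverywhere.
Variable R : realType.
Local Notation TR := (measurableTypeR R).
Implicit Types f g : R -> R.

Lemma mu_itv_neq0 (c d : R) : c < d -> mu (`]c, d[%classic : set R) != 0%E.
Proof. by move=> cd; rewrite lebesgue_measure_itv/= lte_fin cd eqe subr_eq0 gt_eqF. Qed.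

(** A nonempty open interval is not negligible, so two functions that agree
    almost everywhere agree at every common point of continuity. *)
Lemma ae_eq_continuous (c d : R) f g :
  {ae mu, forall t : TR, c < t < d -> f t = g t} ->
  (forall t, c < t < d -> {for t, continuous f}) ->
  (forall t, c < t < d -> {for t, continuous g}) ->
  forall t, c < t < d -> f t = g t.
Proof.
move=> fg cf cg t td; apply/eqP/negPn/negP => neq.
have : {for t, continuous (fun x => f x - g x)}.
  by apply: continuousB; [exact: cf|exact: cg].
move=> /cvgrPdist_lt/(_ `|f t - g t|); rewrite normr_gt0 subr_eq0 => /(_ neq).
move=> /nbhs_ballP[e /= e0 eP].
case: fg => A [mA A0 subA].
pose r := Num.max c (t - e); pose s := Num.min d (t + e).
have /andP[ct dt] := td.
have rs : r < s.
  by rewrite /r /s lt_min !gt_max; apply/andP; split; apply/andP; split; lra.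
have : (mu (`]r, s[%classic : set R) <= mu A)%E.
  apply: le_measure; rewrite ?inE; [by []|exact: mA|].
  move=> x /=; rewrite in_itv/= gt_max lt_min => /andP[/andP[cx tx] /andP[xd xt]].
  apply: subA => /=; apply: contrapT => /contrapT H.
  have fgx : f x = g x by apply: H; rewrite cx.
  have xb : ball t e x by rewrite /ball/= ltr_norml; apply/andP; split; lra.
  by have := eP x xb; rewrite /= fgx subrr subr0 ltxx.
rewrite A0 measure_le0; exact/negP/mu_itv_neq0.
Qed.

Lemma Rint0_ae (D : set R) f : measurable D -> measurable_fun D f ->
  (forall x, D x -> 0 <= f x) -> intR D f -> \int[mu]_(x in D) f x = 0 ->
  {ae mu, forall t : TR, D t -> f t = 0}.
Proof.
move=> mD mf f0 fi f00.
have /(@ae_eq_integral_abs _ TR R mu D mD) : (\int[mu]_(x in D) `|(EFin \o f) x| = 0)%E.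
  transitivity (\int[mu]_(x in D) (f x)%:E)%E; last by rewrite -EFin_Rintegral// f00.
  by apply: eq_integral => x; rewrite inE => Dx /=; rewrite ger0_norm ?f0.
have mEf : measurable_fun D (EFin \o f) by exact/measurable_EFinP.
move=> /(_ mEf); apply: filterS => t H Dt; apply: EFin_inj; exact: H.
Qed.

Lemma Rint_ae_eq (D : set R) f g : measurable D -> measurable_fun D f ->
  measurable_fun D g -> {ae mu, forall t : TR, D t -> f t = g t} ->
  \int[mu]_(x in D) f x = \int[mu]_(x in D) g x.
Proof.
move=> mD mf mg fg; rewrite /Rintegral; congr fine.
apply: (@ae_eq_integral _ TR R mu D) => //; try exact/measurable_EFinP.
by apply: filterS fg => t fg Dt; rewrite fg.
Qed.

End AlmostEverywhere.

Section InverseOperator.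
Variables (R : realType) (a : R).
Hypothesis a1 : a < 1.
Local Notation I := (`]a, 1[%classic : set R).
Local Notation TR := (measurableTypeR R).
Local Notation V := (L2space a).
Local Notation ip := (@L2ip R a).
Local Notation nrm := (nrm (@L2ip R a)).
Let ipP : semi_inner_product ip := L2ip_semi_inner a.
Implicit Types (g : R -> R) (f : V).

Lemma intR_val f : intR I f. Proof. exact: L2_integrable (L2space_L2 f). Qed.

(** Lebesgue's differentiation theorem: almost everywhere, [g] is the derivative
    of its primitive. *)
Lemma Prim_eq0 g : intR I g -> (forall x, a < x < 1 -> Prim a g x = 0) ->
  {ae mu, forall t : TR, I t -> g t = 0}.
Proof.
move=> gi P0.
have loc : locally_integrable [set: R] (ext a g).
  by apply: open_integrable_locally => //; [exact: openT|exact: intR_ext].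
have iy y : mu.-integrable [set` Interval (BLeft a) (BRight y)] (EFin \o ext a g).
  exact: intR_ext.
have H0 := FTC1 iy loc; apply: (@filterS _ _ (ae_filter_ringOfSetsType mu) _ _ _ H0) => t /= H.
rewrite in_itv/= => tI.
have /andP[at_ t1] := tI.
have [] := H; first by rewrite lte_fin.
move=> _; rewrite extE// => <-; rewrite derive1E.
rewrite (@near_eq_derive _ _ _ _ (cst 0)); first exact: derive_cst.
have : \forall y \near t, y \in `]a, 1[.
  by apply: near_in_itvoo; rewrite in_itv.
by apply: filterS => y; rewrite in_itv/= => yI; exact: P0.
Qed.

(** The indicator of the half-line up to [x]; as an element of the space it
    represents the evaluation at [x] of the primitive. *)
Definition ind x : R -> R := fun t => if t <= x then 1 else 0.

Lemma ind_L2 x : L2 a (ind x).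
Proof.
apply: (L2_bounded (M := 1)).
  have -> : ind x = \1_`]-oo, x].
    by apply/funext => t; rewrite /ind indicE mem_setE in_itv/=; case: (t <= x).
  by [].
by move=> t _; rewrite /ind; case: (t <= x); rewrite ?normr1 ?normr0.
Qed.

Definition indV x : V := toL2 (ind_L2 x).

Lemma Rint_ind g x : a <= x <= 1 -> \int[mu]_(t in I) (g t * ind x t) = Prim a g x.
Proof.
move=> /andP[ax x1]; rewrite /Prim Rintegral_mkcond [RHS]Rintegral_mkcond.
congr (Rintegral _ _ _); apply/funext => t; rewrite !patchE.
rewrite !mem_setE !in_itv/= /ind.
have [ta|ta] := ltP a t; rewrite /= ?(ltW ta); last first.
  by case: ifP => // _; rewrite ext0// negb_and -leNgt ta.
have [t1|t1] := ltP t 1; rewrite /=.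
  by case: (t <= x); rewrite ?mulr1 ?mulr0// extE// ta.
by case: ifP => // _; rewrite ext0// negb_and -!leNgt t1 orbT.
Qed.

Lemma ip_ind f x : a <= x <= 1 -> ip f (indV x) = Prim a f x.
Proof. exact: Rint_ind. Qed.

Lemma sqr_nrm_ind x : a <= x <= 1 -> nrm (indV x) ^+ 2 = x - a.
Proof.
move=> xI; have /andP[ax x1] := xI; rewrite (sqr_nrm ipP) ip_ind//.
have gi : intR I (indV x) by exact: intR_val.
rewrite /Prim -Rintegral_itv_obnd_cbnd; last exact: intR_ext.
rewrite -Rintegral_itv_bndo_bndc; last exact: intR_ext.
transitivity (\int[mu]_(t in (`]a, x[%classic : set R)) (1 : R)).
  apply: Rint_eq => t /=; rewrite in_itv/= => /andP[ta tx].
  by rewrite extE/= /ind ?(ltW tx)// ta (lt_le_trans tx).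
by rewrite Rint_cst// mul1r.
Qed.

(** Cauchy-Schwarz against the indicator. *)
Lemma sqr_Prim_le f x : a <= x <= 1 -> Prim a f x ^+ 2 <= (x - a) * nrm f ^+ 2.
Proof.
move=> xI; rewrite -(ip_ind _ xI) -(sqr_nrm_ind xI) !(sqr_nrm ipP) mulrC.
exact: sqr_ip_le.
Qed.

Lemma Prim_le_sqrt f x : a <= x <= 1 -> `|Prim a f x| <= nrm f * Num.sqrt (x - a).
Proof.
move=> xI; have /andP[ax x1] := xI.
apply: le_of_sqr; first by rewrite mulr_ge0 ?sqrtr_ge0 ?nrm_ge0.
have xa : 0 <= x - a by rewrite subr_ge0.
by rewrite real_normK ?num_real// exprMn (sqr_sqrtr xa) [leRHS]mulrC sqr_Prim_le.
Qed.

Definition rsqrt (t : R) := (Num.sqrt (t - a))^-1.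

(** The primitive [2 sqrt (t - a)] stays bounded on the intervals [c n, 1]
    exhausting ]a, 1]. *)
Lemma intR_rsqrt : intR I rsqrt.
Proof.
pose c n : R := a + (1 - a) / n.+2%:R.
have c_gt n : a < c n by rewrite /c ltrDl divr_gt0// subr_gt0.
have c_lt n : c n < 1.
  by rewrite /c -ltrBrDl ltr_pdivrMr// ltr_pMr ?subr_gt0// ltr1n.
pose D n : set R := `[c n, 1]%classic.
have cont t : a < t -> {for t, continuous rsqrt}.
  move=> at_; apply: continuousV; first by rewrite gt_eqF// sqrtr_gt0 subr_gt0.
  apply: continuous_comp; last exact: sqrt_continuous.
  by apply: continuousB => //; exact: cvg_cst.
have der t : a < t -> is_derive t 1 (fun t => 2 * Num.sqrt (t - a)) (rsqrt t).
  move=> at_; have ta0 : 0 < t - a by rewrite subr_gt0.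
  have H1 := @is_derive1_sqrt R _ ta0.
  have H2 : is_derive t 1 (fun t => t - a) 1.
    by apply: is_derive_eq; rewrite subr0.
  have H3 := @is_derive1_comp _ Num.sqrt (fun t => t - a) t _ _ H1 H2.
  have H4 := is_deriveZ 2 H3.
  apply: is_derive_eq H4 _.
  by rewrite /rsqrt /GRing.scale/=; field; rewrite gt_eqF// sqrtr_gt0.
have mDr : forall n0 : nat, measurable_fun (D n0) rsqrt.
  move=> n0; apply: subspace_continuous_measurable_fun; first exact: measurable_itv.
  apply: continuous_in_subspaceT => t; rewrite inE /D /= in_itv/= => /andP[ct _].
  by apply: cont; exact: lt_le_trans ct.
have ndD : {homo D : n m / (n <= m)%N >-> (n <= m)%O}.
  move=> n m nm; apply/subsetPset => t; rewrite /D /= !in_itv/= => /andP[ct ->]; rewrite andbT.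
  apply: le_trans ct; rewrite /c lerD2l ler_pM2l ?subr_gt0//.
  by rewrite lef_pV2 ?posrE// ler_nat.
have UD : \bigcup_n D n = `]a, 1%R]%classic.
  apply/seteqP; split => t.
    by move=> [n _]; rewrite /D /= !in_itv/= => /andP[ct ->]; rewrite (lt_le_trans _ ct).
  rewrite /= in_itv/= => /andP[at_ t1].
  exists (Num.truncn ((1 - a) / (t - a))) => //; rewrite /D /= in_itv/= t1 andbT.
  rewrite /c -lerBrDl ler_pdivrMr// mulrC -ler_pdivrMr ?subr_gt0//.
  by apply: le_trans (ltW (truncnS_gt _)) _; rewrite ler_nat.
have intD n : (\int[mu]_(t in D n) (rsqrt t)%:E <= (2 * Num.sqrt (1 - a))%:E)%E.
  rewrite /D (@continuous_FTC2 _ rsqrt (fun t => 2 * Num.sqrt (t - a)) (c n) 1)//.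
  - rewrite -EFinB lee_fin lerBlDr lerDl mulr_ge0// sqrtr_ge0.
  - apply: continuous_in_subspaceT => t; rewrite inE /D /= in_itv/= => /andP[ct _].
    by apply: cont; exact: lt_le_trans ct.
  - by apply: derivable_LR => [|t /andP[ct _]]; [exact: ltW|]; have [] := der t (lt_le_trans (c_gt n) ct).
  - move=> t; rewrite in_itv/= => /andP[ct _]; rewrite derive1E.
    by have /@derive_val := der t (lt_trans (c_gt n) ct).
have r0 t : 0 <= rsqrt t by rewrite invr_ge0 sqrtr_ge0.
have cvgD := @ge0_nondecreasing_set_cvg_integral _ TR R D (EFin \o rsqrt) mu ndD
  (fun n => measurable_itv _) _ (fun n t _ => r0 t).
have {}cvgD := cvgD (fun n => iffRL (measurable_EFinP _ _) (mDr n)).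
apply: (intRS (E := `]a, 1%R]%classic)) => //; first by move=> t /=; rewrite !in_itv/= => /andP[-> /ltW].
apply/integrableP; split.
  apply/measurable_EFinP; rewrite -UD; apply/(measurable_fun_bigcup _ (fun n => measurable_itv _)) => n; exact: mDr.
apply: (@le_lt_trans _ _ (2 * Num.sqrt (1 - a))%:E); last by rewrite ltry.
have -> : (\int[mu]_(t in `]a, 1%R]) `|(EFin \o rsqrt) t| =
    \int[mu]_(t in \bigcup_n D n) (EFin \o rsqrt) t)%E.
  by rewrite UD; apply: eq_integral => t _; rewrite /= ger0_norm.
rewrite -(cvg_lim _ cvgD)//; apply: lime_le; first by apply/cvg_ex; eexists; exact: cvgD.
by apply: nearW => n; exact: intD.
Qed.

End InverseOperator.

(** * The inverse of the degenerate operator *)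

Section InverseOperator2.
Variables (R : realType) (a : R).
Hypothesis a1 : a < 1.
Local Notation I := (`]a, 1[%classic : set R).
Local Notation TR := (measurableTypeR R).
Local Notation V := (L2space a).
Local Notation ip := (@L2ip R a).
Local Notation nrm := (nrm (@L2ip R a)).
Let ipP : semi_inner_product ip := L2ip_semi_inner a.
Implicit Types (g : R -> R) (f h : V).

(** The flux [(t - a) u'] of a solution of [((t - a) u')' = g] vanishes at [a], so
    it is the primitive of [g]; dividing by the weight gives [u']. *)
Definition dK g t := Prim a g t / (t - a).

Definition Kfun g x := Prim a (dK g) x - Prim a (dK g) 1.

Lemma dK_le f t : a < t < 1 -> `|dK f t| <= nrm f * rsqrt a t.
Proof.
move=> /andP[at_ t1]; have ta : 0 < t - a by rewrite subr_gt0.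
rewrite /dK normrM normfV (gtr0_norm ta) ler_pdivrMr// -mulrA.
have -> : rsqrt a t * (t - a) = Num.sqrt (t - a).
  rewrite /rsqrt -{2}(sqr_sqrtr (ltW ta)) expr2 mulrA mulVf ?mul1r//.
  by rewrite gt_eqF// sqrtr_gt0.
by apply: Prim_le_sqrt => //; rewrite (ltW at_) ltW.
Qed.

Lemma Prim_continuous_at g t : intR I g -> a < t < 1 -> {for t, continuous (Prim a g)}.
Proof.
move=> gi tI; apply: (within_continuous_continuous a1).
  exact: Prim_continuous.
by rewrite in_itv.
Qed.

Lemma dK_continuous_at g t : intR I g -> a < t < 1 -> {for t, continuous (dK g)}.
Proof.
move=> gi tI; have /andP[at_ _] := tI.
apply: continuousM; first exact: Prim_continuous_at.
apply: continuousV; first by rewrite gt_eqF// subr_gt0.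
by apply: continuousB => //; exact: cvg_cst.
Qed.

Lemma measurable_dK g : intR I g -> measurable_fun I (dK g).
Proof.
move=> gi; apply: open_continuous_measurable_fun; first exact: interval_open.
by move=> t; rewrite inE/= in_itv/= => tI; exact: dK_continuous_at.
Qed.

Lemma intR_dK f : intR I (dK f).
Proof.
apply: (intR_le (g := fun t => nrm f * rsqrt a t)) => //.
- by apply: measurable_dK; exact: intR_val.
- by move=> t /=; rewrite in_itv/=; exact: dK_le.
- by apply: intRZ => //; exact: intR_rsqrt.
Qed.

Lemma Kfun_continuous f : {within `[a, 1], continuous (Kfun f)}.
Proof.
apply: within_continuousB; last exact: cst_continuous.
by apply: Prim_continuous => //; exact: intR_dK.
Qed.

Lemma Kfun_1 g : Kfun g 1 = 0. Proof. exact: subrr. Qed.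

Lemma Kfun_le f x : a <= x <= 1 ->
  `|Kfun f x| <= nrm f * \int[mu]_(t in I) rsqrt a t.
Proof.
move=> /andP[ax x1].
apply: (@le_trans _ _ (\int[mu]_(t in I) `|dK f t|)).
  rewrite /Kfun distrC; apply: PrimB_le_int => //; last exact: intR_dK.
  by rewrite ax.
rewrite -RintZ//; last exact: intR_rsqrt.
apply: Rint_le => //; first by apply: intR_norm; exact: intR_dK.
- by apply: intRZ => //; exact: intR_rsqrt.
- by move=> t /=; rewrite in_itv/=; exact: dK_le.
Qed.

Lemma Kfun_L2 f : L2 a (Kfun f).
Proof.
apply: (L2_bounded (M := nrm f * \int[mu]_(t in I) rsqrt a t)).
  apply: measurable_funB; last exact: measurable_cst.
  by apply: measurable_Prim => //; exact: intR_dK.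
by move=> x /andP[ax x1]; apply: Kfun_le; rewrite !ltW.
Qed.

Definition KV f : V := toL2 (Kfun_L2 f).

(** Integration by parts: the Dirichlet form of the operator. *)
Lemma ip_KV f h : ip (KV f) h = - \int[mu]_(x in I) (dK f x * Prim a h x).
Proof.
rewrite Rint_mul_Prim//; [|exact: intR_dK|exact: intR_val].
rewrite -mulN1r -RintZ//; last first.
  by apply: intR_mul_Prim => //; [exact: intR_val|exact: intR_dK].
by apply: Rint_eq => x _ /=; rewrite /Kfun; ring.
Qed.

Lemma Prim_lin c f h x : Prim a (c *: f + h : V) x = c * Prim a f x + Prim a h x.
Proof. by rewrite -Prim_linear//; exact: intR_val. Qed.

Lemma Kfun_lin c f h x : a <= x <= 1 ->
  Kfun (c *: f + h : V) x = c * Kfun f x + Kfun h x.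
Proof.
move=> xI; rewrite /Kfun.
have E : dK (c *: f + h : V) = fun t => c * dK f t + dK h t.
  by apply/funext => t; rewrite /dK Prim_lin; ring.
by rewrite E !Prim_linear//; [ring|exact: intR_dK..].
Qed.

Lemma nrm_le_sup f (M : R) : 0 <= M -> (forall x, a < x < 1 -> `|f x| <= M) ->
  nrm f <= M * Num.sqrt (1 - a).
Proof.
move=> M0 fM; apply: le_of_sqr; first by rewrite mulr_ge0 ?sqrtr_ge0.
rewrite (sqr_nrm ipP) exprMn sqr_sqrtr; last by rewrite subr_ge0 ltW.
have iM : intR I (fun=> M ^+ 2) by apply: L2_integrable; exact: L2_cst.
apply: (@le_trans _ _ (\int[mu]_(x in I) (M ^+ 2))).
  apply: Rint_le => //; first exact: L2_mulr_integrable (L2space_L2 f) (L2space_L2 f).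
  move=> x /=; rewrite in_itv/= => /fM fx; rewrite -expr2 -[leLHS]real_normK ?num_real//.
  exact: sqr_le.
by rewrite Rint_cst// ltW.
Qed.

Lemma intR_energy f h : intR I (fun x => dK f x * Prim a h x).
Proof.
apply: (intR_bounded (M := nrm f * nrm h)) => //; first exact: measure_I_lty.
  apply: measurable_funM; first by apply: measurable_dK; exact: intR_val.
  by apply: measurable_Prim => //; exact: intR_val.
move=> t /=; rewrite in_itv/= => tI; have /andP[at_ t1] := tI.
rewrite normrM.
have H : `|Prim a h t| <= nrm h * Num.sqrt (t - a).
  by apply: Prim_le_sqrt => //; rewrite !ltW.
apply: le_trans (ler_pM (normr_ge0 _) (normr_ge0 _) (dK_le f tI) H) _.
have sp : 0 < Num.sqrt (t - a) by rewrite sqrtr_gt0 subr_gt0.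
by rewrite /rsqrt mulrACA mulVf ?mulr1// gt_eqF.
Qed.

Lemma energy_ge0 f x : a < x < 1 -> 0 <= dK f x * Prim a f x.
Proof.
move=> /andP[ax _]; rewrite /dK mulrAC -expr2 divr_ge0 ?sqr_ge0//.
by rewrite subr_ge0 ltW.
Qed.

(** Symmetry and sign are read on the Dirichlet form [ip_KV]. If [K f] is null,
    the form vanishes at [f], hence so does the primitive of [f], and [f] is null. *)
Lemma KV_negative_inverse :
  negative_inverse ip KV ((\int[mu]_(t in I) rsqrt a t) * Num.sqrt (1 - a)).
Proof.
have symK f h : ip (KV f) h = ip (KV h) f.
  by rewrite !ip_KV; congr (- _); apply: Rint_eq => x _; rewrite /dK; ring.
split.
- move=> c f h; apply: null_eq_ip => // k; apply: Rint_eq => x /=.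
  rewrite in_itv/= => /andP[ax x1]; rewrite Kfun_lin//= !ltW//.
- move=> f; rewrite mulrC mulrA; apply: nrm_le_sup.
    by rewrite mulr_ge0 ?nrm_ge0// Rintegral_ge0// => t _; rewrite invr_ge0 sqrtr_ge0.
  by move=> x /andP[ax x1]; apply: Kfun_le; rewrite !ltW.
- by move=> f h; rewrite symK (ipC ipP).
- move=> f; rewrite (ipC ipP) ip_KV oppr_le0; apply: Rintegral_ge0 => x /=.
  by rewrite in_itv/=; exact: energy_ge0.
- move=> f Kf0.
  have e0 : \int[mu]_(x in I) (dK f x * Prim a f x) = 0.
    apply/eqP; rewrite -oppr_eq0 -ip_KV -normr_eq0 eq_le normr_ge0 andbT.
    by apply: le_trans (ip_le_nrm ipP _ _) _; rewrite Kf0 mul0r.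
  have mE : measurable_fun I (fun x => dK f x * Prim a f x).
    exact: intR_measurable (intR_energy f f).
  have ae0 := Rint0_ae (measurable_I a) mE _ (intR_energy f f) e0.
  have {}ae0 : {ae mu, forall t : TR, a < t < 1 -> Prim a f t = 0}.
    apply: filterS (ae0 _) => [t H tI|x /=]; last by rewrite in_itv/=; exact: energy_ge0.
    have /andP[at_ _] := tI; have It : I t by rewrite /= in_itv.
    have /eqP := H It; rewrite /dK !mulf_eq0 invr_eq0 subr_eq0 (gt_eqF at_) orbF orbb.
    by move=> /eqP.
  have P0 t : a < t < 1 -> Prim a f t = 0.
    apply: (ae_eq_continuous (f := Prim a f) (g := fun=> 0) ae0).
    + by move=> s; apply: Prim_continuous_at; exact: intR_val.
    + by move=> s _; exact: cst_continuous.
  have f0 := Prim_eq0 (intR_val f) P0.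
  rewrite nrmE; suff -> : ip f f = 0 by rewrite sqrtr0.
  transitivity (\int[mu]_(t in I) (0 : R)).
    apply: Rint_ae_eq => //.
    + exact: intR_measurable (L2_mulr_integrable (L2space_L2 f) (L2space_L2 f)).
    + by apply: filterS f0 => t H It; rewrite H// mul0r.
  by rewrite Rint_cst ?mul0r// ltW.
Qed.

End InverseOperator2.

(** * Smooth plateau functions *)

Section Smooth.
Variable R : realType.
Implicit Types (f g : R -> R) (n k : nat).

(** Differentiability to order [n] of the function and of its successive
    derivatives, in a form suited to induction on [n]. *)
Fixpoint diffn n f : Prop :=
  if n is m.+1 then (forall x, derivable f x 1) /\ diffn m (derive1 f) else True.

Lemma diffn_smooth f : (forall n, diffn n f) ->
  forall n x, derivable (derive1n n f) x 1.
Proof.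
move=> H n x; elim: n f H => [|n IH] f H; first by have [] := H 1%N.
rewrite /derive1n iterSr; apply: IH => m; by have [] := H m.+1.
Qed.

Lemma diffnS n f : diffn n.+1 f -> diffn n f.
Proof. by elim: n f => [//|n IH] f [df H]; split => //; exact: IH. Qed.

Lemma diffn_lin n (c : R) f g : diffn n f -> diffn n g ->
  diffn n (fun x => c * f x + g x).
Proof.
elim: n f g => [//|n IH] f g [df Hf] [dg Hg].
have der (x : R) : is_derive x 1 (fun x => c * f x + g x) (c * derive1 f x + derive1 g x).
  have H1 : is_derive x 1 f (derive1 f x) by rewrite derive1E; exact: DeriveDef.
  have H2 : is_derive x 1 g (derive1 g x) by rewrite derive1E; exact: DeriveDef.
  exact: (is_deriveD (is_deriveZ c H1) H2).
split; first by move=> x; have [] := der x.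
have -> : derive1 (fun x => c * f x + g x) = fun x => c * derive1 f x + derive1 g x.
  by apply/funext => x; rewrite derive1E; have [_ ->] := der x.
exact: IH.
Qed.

Lemma diffnM n f g : diffn n f -> diffn n g -> diffn n (fun x => f x * g x).
Proof.
elim: n f g => [//|n IH] f g Hf Hg; have [df Hf'] := Hf; have [dg Hg'] := Hg.
have der (x : R) : is_derive x 1 (fun x => f x * g x) (1 * (derive1 f x * g x) + f x * derive1 g x).
  have H1 : is_derive x 1 f (derive1 f x) by rewrite derive1E; exact: DeriveDef.
  have H2 : is_derive x 1 g (derive1 g x) by rewrite derive1E; exact: DeriveDef.
  apply: (is_derive_eq (is_deriveM H1 H2)); rewrite /GRing.scale/=; ring.
split; first by move=> x; have [] := der x.
have -> : derive1 (fun x => f x * g x) =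
    fun x => 1 * (derive1 f x * g x) + f x * derive1 g x.
  by apply/funext => x; rewrite derive1E; have [_ ->] := der x.
by apply: diffn_lin; apply: IH => //; exact: diffnS.
Qed.

Lemma diffn_cst n (c : R) : diffn n (fun=> c).
Proof.
elim: n c => [//|n IH] c; split; first by move=> x; exact: derivable_cst.
have -> : derive1 (fun=> c) = fun=> 0 by apply/funext => x; rewrite derive1E derive_cst.
exact: IH.
Qed.

Lemma diffn_affine n f (c d : R) : diffn n f -> diffn n (fun x => f (c * x + d)).
Proof.
elim: n f => [//|n IH] f Hf; have [df Hf'] := Hf.
have der (x : R) : is_derive x 1 (fun x => f (c * x + d)) (c * derive1 f (c * x + d) + 0).
  have H1 : is_derive (c * x + d) 1 f (derive1 f (c * x + d)).
    by rewrite derive1E; exact: DeriveDef.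
  have H2 : is_derive x 1 (fun x : R => c * x + d) c.
    have := is_deriveD (is_deriveZ c (is_derive_id x 1)) (is_derive_cst d x 1).
    by rewrite addr0 /GRing.scale/= mulr1.
  have H3 := @is_derive1_comp _ f (fun x => c * x + d) x _ _ H1 H2.
  by apply: is_derive_eq H3 _; rewrite addr0 mulrC.
split; first by move=> x; have [] := der x.
have -> : derive1 (fun x => f (c * x + d)) =
    fun x => c * derive1 f (c * x + d) + 0.
  by apply/funext => x; rewrite derive1E; have [_ ->] := der x.
apply: diffn_lin; first exact: IH.
exact: diffn_cst.
Qed.

(** The family [x^-k e^(-1/x)] is stable under derivation up to linear
    combinations, so its members are smooth all at once. *)
Definition flat k : R -> R :=
  fun x => if 0 < x then x^-1 ^+ k * expR (- x^-1) else 0.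

Lemma expR_ge_pow k (y : R) : 0 <= y -> (y / k.+1%:R) ^+ k.+1 <= expR y.
Proof.
move=> y0; have -> : expR y = expR (y / k.+1%:R) ^+ k.+1.
  by rewrite -expRM_natl mulrC divfK.
apply: lerXn2r; rewrite ?nnegrE ?expR_ge0 ?divr_ge0//.
by apply: le_trans (expR_ge1Dx _); rewrite lerDr.
Qed.

(** The quadratic bound gives the derivative 0 at the origin. *)
Lemma flat_le k : exists C, forall x, `|flat k x| <= C * x ^+ 2.
Proof.
exists (k.+2%:R ^+ k.+2) => x; rewrite /flat; case: ifPn => x0; last first.
  by rewrite normr0 mulr_ge0 ?sqr_ge0 ?exprn_ge0.
have y0 : 0 < x^-1 by rewrite invr_gt0.
rewrite ger0_norm ?mulr_ge0 ?expR_ge0 ?exprn_ge0 ?(ltW y0)//.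
rewrite expRN ler_pdivrMr ?expR_gt0//.
have := expR_ge_pow k.+1 (ltW y0).
rewrite expr_div_n ler_pdivrMr ?exprn_gt0// => H.
have -> : x^-1 ^+ k = x ^+ 2 * x^-1 ^+ k.+2.
  rewrite [x^-1 ^+ k.+2]exprS [x^-1 ^+ k.+1]exprS; move: (x^-1 ^+ k) => w.
  by field; rewrite gt_eqF.
apply: le_trans (ler_wpM2l (sqr_ge0 x) H) _.
by rewrite le_eqVlt; apply/orP; left; apply/eqP; ring.
Qed.

Lemma flat_derive k (x : R) : is_derive x 1 (flat k) (- k%:R * flat k.+1 x + flat k.+2 x).
Proof.
have [x0|x0|x0] := ltgtP x 0.
- have -> : - k%:R * flat k.+1 x + flat k.+2 x = 0.
    by rewrite /flat !ltNge (ltW x0) mulr0 addr0.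
  apply: (near_eq_is_derive _ (is_derive_cst (0 : R^o) (x : R^o) 1)).
  have : \forall y \near x, y < 0 by exact: lt_nbhsl.
  by apply: filterS => y y0; rewrite /flat ltNge (ltW y0).
- have -> : - k%:R * flat k.+1 x + flat k.+2 x =
      - k%:R * (x^-1 ^+ k.+1 * expR (- x^-1)) + x^-1 ^+ k.+2 * expR (- x^-1).
    by rewrite /flat x0.
  have xn0 : x != 0 by rewrite gt_eqF.
  have H1 : is_derive x 1 (fun x : R => x^-1) (- x^-1 ^+ 2).
    have H0 : is_derive x 1 (fun y : R => y) 1 by exact: is_derive_id.
    by apply: (is_derive_eq (is_deriveV _ H0)) => //; rewrite /GRing.scale/= mulr1 exprVn.
  have H2 : is_derive x 1 (fun x : R => x^-1 ^+ k) (- k%:R * x^-1 ^+ k.+1).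
    elim: (k) => [|j IH].
      by apply: (is_derive_eq (is_derive_cst (1 : R^o) (x : R^o) 1)); rewrite oppr0 mul0r.
    have -> : (fun x : R => x^-1 ^+ j.+1) = (fun x => x^-1 * x^-1 ^+ j).
      by apply/funext => y; rewrite exprS.
    apply: (is_derive_eq (is_deriveM H1 IH)).
    by rewrite /GRing.scale/= -natr1 !exprS; ring.
  have H3 := is_deriveN H1.
  have H4 := @is_derive1_comp _ expR (fun x => - x^-1) x _ _ (is_derive_expR _) H3.
  have D : is_derive x 1 (fun x : R => x^-1 ^+ k * expR (- x^-1))
      (- k%:R * (x^-1 ^+ k.+1 * expR (- x^-1)) + x^-1 ^+ k.+2 * expR (- x^-1)).
    refine (is_derive_eq (is_deriveM H2 H4) _).
    by rewrite /GRing.scale/= !exprS; ring.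
  apply: (near_eq_is_derive _ D).
  have : \forall y \near x, 0 < y by exact: lt_nbhsr.
  by apply: filterS => y y0; rewrite /flat y0.
- have [C CP] := flat_le k.
  rewrite x0 {x x0}.
  have -> : - k%:R * flat k.+1 0 + flat k.+2 0 = 0.
    by rewrite /flat ltxx mulr0 addr0.
  have C0 : 0 <= C by have := CP 1; rewrite expr1n mulr1; exact: le_trans.
  have lim0 : (fun h => h^-1 *: (flat k (h *: 1 + 0) - flat k 0)) @ 0^' --> (0 : R).
    apply/cvgrPdist_le => e e0.
    have D0 : 0 < e / (C + 1) by rewrite divr_gt0//; lra.
    near=> h.
    have hN0 : h != 0 by near: h; exact: nbhs_dnbhs_neq.
    rewrite sub0r normrN addr0 /GRing.scale/= mulr1 [flat k 0]/flat ltxx subr0.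
    rewrite normrM normfV ler_pdivrMl ?normr_gt0//.
    apply: le_trans (CP h) _.
    rewrite -[h ^+ 2]real_normK ?num_real// expr2 mulrCA.
    rewrite ler_wpM2l//.
    have : `|h| <= e / (C + 1).
      near: h; apply: nbhs_dnbhs; have := @nbhs0_le _ R _ D0; exact.
    rewrite ler_pdivlMr; last lra.
    have := normr_ge0 h; nra.
  split; first by apply/cvg_ex; exists 0; exact: lim0.
  exact/cvg_lim.
Unshelve. all: by end_near. Qed.

Lemma diffn_flat n k : diffn n (flat k).
Proof.
elim: n k => [//|n IH] k; split; first by move=> x; have [] := flat_derive k x.
have -> : derive1 (flat k) = fun x => - k%:R * flat k.+1 x + flat k.+2 x.
  by apply/funext => x; rewrite derive1E; have [_ ->] := flat_derive k x.
exact: diffn_lin.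
Qed.

(** Smooth functions vanishing outside ]c, d[ and increasing to its indicator. *)
Definition plateau n c d : R -> R :=
  fun x => flat 0 (n.+1%:R * x + - (n.+1%:R * c)) * flat 0 (- n.+1%:R * x + n.+1%:R * d).

Lemma diffn_plateau m n c d : diffn m (plateau n c d).
Proof. by apply: diffnM; apply: diffn_affine; exact: diffn_flat. Qed.

Lemma flat0_itv x : 0 <= flat 0 x <= 1.
Proof.
rewrite /flat; case: ifPn => x0; last by rewrite lexx ler01.
by rewrite mul1r expR_ge0/= -expR0 ler_expR oppr_le0 invr_ge0 ltW.
Qed.

Lemma plateau_itv n c d x : 0 <= plateau n c d x <= 1.
Proof.
rewrite /plateau; have /andP[h1 h2] := flat0_itv (n.+1%:R * x + - (n.+1%:R * c)).
have /andP[h3 h4] := flat0_itv (- n.+1%:R * x + n.+1%:R * d).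
by rewrite mulr_ge0//= mulr_ile1.
Qed.

Lemma plateau_out n c d x : ~~ (c < x < d) -> plateau n c d x = 0.
Proof.
rewrite negb_and -!leNgt => /orP[xc|dx]; rewrite /plateau /flat.
  have -> : (0 < n.+1%:R * x + - (n.+1%:R * c)) = false; last by rewrite mul0r.
  by apply/negbTE; rewrite -leNgt subr_le0 ler_pM2l.
have -> : (0 < - n.+1%:R * x + n.+1%:R * d) = false; last by rewrite mulr0.
by apply/negbTE; rewrite -leNgt addrC mulNr subr_le0 ler_pM2l.
Qed.

Lemma cvg_flat0 (y : R) : 0 < y -> flat 0 (n.+1%:R * y) @[n --> \oo] --> (1 : R).
Proof.
move=> y0.
have H0 : (fun n : nat => - (y^-1 * n.+1%:R^-1) : R) @ \oo --> (0 : R).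
  have cy : (fun=> y^-1 : R) @ \oo --> y^-1 by exact: cvg_cst.
  by have := cvgN (cvgM cy (@cvg_harmonic R)); rewrite mulr0 oppr0; exact.
have H : (fun n : nat => expR (- (y^-1 * n.+1%:R^-1))) @ \oo --> expR 0.
  by apply: continuous_cvg => //; exact: continuous_expR.
rewrite expR0 in H.
apply: cvg_trans H; apply: near_eq_cvg; apply: nearW => n.
by rewrite /flat mulr_gt0// mul1r invfM mulrC.
Qed.

Lemma cvg_plateau c d x : plateau n c d x @[n --> \oo] --> (if c < x < d then 1 else 0 : R).
Proof.
case: ifPn => [/andP[cx xd]|xcd]; last first.
  by under eq_fun do rewrite plateau_out//; exact: cvg_cst.
rewrite -[1 in X in _ --> X]mulr1.
have E n : plateau n c d x = flat 0 (n.+1%:R * (x - c)) * flat 0 (n.+1%:R * (d - x)).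
  by rewrite /plateau; congr (flat 0 _ * flat 0 _); ring.
by under eq_fun do rewrite E; apply: cvgM; apply: cvg_flat0; rewrite subr_gt0.
Qed.

End Smooth.

(** * Weak derivatives and primitives *)

Section WeakDerivative.
Variables (R : realType) (a : R).
Hypothesis a1 : a < 1.
Local Notation I := (`]a, 1[%classic : set R).
Local Notation TR := (measurableTypeR R).
Implicit Types (f g p P psi phi : R -> R).

Definition supported psi := exists c d : R,
  [/\ a < c, d < 1 & forall x, x \notin `[c, d] -> psi x = 0].

Lemma test_continuous phi : test_function a phi -> continuous phi.
Proof.
by move=> [dphi _] x; apply/differentiable_continuous/derivable1_diffP; exact: (dphi 0%N).
Qed.

Lemma test_derive_continuous phi : test_function a phi -> continuous (derive1 phi).
Proof.
by move=> [dphi _] x; apply/differentiable_continuous/derivable1_diffP; exact: (dphi 1%N).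
Qed.

Lemma test_derive_supported phi : test_function a phi -> supported (derive1 phi).
Proof.
move=> [_ [c [d [ac d1 phi0]]]]; exists c, d; split => // x xcd.
rewrite derive1E (@near_eq_derive _ R^o R^o _ (cst 0)); first exact: derive_cst.
have : open (~` `[c, d]%classic : set R).
  by apply: closed_openC; exact: interval_closed.
move=> op; have : \forall y \near x, (~` `[c, d]%classic) y.
  by apply: open_nbhs_nbhs; split => //; move: xcd => /negP.
by apply: filterS => y /negP ycd; exact: phi0.
Qed.

Lemma supported_le psi : continuous psi -> exists M, forall x, a <= x <= 1 -> `|psi x| <= M.
Proof.
move=> cpsi.
have [|c _ cP] := @EVT_max R (fun x => `|psi x|) a 1 (ltW a1).
  apply: continuous_subspaceT => x; apply: continuous_comp; first exact: cpsi.
  exact: norm_continuous.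
by exists `|psi c| => x xI; apply: cP; rewrite in_itv.
Qed.

Lemma continuous_intR psi : continuous psi -> intR I psi.
Proof.
move=> cpsi; apply: (intRS (E := `[a, 1]%classic)) => //.
  exact: subset_itv_oo_cc.
apply: continuous_compact_integrable; first exact: segment_compact.
exact: continuous_subspaceT.
Qed.

Lemma Prim_derive_test phi x : test_function a phi -> a <= x <= 1 ->
  Prim a (derive1 phi) x = phi x.
Proof.
move=> tphi /andP[ax x1].
have [c [d [ac d1 dphi0]]] := test_derive_supported tphi.
have phia : phi a = 0.
  have [_ [c' [d' [ac' d1' phi0]]]] := tphi.
  by apply: phi0; rewrite in_itv/= negb_and -!ltNge ac'.
move: ax; rewrite le_eqVlt => /predU1P[<-|ax]; first by rewrite Prim_a phia.
have [dphi _] := tphi.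
rewrite /Prim /Rintegral.
have -> : (\int[mu]_(t in `[a, x]) (ext a (derive1 phi) t)%:E =
    \int[mu]_(t in `[a, x]) (derive1 phi t)%:E)%E.
  apply: eq_integral => t; rewrite inE/= in_itv/= => /andP[at_ tx]; congr EFin.
  have [tI|tI] := boolP (a < t < 1); first by rewrite extE.
  rewrite ext0// dphi0// in_itv/=.
  move: tI; rewrite !negb_and -!leNgt -!ltNge => /orP[ta|t1].
    by rewrite (le_lt_trans ta ac).
  by rewrite (lt_le_trans d1 t1) orbT.
rewrite (continuous_FTC2 ax (F := phi)) ?phia ?sube0//.
- by apply: continuous_subspaceT; exact: test_derive_continuous.
- by apply: derivable_LR => [|t _]; [exact: ltW|exact: (dphi 0%N)].
Qed.

Lemma Rint_Prim_test g phi : intR I g -> test_function a phi ->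
  \int[mu]_(x in I) (derive1 phi x * Prim a g x) = - \int[mu]_(x in I) (g x * phi x).
Proof.
move=> gi tphi; have ci := continuous_intR (test_derive_continuous tphi).
rewrite Rint_mul_Prim// -mulN1r -RintZ//; last first.
  apply: (intR_eq (f := fun s => - (g s * (Prim a (derive1 phi) 1 - Prim a (derive1 phi) s)))) => //.
    move=> s /=; rewrite in_itv/= => /andP[sa s1].
    rewrite !Prim_derive_test ?lexx ?ltW//.
    have [_ [c [d [ac d1 phi0]]]] := tphi.
    have -> : phi 1 = 0 by apply: phi0; rewrite in_itv/= negb_and -!ltNge d1 orbT.
    ring.
  apply: (intR_eq (f := fun s => (-1) * (g s * (Prim a (derive1 phi) 1 - Prim a (derive1 phi) s)))) => //.
    by move=> s _; ring.
  by apply: intRZ => //; exact: intR_mul_Prim.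
apply: Rint_eq => s /=; rewrite in_itv/= => /andP[sa s1].
rewrite !Prim_derive_test ?lexx ?ltW//.
have [_ [c [d [ac d1 phi0]]]] := tphi.
have -> : phi 1 = 0 by apply: phi0; rewrite in_itv/= negb_and -!ltNge d1 orbT.
ring.
Qed.

Lemma intR_mul_bounded f psi (M : R) : intR I f -> measurable_fun I psi ->
  (forall x, a < x < 1 -> `|psi x| <= M) -> intR I (fun x => f x * psi x).
Proof.
move=> fi mpsi psiM; apply: (intR_le (g := fun x => M * `|f x|)) => //.
- by apply: measurable_funM => //; exact: intR_measurable.
- move=> x /=; rewrite in_itv/= => xI; rewrite normrM mulrC ler_wpM2r//.
  exact: psiM.
- by apply: intRZ => //; exact: intR_norm.
Qed.

Lemma continuous_measurable_I psi : continuous psi -> measurable_fun I psi.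
Proof. by move=> cpsi; apply: measurable_funTS; exact: continuous_measurable_fun. Qed.

Lemma intR_mul_continuous f psi : intR I f -> continuous psi ->
  intR I (fun x => f x * psi x).
Proof.
move=> fi cpsi; have [M MP] := supported_le cpsi.
apply: (intR_mul_bounded (M := M)) => //; first exact: continuous_measurable_I.
by move=> x /andP[ax x1]; apply: MP; rewrite !ltW.
Qed.

(** A primitive has its integrand as weak derivative: Fubini's theorem replaces
    integration by parts. *)
Lemma weak_derivative_Prim p g c : intR I p -> intR I g ->
  {ae mu, forall t : TR, I t -> p t = c + Prim a g t} -> weak_derivative a p g.
Proof.
move=> pi gi pE; split; [by apply: open_integrable_locally => //; exact: interval_open..|].
move=> phi tphi; have cphi' := test_derive_continuous tphi.
have mP := measurable_Prim a1 gi.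
have mphi := continuous_measurable_I cphi'.
transitivity (\int[mu]_(x in I) (c * derive1 phi x + derive1 phi x * Prim a g x)).
  apply: Rint_ae_eq => //.
  - by apply: measurable_funM => //; exact: intR_measurable.
  - apply: measurable_funD; apply: measurable_funM => //; exact: measurable_cst.
  - by apply: filterS pE => t H It; rewrite H//; ring.
rewrite RintD//.
- rewrite Rint_Prim_test// RintZ//; last exact: continuous_intR.
  rewrite -Prim_1 Prim_derive_test ?lexx ?ltW//.
  have [_ [c' [d' [ac d1 phi0]]]] := tphi.
  have -> : phi 1 = 0 by apply: phi0; rewrite in_itv/= negb_and -!ltNge d1 orbT.
  by rewrite mulr0 add0r.
- by apply: intRZ => //; exact: continuous_intR.
- apply: (intR_eq (f := fun x => Prim a g x * derive1 phi x)) => //.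
    by move=> x _; rewrite mulrC.
  apply: intR_mul_continuous => //.
  apply: (intR_bounded (M := \int[mu]_(t in I) `|g t|)) => //; first exact: measure_I_lty.
  move=> x /=; rewrite in_itv/= => /andP[ax x1].
  by have := @PrimB_le_int R a g a x; rewrite Prim_a subr0 lexx; apply=> //; exact: ltW.
Qed.

(** ** The du Bois-Reymond lemma *)

Lemma locally_intR P c d : locally_integrable I P -> a < c -> d < 1 ->
  intR `[c, d]%classic P.
Proof.
move=> [mP _ locP] ac d1.
have sub : `[c, d]%classic `<=` I.
  by move=> x /=; rewrite !in_itv/= => /andP[cx xd]; rewrite (lt_le_trans ac cx) (le_lt_trans xd d1).
apply/integrableP; split.
  by apply/measurable_EFinP; exact: measurable_funS mP.
by apply: locP => //; exact: segment_compact.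
Qed.

Lemma intR_supported P psi : locally_integrable I P -> continuous psi ->
  supported psi -> intR I (fun x => P x * psi x).
Proof.
move=> locP cpsi [c [d [ac d1 psi0]]].
have Pcd := locally_intR locP ac d1.
have PI : intR I (P \_ `[c, d]).
  rewrite /intR -restrict_EFin.
  apply/(@integrable_restrict _ TR R mu `[c, d]%classic (measurable_itv _) I (measurable_itv _) (EFin \o P)).
  by apply: intRS Pcd => //; exact: measurableI.
apply: (intR_eq (f := fun x => (P \_ `[c, d]) x * psi x)) => //.
  move=> x _; rewrite patchE; case: ifPn => //; rewrite notin_setE /= => /negP xcd.
  by rewrite psi0 ?mulr0.
exact: intR_mul_continuous.
Qed.

Lemma plateau_continuous n c d : continuous (@plateau R n c d).
Proof.
move=> x; apply/differentiable_continuous/derivable1_diffP.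
by have [] := diffn_plateau 1 n c d.
Qed.

Lemma plateau_supported n c d : a < c -> d < 1 -> supported (@plateau R n c d).
Proof.
move=> ac d1; exists c, d; split => // x; rewrite in_itv/= => xcd; apply: plateau_out.
by apply: contra xcd => /andP[/ltW -> /ltW ->].
Qed.

(** Dominated convergence. *)
Lemma cvg_Rint_plateau P c d : locally_integrable I P -> a < c -> c < d -> d < 1 ->
  \int[mu]_(x in I) (P x * plateau n c d x) @[n --> \oo] -->
  \int[mu]_(x in (`]c, d[%classic : set R)) P x.
Proof.
move=> locP ac cd d1.
have Pcd : intR `]c, d[%classic P.
  by apply: intRS (locally_intR locP ac d1) => //; exact: subset_itv_oo_cc.
have E n : \int[mu]_(x in I) (P x * plateau n c d x) =
    \int[mu]_(x in (`]c, d[%classic : set R)) (P x * plateau n c d x).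
  rewrite Rintegral_mkcond [RHS]Rintegral_mkcond; congr (Rintegral _ _ _).
  apply/funext => x; rewrite !patchE !mem_setE !in_itv/=.
  have [/andP[cx xd]|xcd] := boolP (c < x < d).
    by rewrite (lt_trans ac cx) (lt_trans xd d1).
  by rewrite plateau_out// mulr0; case: ifP.
under eq_fun do rewrite E.
apply: fine_cvg; rewrite EFin_Rintegral//.
apply: (@dominated_cvg _ TR R mu `]c, d[%classic _ _ _ (fun x => `|P x|%:E)) => //.
- move=> n; apply/measurable_EFinP; apply: measurable_funM; first exact: intR_measurable.
  by apply: measurable_funTS; apply: continuous_measurable_fun; exact: plateau_continuous.
- move=> x /=; rewrite in_itv/= => xcd; apply/cvg_EFin; first exact: nearW.
  have := @cvg_plateau R c d x; rewrite xcd => H.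
  by rewrite -[P x in X in _ --> X]mulr1; apply: cvgM => //; exact: cvg_cst.
- exact: intR_norm.
- move=> n x _; rewrite lee_fin normrM; have /andP[b0 b1] := plateau_itv n c d x.
  by rewrite (ger0_norm b0) ler_piMr.
Qed.

(** The primitive of [P - m], cut off near the endpoints because [P] is only
    locally integrable, vanishes. *)
Lemma ae_eq_of_averages P m : locally_integrable I P ->
  (forall c d, a < c -> c < d -> d < 1 ->
     \int[mu]_(x in (`]c, d[%classic : set R)) P x = m * (d - c)) ->
  {ae mu, forall t : TR, I t -> P t = m}.
Proof.
move=> locP Pm.
pose e k : R := (1 - a) / k.+3%:R.
have e0 k : 0 < e k by rewrite divr_gt0// subr_gt0.
have e1 k : a + e k < 1 - e k.
  have : 2 * e k < 1 - a.
    rewrite /e mulrA ltr_pdivrMr// mulrC ltr_pM2l ?subr_gt0// ltr_nat//.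
  by move: (e k) => x ?; lra.
pose Pk k x := if a + e k < x < 1 - e k then P x - m else 0.
have iPm k : intR `]a + e k, 1 - e k[%classic (fun x => P x - m).
  apply: intRB => //.
    apply: intRS (locally_intR (c := a + e k) (d := 1 - e k) locP _ _) => //.
    + exact: subset_itv_oo_cc.
    + by rewrite ltrDl.
    + by rewrite ltrBlDr ltrDl.
  apply: (intRS (E := I)) => //; last by apply: L2_integrable; exact: L2_cst.
  move=> x /=; rewrite !in_itv/= => /andP[h1 h2]; have := e0 k.
  by move: (e k) h1 h2 => y *; apply/andP; split; lra.
have PkE k : Pk k = (fun x => P x - m) \_ `]a + e k, 1 - e k[.
  by apply/funext => x; rewrite patchE mem_setE in_itv.
have iPk k : intR I (Pk k).
  rewrite PkE /intR -restrict_EFin.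
  apply/(@integrable_restrict _ TR R mu `]a + e k, 1 - e k[%classic (measurable_itv _) I
    (measurable_itv _) (EFin \o (fun x => P x - m))).
  by apply: intRS (iPm k) => //; exact: measurableI.
have Pk0 k x : a < x < 1 -> Prim a (Pk k) x = 0.
  move=> /andP[ax x1].
  pose d := Num.min x (1 - e k).
  have -> : Prim a (Pk k) x = \int[mu]_(t in (`]a + e k, d[%classic : set R)) (P t - m).
    rewrite /Prim -Rintegral_itv_bndo_bndc; last exact: intR_ext.
    rewrite Rintegral_mkcond [RHS]Rintegral_mkcond; congr (Rintegral _ _ _).
    apply/funext => t; rewrite !patchE !mem_setE !in_itv/= /d lt_min.
    have [ta|ta] := leP a t; rewrite /=; last first.
      case: ifP => // /andP[h _]; exfalso; have := e0 k; move: (e k) h => y *; lra.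
    have [tx|tx] := ltP t x; rewrite /= ?andbF//.
    rewrite /ext patchE mem_setE in_itv/= (lt_trans tx x1) andbT /Pk.
    case: ifPn => // ta'; case: ifP => // /andP[h _]; exfalso.
    by have := e0 k; move: ta'; rewrite -leNgt => ?; move: (e k) h => y *; lra.
  have [ed|de] := ltP (a + e k) d; last first.
    by rewrite set_itv_ge ?Rintegral_set0// bnd_simp -leNgt.
  have d1 : d < 1.
    by rewrite /d gt_min x1.
  rewrite RintB//.
  - rewrite Rint_cst ?(ltW ed)// Pm ?subrr//.
    by rewrite ltrDl.
  - apply: intRS (locally_intR (c := a + e k) (d := d) locP _ _) => //.
    + exact: subset_itv_oo_cc.
    + by rewrite ltrDl.
  - apply: (intRS (E := I)) => //; last by apply: L2_integrable; exact: L2_cst.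
    move=> t /=; rewrite !in_itv/= => /andP[h1 h2]; have := e0 k.
    by move: (e k) h1 => y *; apply/andP; split; lra.
have := ae_foralln (fun k => Prim_eq0 (iPk k) (Pk0 k)).
apply: filterS => t H It; have := It; rewrite /= in_itv/= => /andP[at_ t1].
pose k1 := Num.truncn ((1 - a) / (t - a)); pose k2 := Num.truncn ((1 - a) / (1 - t)).
pose k := maxn k1 k2.
have small (s : R) : 0 < s -> (1 - a) / s < k.+1%:R -> e k < s.
  move=> s0 h; rewrite /e ltr_pdivrMr// mulrC -ltr_pdivrMr//.
  by apply: lt_le_trans h _; rewrite ler_nat ltnS; apply: leqW; exact: leqnSn.
have h1 : e k < t - a.
  apply: small; first by rewrite subr_gt0.
  by apply: lt_le_trans (truncnS_gt _) _; rewrite ler_nat ltnS leq_maxl.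
have h2 : e k < 1 - t.
  apply: small; first by rewrite subr_gt0.
  by apply: lt_le_trans (truncnS_gt _) _; rewrite ler_nat ltnS leq_maxr.
have := H k It; rewrite /Pk.
have -> : a + e k < t < 1 - e k by apply/andP; split; lra.
by move=> /eqP; rewrite subr_eq0 => /eqP.
Qed.

Lemma locally_cst (m : R) : locally_integrable I (fun=> m).
Proof.
apply: open_integrable_locally; first exact: interval_open.
by apply: L2_integrable; exact: L2_cst.
Qed.

(** The primitive vanishes near [a] and, the integral being zero, near 1. *)
Lemma test_antiderivative psi : (forall n, diffn n psi) -> supported psi ->
  \int[mu]_(x in I) psi x = 0 ->
  exists2 phi, test_function a phi & derive1 phi = psi.
Proof.
move=> spsi [c [d [ac d1 psi0]]] int0.
have cpsi : continuous psi.
  move=> x; apply/differentiable_continuous/derivable1_diffP.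
  by have [] := spsi 1%N.
have ipsi b x : intR [set` Interval (BSide b a) (BRight x)] psi.
  have [ax|xa] := leP a x; last first.
    rewrite set_itv_ge; first exact: integrable_set0.
    by case: b; rewrite bnd_simp -?ltNge -?leNgt// ltW.
  apply: (intRS (E := `[a, x]%classic)) => //.
    by move=> y /=; rewrite !in_itv/= => /andP[h ->]; rewrite andbT; case: b h => // /ltW.
  apply: continuous_compact_integrable; first exact: segment_compact.
  exact: continuous_subspaceT.
pose phi x := \int[mu]_(t in `[a, x]) psi t.
have phi_left x : x < c -> phi x = 0.
  move=> xc; rewrite /phi; transitivity (\int[mu]_(t in `[a, x]) (cst 0 t : R)).
    apply: Rint_eq => t /=; rewrite in_itv/= => /andP[_ tx].
    by rewrite psi0// in_itv/= negb_and -ltNge (le_lt_trans tx xc).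
  by rewrite /Rintegral integral0.
have phi_right x : d < x -> phi x = 0.
  move=> dx; have [ax|xa] := ltP a x; last by rewrite phi_left// (le_lt_trans xa ac).
  rewrite /phi -int0 Rintegral_mkcond [RHS]Rintegral_mkcond; congr (Rintegral _ _ _).
  apply/funext => t; rewrite !patchE !mem_setE !in_itv/=.
  have [tcd|tcd] := boolP (t \in `[c, d]); last by rewrite psi0//; do 2 case: ifP.
  move: tcd; rewrite in_itv/= => /andP[ct td].
  by rewrite (ltW (lt_le_trans ac ct)) (lt_le_trans ac ct) (le_lt_trans td d1)
    (ltW (le_lt_trans td dx)).
have der (x : R) : is_derive x 1 phi (psi x).
  have [xc|cx] := ltP x c.
    have -> : psi x = 0 by apply: psi0; rewrite in_itv/= negb_and -ltNge xc.
    apply: (near_eq_is_derive _ (is_derive_cst (0 : R^o) (x : R^o) 1)).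
    have : \forall y \near x, y < c by exact: lt_nbhsl.
    by apply: filterS => y yc; rewrite phi_left.
  have xx1 : x < x + 1 by rewrite ltrDl.
  have ax : (a%:E < x%:E)%E by rewrite lte_fin (lt_le_trans ac cx).
  have [h1 h2] := @continuous_FTC1 R psi (BLeft a) x (x + 1) xx1 (ipsi true _) ax (cpsi x).
  by apply: DeriveDef => //; rewrite -derive1E.
have dphi : derive1 phi = psi.
  by apply/funext => x; rewrite derive1E; have [_ ->] := der x.
exists phi => //; split.
  apply: diffn_smooth => -[//|n]; split; last by rewrite dphi.
  by move=> x; have [] := der x.
exists c, d; split => // x; rewrite in_itv/= negb_and -!ltNge => /orP[xc|dx].
  exact: phi_left.
exact: phi_right.
Qed.

(** Testing against the antiderivative of a difference of two multiples of
    plateaus with the same integral compares the averages of [P] on two intervals: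
    they are all equal. *)
Lemma du_Bois_Reymond P : locally_integrable I P ->
  (forall phi, test_function a phi -> \int[mu]_(x in I) (P x * derive1 phi x) = 0) ->
  exists m, {ae mu, forall t : TR, I t -> P t = m}.
Proof.
move=> locP P0; have a1_ := a1.
pose c0 := a + (1 - a) / 3; pose d0 := 1 - (1 - a) / 3.
have ac0 : a < c0 by rewrite /c0; lra.
have cd0 : c0 < d0 by rewrite /c0 /d0; lra.
have d01 : d0 < 1 by rewrite /d0; lra.
pose m := \int[mu]_(x in (`]c0, d0[%classic : set R)) P x / (d0 - c0).
exists m; apply: ae_eq_of_averages => // c d ac cd d1.
pose A c d n := \int[mu]_(x in I) (1 * plateau n c d x).
pose B c d n := \int[mu]_(x in I) (P x * plateau n c d x).
have cvA c' d' : a < c' -> c' < d' -> d' < 1 -> A c' d' n @[n --> \oo] --> d' - c'.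
  move=> h1 h2 h3; have := cvg_Rint_plateau (locally_cst 1) h1 h2 h3.
  by rewrite Rint_cst ?mul1r// ltW.
have AB n : A c0 d0 n * B c d n = A c d n * B c0 d0 n.
  pose psi x := A c0 d0 n * plateau n c d x + (- A c d n) * plateau n c0 d0 x.
  have iA c' d' : a < c' -> d' < 1 -> intR I (fun x => 1 * plateau n c' d' x).
    move=> h1 h2; apply: intR_supported; [exact: locally_cst|exact: plateau_continuous|].
    exact: plateau_supported.
  have iB c' d' : a < c' -> d' < 1 -> intR I (fun x => P x * plateau n c' d' x).
    move=> h1 h2; apply: intR_supported; [by []|exact: plateau_continuous|].
    exact: plateau_supported.
  have smooth k : diffn k psi.
    apply: diffn_lin; first exact: diffn_plateau.
    have -> : (fun x => - A c d n * plateau n c0 d0 x) =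
        (fun x => - A c d n * plateau n c0 d0 x + (fun=> 0) x).
      by apply/funext => x; rewrite addr0.
    apply: diffn_lin; first exact: diffn_plateau.
    exact: diffn_cst.
  have supp : supported psi.
    exists (Num.min c c0), (Num.max d d0); split.
    - by rewrite lt_min ac.
    - by rewrite gt_max d1.
    - move=> x; rewrite in_itv/= negb_and -!ltNge lt_min gt_max => /orP[]/andP[h1 h2].
        by rewrite /psi !plateau_out ?mulr0 ?addr0// negb_and -!leNgt ?(ltW h1) ?(ltW h2).
      by rewrite /psi !plateau_out ?mulr0 ?addr0// negb_and -!leNgt ?(ltW h1) ?(ltW h2) orbT.
  have lin Q : locally_integrable I Q -> \int[mu]_(x in I) (Q x * psi x) =
      A c0 d0 n * \int[mu]_(x in I) (Q x * plateau n c d x) -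
      A c d n * \int[mu]_(x in I) (Q x * plateau n c0 d0 x).
    move=> locQ.
    have i1 : intR I (fun x => Q x * plateau n c d x).
      by apply: intR_supported => //; [exact: plateau_continuous|exact: plateau_supported].
    have i2 : intR I (fun x => Q x * plateau n c0 d0 x).
      by apply: intR_supported => //; [exact: plateau_continuous|exact: plateau_supported].
    rewrite -!RintZ// -RintB//; [|exact: intRZ..].
    by apply: Rint_eq => x _; rewrite /psi; ring.
  have psi_int : \int[mu]_(x in I) psi x = 0.
    transitivity (\int[mu]_(x in I) (1 * psi x)).
      by apply: Rint_eq => x _; rewrite mul1r.
    by rewrite lin; [rewrite -/(A c d n) -/(A c0 d0 n); ring|exact: locally_cst].
  have [phi tphi dphi] := test_antiderivative smooth supp psi_int.
  have := P0 _ tphi; rewrite dphi lin// => /eqP; rewrite subr_eq0 => /eqP.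
  exact.
have L1 : A c0 d0 n * B c d n @[n --> \oo] --> (d0 - c0) * \int[mu]_(x in (`]c, d[%classic : set R)) P x.
  by apply: cvgM; [exact: cvA|exact: cvg_Rint_plateau].
have L2 : A c d n * B c0 d0 n @[n --> \oo] --> (d - c) * \int[mu]_(x in (`]c0, d0[%classic : set R)) P x.
  by apply: cvgM; [exact: cvA|exact: cvg_Rint_plateau].
have EE : (fun n => A c0 d0 n * B c d n) = (fun n => A c d n * B c0 d0 n).
  by apply/funext => n; exact: AB.
rewrite EE in L1.
have E := cvg_unique (@Rhausdorff R) L1 L2.
have n0 : d0 - c0 != 0 by rewrite subr_eq0 gt_eqF.
apply: (mulfI n0); rewrite E /m; field.
exact: n0.
Qed.

Lemma plateau_test n c d : a < c -> d < 1 -> test_function a (@plateau R n c d).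
Proof.
move=> ac d1; split; last exact: plateau_supported.
by apply: diffn_smooth => k; exact: diffn_plateau.
Qed.

(** Subtracting the primitive leaves a function with zero weak derivative, which
    is constant by the du Bois-Reymond lemma. *)
Lemma weak_derivative_Prim_inv p g : weak_derivative a p g -> intR I g ->
  exists c, {ae mu, forall t : TR, I t -> p t = c + Prim a g t}.
Proof.
move=> [locp locg H] gi.
have iP : intR I (Prim a g).
  apply: (intR_bounded (M := \int[mu]_(t in I) `|g t|)) => //.
  - exact: measure_I_lty.
  - exact: measurable_Prim.
  - move=> x /=; rewrite in_itv/= => /andP[ax x1].
    by have := @PrimB_le_int R a g a x; rewrite Prim_a subr0 lexx; apply=> //; exact: ltW.
have locP : locally_integrable I (Prim a g).
  by apply: open_integrable_locally => //; exact: interval_open.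
have [|phi tphi|m mP] := @du_Bois_Reymond (fun x => p x - Prim a g x).
- exact: locally_integrableB.
- have cphi := test_derive_continuous tphi.
  have supp := test_derive_supported tphi.
  transitivity (\int[mu]_(x in I) (p x * derive1 phi x - Prim a g x * derive1 phi x)).
    by apply: Rint_eq => x _; ring.
  rewrite RintB//; [|exact: intR_supported..].
  rewrite H//; apply/eqP; rewrite subr_eq0; apply/eqP.
  by rewrite -Rint_Prim_test//; apply: Rint_eq => x _; rewrite mulrC.
- by exists m; apply: filterS mP => t Ht It; rewrite -(Ht It) subrK.
Qed.

(** The plateaus are test functions: integrals over subintervals agree. *)
Lemma weak_derivative_unique f g1 g2 : weak_derivative a f g1 -> weak_derivative a f g2 ->
  {ae mu, forall t : TR, I t -> g1 t = g2 t}.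
Proof.
move=> [_ loc1 H1] [_ loc2 H2].
have loc12 : locally_integrable I (fun x => g1 x - g2 x) by exact: locally_integrableB.
have := @ae_eq_of_averages (fun x => g1 x - g2 x) 0 loc12.
have Z c d : a < c -> c < d -> d < 1 ->
    \int[mu]_(x in (`]c, d[%classic : set R)) (g1 x - g2 x) = 0 * (d - c).
  move=> ac cd d1; have L1 := cvg_Rint_plateau loc12 ac cd d1.
  have E n : \int[mu]_(x in I) ((g1 x - g2 x) * plateau n c d x) = 0.
    have tb := plateau_test n ac d1.
    transitivity (\int[mu]_(x in I) (g1 x * plateau n c d x - g2 x * plateau n c d x)).
      by apply: Rint_eq => x _; ring.
    rewrite RintB//; last 2 first.
    - by apply: intR_supported => //; [exact: plateau_continuous|exact: plateau_supported].
    - by apply: intR_supported => //; [exact: plateau_continuous|exact: plateau_supported].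
    by apply/eqP; rewrite subr_eq0 -eqr_opp -H1// -H2//.
  have F0 : (fun n => \int[mu]_(x in I) ((g1 x - g2 x) * plateau n c d x)) = fun=> 0.
    by apply/funext => n; exact: E.
  rewrite F0 in L1; rewrite mul0r; apply: (cvg_unique (@Rhausdorff R) L1).
  exact: cvg_cst.
move=> /(_ Z); apply: filterS => t Ht It; have /eqP := Ht It.
by rewrite subr_eq0 => /eqP.
Qed.

End WeakDerivative.

(** * The graph of the operator *)

Section GraphA.
Variables (R : realType) (a : R).
Hypothesis a1 : a < 1.
Local Notation I := (`]a, 1[%classic : set R).
Local Notation TR := (measurableTypeR R).
Implicit Types (f g p : R -> R).

Lemma intR_lty (D : set R) f : measurable D -> intR D f -> (\int[mu]_(x in D) (f x)%:E < +oo)%E.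
Proof. by move=> mD fi; rewrite -EFin_Rintegral// ltry. Qed.

Lemma within_oc_left f : {within `]a, 1], continuous f} -> f x @[x --> 1^'-] --> f 1.
Proof.
move=> cf; pose m := (a + 1) / 2.
have a1_ := a1; have m1 : m < 1 by rewrite /m; lra.
have am : a < m by rewrite /m; lra.
have /(continuous_within_itvP _ m1)[] : {within `[m, 1], continuous f} => //.
apply: continuous_subspaceW cf => x /=; rewrite !in_itv/= => /andP[mx ->].
by rewrite (lt_le_trans am mx).
Qed.

Lemma within_oc_at f t : {within `]a, 1], continuous f} -> a < t < 1 -> {for t, continuous f}.
Proof.
move=> cf /andP[at_ t1]; pose m := (a + t) / 2.
have am : a < m by rewrite /m; lra.
have mt : m < t by rewrite /m; lra.
apply: (@within_continuous_continuous _ _ _ m 1); first exact: lt_trans t1.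
  apply: continuous_subspaceW cf => x /=; rewrite !in_itv/= => /andP[mx ->].
  by rewrite (lt_le_trans am mx).
by rewrite in_itv/= mt.
Qed.

Lemma Prim_left g : intR I g -> Prim a g x @[x --> 1^'-] --> Prim a g 1.
Proof. by move=> gi; have /(continuous_within_itvP _ a1)[] := Prim_continuous a1 gi. Qed.

Lemma dK_left g : intR I g -> dK a g x @[x --> 1^'-] --> dK a g 1.
Proof.
move=> gi; apply: cvgM; first exact: Prim_left.
apply: cvgV; first by rewrite gt_eqF// subr_gt0.
apply: cvgB; last exact: cvg_cst.
exact: cvg_at_left_filter.
Qed.

(** Near 1 the difference quotient is an average of [dK a v], whose limit at 1 is
    the total integral of [v] divided by the weight [1 - a]. *)
Lemma left_derivative_Kfun (v : L2space a) (w : R -> R) : w 1 = 0 ->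
  (forall x, a < x < 1 -> w x = Kfun a v x) ->
  left_derivative w 1 = (1 - a)^-1 * \int[mu]_(t in I) v t.
Proof.
move=> w1 wK; have iv := intR_val v; have iK := intR_dK a1 v.
have -> : (1 - a)^-1 * \int[mu]_(t in I) v t = dK a v 1.
  by rewrite /dK Prim_1 mulrC.
set D := dK a v 1.
apply/cvg_lim => //; apply/cvgrPdist_le => e e0.
have /cvgrPdist_le/(_ e e0) := dK_left iv; rewrite -/D.
rewrite near_withinE => /nbhs_ballP[r /= r0 rP].
near=> h.
have h0 : h < 0 by near: h; exact: nbhs_left_lt.
have hr : - h < r.
  by rewrite ltrNl; near: h; apply: nbhs_left_gt; rewrite oppr_lt0.
have ha : a < 1 + h.
  by rewrite -ltrBlDl; near: h; apply: nbhs_left_gt; rewrite subr_lt0.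
have x1 : 1 + h < 1 by rewrite gtrDl.
rewrite w1 subr0 wK ?ha ?x1//.
have -> : Kfun a v (1 + h) = - \int[mu]_(t in `]1 + h, 1[) ext a (dK a v) t.
  rewrite /Kfun -opprB PrimB//; last by rewrite !ltW.
  by rewrite Rintegral_itv_bndo_bndc//; exact: intR_ext.
have iD : intR `]1 + h, 1[%classic (fun=> D).
  by apply: L2_integrable; exact: L2_cst.
have E : \int[mu]_(t in (`]1 + h, 1[%classic : set R)) (ext a (dK a v) t - D) =
    \int[mu]_(t in `]1 + h, 1[) ext a (dK a v) t + D * h.
  rewrite RintB//; last exact: intR_ext.
  by rewrite Rint_cst ?ltW//; ring.
have B : `|\int[mu]_(t in (`]1 + h, 1[%classic : set R)) (ext a (dK a v) t - D)| <= e * - h.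
  have -> : e * - h = \int[mu]_(t in (`]1 + h, 1[%classic : set R)) e.
    by rewrite Rint_cst ?ltW//; ring.
  apply: Rint_le_norm => //.
  - by apply: measurable_funB => //; apply: measurable_funTS; exact: measurable_ext.
  - move=> t /=; rewrite in_itv/= => /andP[ht t1].
    rewrite extE ?t1 ?(lt_trans ha ht)// distrC; apply: rP => //=.
    by rewrite /ball/= ltr_norml; apply/andP; split; lra.
  - by apply: L2_integrable; exact: L2_cst.
have -> : D - h^-1 * (- \int[mu]_(t in `]1 + h, 1[) ext a (dK a v) t) =
    h^-1 * (\int[mu]_(t in (`]1 + h, 1[%classic : set R)) (ext a (dK a v) t - D)).
  by rewrite E; field; rewrite lt_eqF.
rewrite normrM normfV (ltr0_norm h0) ler_pdivrMl ?oppr_gt0//.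
by rewrite [leRHS]mulrC.
Unshelve. all: by end_near. Qed.

Lemma Kfun_within_oc (v : L2space a) : {within `]a, 1], continuous (Kfun a v)}.
Proof.
apply: (continuous_subspaceW _ (@Kfun_continuous R a a1 v)) => x /=.
by rewrite !in_itv/= => /andP[/ltW -> ->].
Qed.

Lemma inv_continuous t : a < t -> {for t, continuous (fun x : R => (x - a)^-1)}.
Proof.
move=> at_; apply: continuousV; first by rewrite gt_eqF// subr_gt0.
by apply: continuousB => //; exact: cvg_cst.
Qed.

(** Its primitive [ln (x - a)] diverges at [a]. *)
Lemma inv_not_integrable : ~ intR I (fun x => (x - a)^-1).
Proof.
move=> ii0; pose h := fun x : R => (x - a)^-1; have ii : intR I h := ii0.
pose M := \int[mu]_(t in I) `|h t|.
pose N := M + 1.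
have M0 : 0 <= M by exact: Rintegral_ge0.
have ea : 0 < 1 - a by rewrite subr_gt0.
pose x := a + (1 - a) * expR (- N).
have eN : expR (- N) < 1 by rewrite -expR0 ltr_expR /N; lra.
have dln t : a < t -> is_derive t 1 (fun t => ln (t - a)) (h t).
  move=> at_; have ta0 : 0 < t - a by rewrite subr_gt0.
  have H2 : is_derive t 1 (fun t => t - a) 1.
    by apply: is_derive_eq; rewrite subr0.
  have H3 := @is_derive1_comp _ (@ln R) (fun t => t - a) t _ _ (is_derive1_ln ta0) H2.
  by apply: is_derive_eq H3 _; rewrite mulr1.
have ax : a < x by rewrite ltrDl mulr_gt0// expR_gt0.
have x1 : x < 1 by have := ltr_pM2l ea (expR (- N)) 1; rewrite eN mulr1 /x; move=> H; rewrite -ltrBrDl H.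
have B : `|Prim a h 1 - Prim a h x| <= M.
  by apply: PrimB_le_int => //; rewrite (ltW ax) ltW.
have E : Prim a h 1 - Prim a h x = N.
  rewrite PrimB//; last by rewrite (ltW ax) ltW.
  have hc : {within `[x, 1], continuous h}.
    apply: continuous_in_subspaceT => t; rewrite inE/= in_itv/= => /andP[xt _].
    by apply: inv_continuous; exact: lt_le_trans xt.
  have ih : intR `[x, 1]%classic h.
    by apply: continuous_compact_integrable => //; exact: segment_compact.
  transitivity (\int[mu]_(t in `[x, 1]) h t).
    transitivity (\int[mu]_(t in (`]x, 1[%classic : set R)) h t).
      rewrite -Rintegral_itv_bndo_bndc; last exact: intR_ext.
      apply: Rint_eq => t /=; rewrite in_itv/= => /andP[xt t1].
      by rewrite extE// (lt_trans ax xt).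
    rewrite Rintegral_itv_bndo_bndc; last first.
      by apply: intRS ih => //; exact: subset_itv_oo_cc.
    rewrite Rintegral_itv_obnd_cbnd//.
    apply: intRS ih => // t /=; rewrite !in_itv/= => /andP[xt ->].
    by rewrite (ltW xt).
  rewrite /Rintegral (continuous_FTC2 x1 (F := fun t => ln (t - a)) hc).
  - rewrite -EFinB /= /x [a + _]addrC addrK lnM ?posrE ?expR_gt0//.
    by rewrite expRK; ring.
  - apply: derivable_LR => [|t /andP[xt _]]; first exact: ltW.
    by have [] := dln t (lt_le_trans ax xt).
  - move=> t; rewrite in_itv/= => /andP[xt _]; rewrite derive1E.
    by have [_ ->] := dln t (lt_trans ax xt).
by move: B; rewrite E /N ger0_norm; lra.
Qed.

Lemma weak_derivative_ae f g1 g2 : weak_derivative a f g1 -> locally_integrable I g2 ->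
  {ae mu, forall t : TR, I t -> g1 t = g2 t} -> weak_derivative a f g2.
Proof.
move=> [lf l1 H] l2 g12; split => // phi tphi; rewrite H//; congr (- _).
have [m1 _ _] := l1; have [m2 _ _] := l2.
have mphi : measurable_fun I phi.
  by apply: continuous_measurable_I; exact: (@test_continuous _ a).
apply: Rint_ae_eq => //; try exact: measurable_funM.
by apply: filterS g12 => t Ht It; rewrite Ht.
Qed.

Lemma L2_Prim (v : L2space a) : L2 a (Prim a v).
Proof.
apply: (L2_bounded (M := nrm (@L2ip R a) v * Num.sqrt (1 - a))).
  by apply: measurable_Prim => //; exact: intR_val.
move=> x /andP[ax x1].
have H : `|Prim a v x| <= nrm (@L2ip R a) v * Num.sqrt (x - a).
  by apply: Prim_le_sqrt => //; rewrite !ltW.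
apply: le_trans H _.
by rewrite ler_wpM2l ?nrm_ge0// ler_wsqrtr// lerB// ltW.
Qed.

(** The weighted derivative of [Kfun a g] is the primitive of [g]. *)
Lemma graph_A_of_Kfun f g (Lg : L2 a g) : L2 a f ->
  {ae mu, forall t : TR, I t -> f t = Kfun a g t} -> graph_A a f g.
Proof.
move=> Lf fK; pose v := toL2 Lg.
have iK : intR I (dK a g) := intR_dK a1 v.
have ig : intR I g by exact: L2_integrable.
have wf : weak_derivative a f (dK a g).
  apply: (weak_derivative_Prim a1 (c := - Prim a (dK a g) 1)) => //.
    exact: L2_integrable.
  by apply: filterS fK => t Ht It; rewrite Ht// /Kfun addrC.
have pE x : a < x < 1 -> (x - a) * dK a g x = Prim a g x.
  by move=> /andP[ax _]; rewrite /dK mulrC divfK// gt_eqF// subr_gt0.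
have Lp : L2 a (fun x => (x - a) * dK a g x).
  by apply: (L2_eq (f := Prim a g)) => [x xI|]; [rewrite pE|exact: (L2_Prim v)].
have wp : weak_derivative a (fun x => (x - a) * dK a g x) g.
  apply: (weak_derivative_Prim a1 (c := 0)) => //; first exact: L2_integrable.
  by apply: nearW => t It; rewrite add0r pE//; move: It; rewrite /= in_itv.
split => //; last by exists (dK a g).
split => //; exists (dK a g); split => //.
- apply: intR_lty => //.
  apply: (intR_eq (f := fun x => dK a v x * Prim a v x)) => //; last exact: intR_energy.
  by move=> x /=; rewrite in_itv/= => xI; rewrite -pE//=; ring.
- exists (Kfun a g); split => //; last exact: Kfun_1.
  exact: (@Kfun_within_oc v).
- by split => //; exists g.
Qed.

(** Integrating the equation once gives [(x - a) f' = c + Prim a g]. The finite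
    energy forces [c = 0], since [1 / (x - a)] is not integrable at [a]; integrating
    again, the constant is fixed by the boundary value 0 at 1. *)
Lemma Kfun_of_graph_A f g (Lg : L2 a g) : graph_A a f g ->
  {ae mu, forall t : TR, I t -> f t = Kfun a g t}.
Proof.
move=> [[Lf [fx' [wf' energy [f' [cf' ff' f'1]] _]]] _ [fx wf wp]].
pose v := toL2 Lg; have iK : intR I (dK a g) := intR_dK a1 v.
have ig : intR I g by exact: L2_integrable.
have [c cP] := weak_derivative_Prim_inv a1 wp ig.
have fxx := weak_derivative_unique a1 wf wf'.
have [_ lfx' _] := wf'; have [mfx' _ _] := lfx'.
have fxE : {ae mu, forall t : TR, I t -> fx' t = c / (t - a) + dK a g t}.
  apply: filterS2 cP fxx => t Ht1 Ht2 It.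
  have := It; rewrite /= in_itv/= => /andP[at_ _].
  have ta : t - a != 0 by rewrite subr_eq0 gt_eqF.
  apply: (mulfI ta); rewrite -Ht2// Ht1// /dK; field.
  exact: ta.
have c0 : c = 0.
  apply/eqP/negPn/negP => cN0; apply: inv_not_integrable.
  have ie : intR I (fun x => (x - a) * fx' x ^+ 2).
    apply/integrableP; split.
      apply/measurable_EFinP; apply: measurable_funM; last exact: measurable_funX.
      by apply: measurable_funB => //; exact: measurable_cst.
    apply: le_lt_trans energy; rewrite le_eqVlt; apply/orP; left; apply/eqP.
    apply: eq_integral => x; rewrite inE/= in_itv/= => /andP[ax _].
    by rewrite ger0_norm// mulr_ge0 ?sqr_ge0// subr_ge0 ltW.
  have mi : measurable_fun I (fun x : R => (x - a)^-1).
    apply: open_continuous_measurable_fun; first exact: interval_open.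
    move=> t; rewrite inE/= in_itv/= => /andP[at_ _].
    exact: inv_continuous.
  have iE : intR I (fun x => (x - a) * (c / (x - a) + dK a g x) ^+ 2).
    apply/integrableP; split.
      apply/measurable_EFinP; apply: measurable_funM.
        by apply: measurable_funB => //; exact: measurable_cst.
      apply: measurable_funX; apply: measurable_funD; last by apply: measurable_dK.
      by apply: measurable_funM => //; exact: measurable_cst.
    have /integrableP[_] := ie; apply: le_lt_trans.
    rewrite le_eqVlt; apply/orP; left; apply/eqP.
    apply: (@ae_eq_integral _ TR R mu I) => //.
    - apply: measurableT_comp => //; apply/measurable_EFinP; apply: measurable_funM.
        by apply: measurable_funB => //; exact: measurable_cst.
      apply: measurable_funX; apply: measurable_funD; last by apply: measurable_dK.
      by apply: measurable_funM => //; exact: measurable_cst.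
    - by apply: measurableT_comp => //; apply/measurable_EFinP; exact: (intR_measurable ie).
    - by apply: filterS fxE => t Ht It /=; rewrite Ht.
  have iG := intR_energy a1 v v.
  (* [c ^ 2 <= 2 (c + P) ^ 2 + 2 P ^ 2], divided by the weight. *)
  apply: (intR_le (g := fun x => 2 * (c ^+ 2)^-1 *
      ((x - a) * (c / (x - a) + dK a g x) ^+ 2 + dK a v x * Prim a v x))) => //; last first.
    by apply: intRZ => //; exact: intRD.
  move=> x /=; rewrite in_itv/= => xI; have /andP[ax _] := xI.
  have xa : 0 < x - a by rewrite subr_gt0.
  rewrite ger0_norm ?invr_ge0 ?(ltW xa)//.
  rewrite /dK /=; move: (x - a) xa (Prim a g x) => y y0 P.
  have c2 : 0 < c ^+ 2 by rewrite exprn_even_gt0.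
  have -> : 2 / c ^+ 2 * (y * (c / y + P / y) ^+ 2 + P / y * P) =
      y^-1 * (2 * ((c + P) ^+ 2 + P ^+ 2) / c ^+ 2).
    by field; rewrite cN0 gt_eqF.
  rewrite ler_peMr ?invr_ge0 ?(ltW y0)// ler_pdivlMr// mul1r.
  by have := sqr_ge0 (c + 2 * P); nra.
have fxE' : {ae mu, forall t : TR, I t -> fx' t = dK a g t}.
  by apply: filterS fxE => t Ht It; rewrite Ht// c0 mul0r add0r.
have lK : locally_integrable I (dK a g).
  by apply: open_integrable_locally => //; exact: interval_open.
have [c' c'P] := weak_derivative_Prim_inv a1 (weak_derivative_ae wf' lK fxE') iK.
have f'E t : a < t < 1 -> f' t = c' + Prim a (dK a g) t.
  move: t; apply: (ae_eq_continuous (f := f') (g := fun t => c' + Prim a (dK a g) t)).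
  - apply: filterS2 ff' c'P => s H1 H2 sI.
    have Is : I s by rewrite /= in_itv.
    by rewrite -H1// H2.
  - by move=> s sI; exact: within_oc_at.
  - move=> s sI; apply: continuousD; first exact: cvg_cst.
    exact: Prim_continuous_at.
have c'E : c' = - Prim a (dK a g) 1.
  have L1 := within_oc_left cf'; rewrite f'1 in L1.
  have L2 : (fun x => c' + Prim a (dK a g) x) x @[x --> 1^'-] --> c' + Prim a (dK a g) 1.
    by apply: cvgD; [exact: cvg_cst|exact: Prim_left].
  have : c' + Prim a (dK a g) 1 = 0.
    apply: (cvg_unique (@Rhausdorff R) L2).
    apply: cvg_trans L1; apply: near_eq_cvg.
    near=> x; rewrite f'E//; apply/andP; split.
      by near: x; exact: nbhs_left_gt.
    by near: x; exact: nbhs_left_lt.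
  by move/eqP; rewrite addr_eq0 => /eqP.
apply: filterS c'P => t Ht It; rewrite Ht// c'E /Kfun; ring.
Unshelve. all: by end_near. Qed.

End GraphA.

(** * Dilation to the unit interval *)

Section Scaling.
Variables (R : realType) (a : R).
Hypothesis a1 : a < 1.
Local Notation TR := (measurableTypeR R).
Local Notation I := (`]a, 1[%classic : set R).
Local Notation J := (`]0, 1[%classic : set R).

Definition dil (y : R) : R := a + (1 - a) * y.
Definition undil (x : R) : R := (x - a) / (1 - a).

Lemma dilK : cancel dil undil.
Proof. by move=> y; rewrite /dil /undil addrAC subrr add0r mulrC mulKf// subr_eq0 gt_eqF. Qed.

Lemma undilK : cancel undil dil.
Proof. by move=> y; rewrite /dil /undil mulrC divfK ?subr_eq0 ?gt_eqF// addrC subrK. Qed.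

Lemma dil_in y : (a < dil y < 1) = (0 < y < 1).
Proof.
have k0 : 0 < 1 - a by rewrite subr_gt0.
rewrite /dil ltrDl pmulr_rgt0//; congr andb.
by rewrite -ltrBrDl -{2}[1 - a]mulr1 ltr_pM2l.
Qed.

Lemma undil_in x : (0 < undil x < 1) = (a < x < 1).
Proof. by rewrite -dil_in undilK. Qed.

Lemma measurable_dil : measurable_fun [set: TR] (dil : TR -> TR).
Proof.
apply: measurable_funD; first exact: measurable_cst.
by apply: measurable_funM; [exact: measurable_cst|exact: measurable_id].
Qed.

Lemma measurable_undil : measurable_fun [set: TR] (undil : TR -> TR).
Proof.
apply: measurable_funM; last exact: measurable_cst.
by apply: measurable_funB; [exact: measurable_id|exact: measurable_cst].
Qed.

Let k0 : 0 <= 1 - a. Proof. by rewrite subr_ge0 ltW. Qed.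

(** Both measures agree on half-open intervals. *)
Lemma lebesgue_measure_dil (A : set TR) : measurable A ->
  mu A = pushforward (mscale (NngNum k0) mu) (dil : TR -> TR) A.
Proof.
move=> mA; have kp : 0 < 1 - a by rewrite subr_gt0.
apply: (@lebesgue_measure_unique R (pushforward (mscale (NngNum k0) mu) (dil : TR -> TR)) _ A mA).
  exact: measurable_dil.
move=> ? X [[c d] _ <-] /=.
have -> : pushforward (mscale (NngNum k0) mu) (dil : TR -> TR) `]c, d]%classic =
  ((1 - a)%:E * mu (`]undil c, undil d]%classic : set R))%E.
  rewrite /pushforward /mscale/=; congr (_ * mu _)%E.
  apply/seteqP; split => y /=; rewrite !in_itv/= /undil /dil ltr_pdivrMr// ler_pdivlMr//;
    by rewrite ltrBlDl lerBrDl [y * _]mulrC.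
rewrite !lebesgue_measure_itv/= !lte_fin /undil ltr_pM2r ?invr_gt0// ltrD2r.
case: ifP => _; last by rewrite mule0.
rewrite -!EFinB -EFinM; congr EFin; move: (@divff _ (1 - a)) => /(_ (lt0r_neq0 kp)).
by rewrite -mulrBl mulrCA => ->; rewrite mulr1; ring.
Qed.

Lemma preimage_dil : dil @^-1` I = J.
Proof.
by apply/seteqP; split => y /=; rewrite !in_itv/= dil_in.
Qed.

Lemma ge0_integral_dil (f : R -> \bar R) : measurable_fun (I : set TR) f ->
  (forall x, I x -> (0 <= f x)%E) ->
  (\int[mu]_(x in I) f x = (1 - a)%:E * \int[mu]_(y in J) f (dil y))%E.
Proof.
move=> mf f0.
have mI : measurable (I : set TR) by [].
have md := measurable_dil; rewrite (@eq_measure_integral _ TR R I (pushforward (mscale (NngNum k0) mu) (dil : TR -> TR)) mu); last first.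
  by move=> A mA _; exact: (@lebesgue_measure_dil A mA).
rewrite (@ge0_integral_pushforward _ _ TR TR R dil measurable_dil (mscale (NngNum k0) mu))//; last first.
  by move=> x; rewrite inE; exact: f0.
rewrite preimage_dil (@ge0_integral_mscale _ TR R mu J)//.
  apply: (measurable_comp (F := I)) => //.
    by rewrite -preimage_dil; exact: image_preimage_subset.
  by apply: measurable_funTS; exact: measurable_dil.
by move=> x Jx; apply: f0; rewrite -preimage_dil in Jx.
Qed.

Lemma measurable_dil_comp (f : R -> R) : measurable_fun I f -> measurable_fun J (f \o dil).
Proof.
move=> mf; apply: (measurable_comp (F := I)) => //.
  by rewrite -preimage_dil; exact: image_preimage_subset.
by apply: measurable_funTS; exact: measurable_dil.
Qed.

Lemma measurable_undil_comp (g : R -> R) : measurable_fun J g -> measurable_fun I (g \o undil).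
Proof.
move=> mg; apply: (measurable_comp (F := J)) => //.
  by move=> _ [x + <-] /=; rewrite !in_itv/= undil_in.
by apply: measurable_funTS; exact: measurable_undil.
Qed.

Lemma intR_dilP (f : R -> R) : measurable_fun I f -> intR J (f \o dil) <-> intR I f.
Proof.
move=> mf; have mJ := measurable_dil_comp mf.
have kp : 0 < 1 - a by rewrite subr_gt0.
have E : (\int[mu]_(x in I) `|(f x)%:E| = (1 - a)%:E * \int[mu]_(y in J) `|(f (dil y))%:E|)%E.
  apply: (ge0_integral_dil (f := fun x => `|(f x)%:E|%E)) => //.
  by apply: measurableT_comp => //; apply/measurable_EFinP.
split=> /integrableP[m H]; apply/integrableP; split; try exact/measurable_EFinP.
- by rewrite E lte_mul_pinfty// ?lee_fin// ltW.
- move: H; rewrite E; case: (X in (_ * X < _)%E -> _) => //=.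
  + by move=> r _; exact: ltry.
  + by rewrite gt0_muley.
Qed.

Lemma Rint_dil (f : R -> R) : intR I f ->
  \int[mu]_(x in I) f x = (1 - a) * \int[mu]_(y in J) f (dil y).
Proof.
have pos (h : R -> R) : (forall x, 0 <= h x) -> intR I h ->
    \int[mu]_(x in I) h x = (1 - a) * \int[mu]_(y in J) h (dil y).
  move=> h0 ih; have mh := intR_measurable ih.
  have iJ : intR J (h \o dil) by apply/intR_dilP.
  apply: EFin_inj; rewrite EFin_Rintegral// EFinM EFin_Rintegral//.
  apply: (ge0_integral_dil (f := fun x => (h x)%:E)) => //.
  + by apply/measurable_EFinP.
  + by move=> x _; rewrite lee_fin.
move=> fi; have mf := intR_measurable fi; have ai := intR_norm fi.
have fJ : intR J (f \o dil) by apply/intR_dilP.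
have aJ := intR_norm fJ.
have E1 := pos (fun x => `|f x|) (fun x => normr_ge0 _) ai.
have p2 x : 0 <= `|f x| + f x by rewrite -lerBlDr sub0r -normrN ler_norm.
have m2 : measurable I by [].
have E2 := pos (fun x => `|f x| + f x) p2 (intRD m2 ai fi).
rewrite RintD// in E2.
have E3 : \int[mu]_(y in J) (`|f (dil y)| + f (dil y)) =
   \int[mu]_(y in J) `|f (dil y)| + \int[mu]_(y in J) f (dil y) by exact: RintD.
rewrite E3 E1 mulrDr in E2.
apply: addrI; exact: E2.
Qed.

Lemma L2_dil (f : R -> R) : L2 a f -> L2 0 (f \o dil).
Proof.
move=> /L2P[mf if2]; apply/L2P; split; first exact: measurable_dil_comp.
by apply/(intR_dilP (f := fun x => f x ^+ 2)) => //; exact: measurable_funX.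
Qed.

Lemma L2_undil (g : R -> R) : L2 0 g -> L2 a (g \o undil).
Proof.
move=> /L2P[mg ig2]; have mG := measurable_undil_comp mg; apply/L2P; split => //.
apply/(intR_dilP (f := fun x => (g \o undil) x ^+ 2)); first exact: measurable_funX.
by apply: intR_eq ig2 => // x _ /=; rewrite dilK.
Qed.

Lemma L2norm_dil (f : R -> R) : L2 a f ->
  L2norm a f = Num.sqrt (1 - a) * L2norm 0 (f \o dil).
Proof.
move=> /L2P[mf if2]; rewrite /L2norm -sqrtrM//; congr Num.sqrt.
exact: (Rint_dil if2).
Qed.

Lemma Prim_dil (g : R -> R) y : intR J g -> 0 <= y <= 1 ->
  Prim a (g \o undil) (dil y) = (1 - a) * Prim 0 g y.
Proof.
move=> gi /andP[y0 y1]; have kp : 0 < 1 - a by rewrite subr_gt0.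
have mg := intR_measurable gi.
have iG : intR I (g \o undil).
  apply/intR_dilP; first exact: measurable_undil_comp.
  by apply: intR_eq gi => // x _ /=; rewrite dilK.
have d1 : a <= dil y <= 1 by rewrite /dil; apply/andP; split; nra.
rewrite -Rint_ind// -Rint_ind ?y0//; rewrite (Rint_dil (f := fun t => (g \o undil) t * ind (dil y) t)).
  congr (_ * _); apply: Rint_eq => t _ /=; rewrite dilK /ind /dil lerD2l.
  by rewrite ler_pM2l.
apply: (intR_le (g := fun t => `|(g \o undil) t|)) => //.
- apply: measurable_funM; first exact: measurable_undil_comp.
  exact: L2_measurable (ind_L2 _ _).
- by move=> t _; rewrite /ind; case: ifP; rewrite ?mulr1 ?mulr0 ?normr0.
- exact: intR_norm.
Qed.

Lemma PrimZ c (g : R -> R) b x : intR (`]b, 1[%classic : set R) g ->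
  Prim b (fun t => c * g t) x = c * Prim b g x.
Proof.
move=> gi; rewrite /Prim -RintZ//; last exact: intR_ext.
by apply: Rint_eq => t _; rewrite /ext !patchE; case: ifP; rewrite ?mulr0.
Qed.

(** The operator scales by the factor [(1 - a)^-1] under dilation. *)
Lemma Kfun_dil c (v : L2space 0) y : 0 <= y <= 1 ->
  Kfun a (fun x => c * v (undil x)) (dil y) = (1 - a) * c * Kfun 0 v y.
Proof.
move=> yI; have kp : 0 < 1 - a by rewrite subr_gt0.
have iv : intR J v := intR_val v.
have idK : intR J (dK 0 v) := intR_dK ltr01 v.
pose G x := c * v (undil x); pose D x := c * dK 0 v x.
have iD : intR J D by exact: intRZ.
have iG : intR J (fun x => c * v x) by exact: intRZ.
have E t : 0 < t < 1 -> dK a G (dil t) = D t.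
  move=> /andP[t0 t1]; rewrite /dK (Prim_dil (g := fun x => c * v x))//; last by rewrite !ltW.
  rewrite PrimZ// /D /dK /dil subr0 addrAC subrr add0r invfM.
  by rewrite mulrACA divff ?lt0r_neq0// mul1r mulrA.
have iDu : intR I (D \o undil).
  apply/intR_dilP; first by apply: measurable_undil_comp; exact: intR_measurable.
  by apply: intR_eq iD => // x _ /=; rewrite dilK.
have EI t : I t -> (D \o undil) t = dK a G t.
  by rewrite /= in_itv/= -undil_in => /E <-; rewrite undilK.
have iG' : intR I (dK a G) by apply: intR_eq iDu.
have EP x : Prim a (dK a G) x = Prim a (D \o undil) x.
  by apply: Prim_eq => //; apply: aeW => t /EI ->.
have d1 : dil 1 = 1 by rewrite /dil; ring.
have F (z : R) : 0 <= z <= 1 -> Prim a (dK a G) (dil z) = (1 - a) * (c * Prim 0 (dK 0 v) z).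
  by move=> zI; rewrite EP Prim_dil//; congr (_ * _); exact: PrimZ.
have F1 := F 1; rewrite d1 ler01 lexx in F1.
by rewrite /Kfun F// F1//; ring.
Qed.

Section Transport.
Variable S : R -> (R -> R) -> (R -> R).
Hypothesis SA : is_exp_A a S.
Local Notation V := (L2space (0 : R)).
Local Notation ip := (@L2ip R 0).
Local Notation nrm := (nrm (@L2ip R 0)).
Let ipP : semi_inner_product ip := L2ip_semi_inner 0.

(** The semigroup on ]a, 1[ read in the variable of ]0, 1[, with time measured in
    units of [1 - a]. The alternative does not occur for nonnegative times. *)
Definition rescaled (tau : R) (v : V) : V :=
  if pselect (L2 0 (S ((1 - a) * tau) (v \o undil) \o dil)) is left H then toL2 H else v.

Lemma rescaledE tau v : 0 <= tau ->
  rescaled tau v = S ((1 - a) * tau) (v \o undil) \o dil :> (R -> R).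
Proof.
move=> t0; rewrite /rescaled; case: pselect => //= nH; exfalso; apply: nH.
apply: L2_dil; apply: (sg_L2 SA.1); first by rewrite mulr_ge0.
by apply: L2_undil; exact: L2space_L2.
Qed.

Lemma nrm_dil (w : V) (F : R -> R) : L2 a F -> (forall y, 0 < y < 1 -> w y = F (dil y)) ->
  nrm w = (Num.sqrt (1 - a))^-1 * L2norm a F.
Proof.
move=> LF wF; rewrite L2norm_dil// mulKf; last by rewrite gt_eqF// sqrtr_gt0 subr_gt0.
rewrite nrm_L2norm /L2norm; congr Num.sqrt; apply: Rint_eq => y /=.
by rewrite in_itv/= => /wF ->.
Qed.

Lemma L2B (f g : R -> R) : L2 a f -> L2 a g -> L2 a (fun x => f x - g x).
Proof.
by move=> Lf Lg; apply: L2_eq (L2_lin (-1) Lg Lf) => x _; ring.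
Qed.

Lemma L2Z c (f : R -> R) : L2 a f -> L2 a (fun x => c * f x).
Proof.
by move=> Lf; apply: L2_eq (L2_lin c Lf (L2_cst a 0)) => x _; ring.
Qed.

Lemma null_eq_dil (w w' : V) (F G : R -> R) : L2 a F -> L2 a G ->
  (forall y, 0 < y < 1 -> w y = F (dil y)) ->
  (forall y, 0 < y < 1 -> w' y = G (dil y)) -> ae_eq1 a F G -> null_eq ip w w'.
Proof.
move=> LF LG wF wG FG; have LB := L2B LF LG; rewrite /null_eq (nrm_dil LB); last first.
  by move=> y yI /=; rewrite -wF// -wG.
have -> : L2norm a (fun x => F x - G x) = 0; last by rewrite mulr0.
rewrite /L2norm (_ : (\int[mu]_(x in I) (F x - G x) ^+ 2) = 0) ?sqrtr0//.
transitivity (\int[mu]_(x in I) (0 : R)); last by rewrite Rint_cst ?mul0r// ltW.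
apply: Rint_ae_eq => //.
  by apply: measurable_funX; exact: L2_measurable.
by apply: filterS FG => x FGx Ix; rewrite FGx// subrr expr0n.
Qed.

Lemma L2norm_small (F : R -> R -> R) :
  (L2norm a (F h) @[h --> 0^'+] --> (0 : R)) <->
  (forall e, 0 < e -> exists2 d, 0 < d & forall h, 0 < h < d -> L2norm a (F h) <= e).
Proof.
split=> [H e e0|H].
  move/cvgrPdist_le : H => /(_ e e0) [d /= d0 dP]; exists d => // h /andP[h0 hd].
  have := dP h; rewrite /= !sub0r !normrN gtr0_norm// => /(_ hd h0).
  by rewrite ger0_norm// sqrtr_ge0.
apply/cvgrPdist_le => e e0; have [d d0 dP] := H e e0.
exists d => //= h; rewrite /= sub0r normrN => hd h0.
by rewrite sub0r normrN ger0_norm ?sqrtr_ge0// dP// h0 (le_lt_trans (ler_norm _)).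
Qed.

Let kp : 0 < 1 - a. Proof. by rewrite subr_gt0. Qed.
Let sp : 0 < Num.sqrt (1 - a). Proof. by rewrite sqrtr_gt0. Qed.

Lemma undil_L2 (v : V) : L2 a (v \o undil).
Proof. by apply: L2_undil; exact: L2space_L2. Qed.

Lemma S_L2 tau (v : V) : 0 <= tau -> L2 a (S ((1 - a) * tau) (v \o undil)).
Proof. by move=> t0; apply: (sg_L2 SA.1); [rewrite mulr_ge0|exact: undil_L2]. Qed.

Lemma rescaled_difference h (f g : V) : 0 < h ->
  nrm (h^-1 *: (rescaled h f - f) - g) = Num.sqrt (1 - a) *
  L2norm a (fun x => ((1 - a) * h)^-1 * (S ((1 - a) * h) (f \o undil) x - f (undil x))
                     - (1 - a)^-1 * g (undil x)).
Proof.
move=> h0; have h0' := ltW h0.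
pose G x := (1 - a) * (((1 - a) * h)^-1 * (S ((1 - a) * h) (f \o undil) x - f (undil x))
                     - (1 - a)^-1 * g (undil x)).
have LG0 : L2 a (fun x => ((1 - a) * h)^-1 * (S ((1 - a) * h) (f \o undil) x - f (undil x))
                     - (1 - a)^-1 * g (undil x)).
  apply: L2B; last by apply: L2Z; exact: undil_L2.
  by apply: L2Z; apply: L2B; [exact: S_L2|exact: undil_L2].
have LG : L2 a G by exact: L2Z.
rewrite (nrm_dil (F := G))//; last first.
  move=> y yI /=; rewrite /GRing.scale /GRing.add /GRing.opp /=.
  rewrite rescaledE//= /G dilK invfM.
  by rewrite mulrBr mulrA mulrA divff ?gt_eqF// mul1r mulrA divff ?gt_eqF// mul1r.
rewrite {1}/L2norm.
have -> : \int[mu]_(x in I) G x ^+ 2 = (1 - a) ^+ 2 *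
  \int[mu]_(x in I) (((1 - a) * h)^-1 * (S ((1 - a) * h) (f \o undil) x - f (undil x))
                     - (1 - a)^-1 * g (undil x)) ^+ 2.
  rewrite -RintZ//; last by have /L2P[] := LG0.
  by apply: Rint_eq => x _; rewrite exprMn.
rewrite sqrtrM ?sqr_ge0// sqrtr_sqr gtr0_norm// mulrA; congr (_ * _).
by rewrite -{2}(sqr_sqrtr k0) expr2 mulKf// gt_eqF.
Qed.

Lemma rescaled_generator (f g : V) :
  (forall e, 0 < e -> exists2 d, 0 < d & forall h, 0 < h < d ->
      nrm (h^-1 *: (rescaled h f - f) - g) <= e) <->
  generator a S (f \o undil) (fun x => (1 - a)^-1 * g (undil x)).
Proof.
pose F h x := h^-1 * (S h (f \o undil) x - f (undil x)) - (1 - a)^-1 * g (undil x).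
have /= HF := L2norm_small F.
split=> [H|[_ _ /HF H] e e0].
- split; [exact: undil_L2|by apply: L2Z; exact: undil_L2|apply/HF => e e0].
  have [|d d0 dP] := H (Num.sqrt (1 - a) * e); first by rewrite mulr_gt0.
  exists ((1 - a) * d); first by rewrite mulr_gt0.
  move=> h /andP[h0 hd].
  have E : h = (1 - a) * (h / (1 - a)) by rewrite mulrC divfK// gt_eqF.
  have h0' : 0 < h / (1 - a) by rewrite divr_gt0.
  have := dP (h / (1 - a)); rewrite rescaled_difference// -E ler_pM2l//; apply.
  by rewrite h0' ltr_pdivrMr// mulrC.
- have [|d d0 dP] := H ((Num.sqrt (1 - a))^-1 * e); first by rewrite mulr_gt0// invr_gt0.
  exists (d / (1 - a)); first by rewrite divr_gt0.
  move=> h /andP[h0 hd]; rewrite rescaled_difference//.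
  rewrite -ler_pdivlMl//; apply: dP.
  by rewrite mulr_gt0//= mulrC -ltr_pdivlMr.
Qed.

(** Each property is transported by the dilation, which multiplies norms by
    [sqrt (1 - a)]; the generator picks up a factor [1 - a] from the change of time
    and its inverse from the change of variable. *)
Lemma rescaled_semigroup : semigroup_of ip (@KV R 0 ltr01) rescaled.
Proof.
split.
- move=> t t0 c f g; apply: (null_eq_dil (F := S ((1 - a) * t) ((c *: f + g : V) \o undil))
    (G := fun x => c * S ((1 - a) * t) (f \o undil) x + S ((1 - a) * t) (g \o undil) x)).
  + exact: S_L2.
  + by apply: L2_lin; exact: S_L2.
  + by move=> y _; rewrite rescaledE.
  + by move=> y _; rewrite /= /GRing.scale /GRing.add /= !rescaledE.
  + by apply: (sg_linear SA.1); [rewrite mulr_ge0|exact: undil_L2..].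
- move=> t t0; have [|M MP] := sg_bounded SA.1 (t := (1 - a) * t); first by rewrite mulr_ge0.
  exists M => f; rewrite (nrm_dil (F := S ((1 - a) * t) (f \o undil))); [|exact: S_L2|].
    rewrite (nrm_dil (w := f) (F := f \o undil)); [|exact: undil_L2|].
      by rewrite mulrCA ler_pM2l ?invr_gt0//; apply: MP; exact: undil_L2.
    by move=> y _ /=; rewrite dilK.
  by move=> y _; rewrite rescaledE.
- move=> f; apply: (null_eq_dil (F := S 0 (f \o undil)) (G := f \o undil)).
  + by have := S_L2 f (lexx 0); rewrite mulr0.
  + exact: undil_L2.
  + by move=> y _; rewrite rescaledE// mulr0.
  + by move=> y _ /=; rewrite dilK.
  + by apply: (sg_0 SA.1); exact: undil_L2.
- move=> s t f s0 t0.
  apply: (null_eq_dil (F := S ((1 - a) * s + (1 - a) * t) (f \o undil))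
     (G := S ((1 - a) * s) (S ((1 - a) * t) (f \o undil)))).
  + by rewrite -mulrDr; apply: S_L2; rewrite addr_ge0.
  + by apply: (sg_L2 SA.1); [rewrite mulr_ge0|exact: S_L2].
  + by move=> y _; rewrite rescaledE ?addr_ge0// mulrDr.
  + move=> y _; rewrite rescaledE//=; congr (S _ _ _).
    by apply/funext => x /=; rewrite rescaledE//= undilK.
  + by apply: (sg_add SA.1); [rewrite mulr_ge0..|exact: undil_L2].
- move=> f e e0; have /= HF := L2norm_small (fun h x => S h (f \o undil) x - f (undil x)).
  have /HF H := sg_continuous SA.1 (undil_L2 f).
  have [|d d0 dP] := H (Num.sqrt (1 - a) * e); first by rewrite mulr_gt0.
  exists (d / (1 - a)); first by rewrite divr_gt0.
  move=> h /andP[h0 hd]; have h0' := ltW h0.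
  rewrite (nrm_dil (F := fun x => S ((1 - a) * h) (f \o undil) x - f (undil x))).
  + rewrite ler_pdivrMl//; apply: dP.
    by rewrite mulr_gt0//= mulrC -ltr_pdivlMr.
  + by apply: L2B; [exact: S_L2|exact: undil_L2].
  + by move=> y _; rewrite /= /GRing.add /GRing.opp /= rescaledE//= dilK.
- move=> g; apply/rescaled_generator.
  have LG : L2 a (fun x => (1 - a)^-1 * g (undil x)) by apply: L2Z; exact: undil_L2.
  apply/SA.2; apply: (graph_A_of_Kfun a1 LG); first exact: undil_L2.
  apply: aeW => x; rewrite /= in_itv/= -undil_in => /andP[x0 x1].
  rewrite -{2}[x]undilK Kfun_dil ?divff ?gt_eqF ?mul1r//.
  by rewrite !ltW.
- move=> f g /rescaled_generator/SA.2 H.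
  have LG : L2 a (fun x => (1 - a)^-1 * g (undil x)) by apply: L2Z; exact: undil_L2.
  have FG := Kfun_of_graph_A a1 LG H.
  apply: (null_eq_dil (F := f \o undil) (G := Kfun 0 g \o undil)).
  + exact: undil_L2.
  + by apply: L2_undil; exact: Kfun_L2.
  + by move=> y _ /=; rewrite dilK.
  + by move=> y _ /=; rewrite dilK.
  + apply: filterS FG => x H' Ix; rewrite H'//.
    move: Ix; rewrite /= in_itv/= -undil_in => /andP[x0 x1].
    rewrite -{1}[x]undilK Kfun_dil ?divff ?gt_eqF ?mul1r//.
    by rewrite !ltW.
Qed.

End Transport.

End Scaling.

(** * The first eigenfunction and the spectral gap *)

Section Bessel.
Variable R : realType.
Implicit Types (x y z : R) (c : nat -> R).

Lemma cvg_pseries_fact c x : (forall k, `|c k| <= (k`!%:R)^-1) -> cvgn (pseries c x).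
Proof.
move=> cP; apply: normed_cvg.
apply: (series_le_cvg (v_ := exp_coeff `|x|)).
- by move=> n; exact: normr_ge0.
- by move=> n; exact: exp_coeff_ge0.
- move=> n; rewrite /= normrM normrX /exp_coeff/= mulrC ler_wpM2l ?exprn_ge0//.
- exact: is_cvg_series_exp_coeff.
Qed.

Definition bcoef (k : nat) : R := (-1) ^+ k / (k`!%:R ^+ 2).

(** Bessel's function in the variable [x = (z / 2)^2], in which it is an entire
    power series satisfying [(x E')' = - E]. *)
Definition besselE x := limn (pseries bcoef x).

(** The coefficients of [x * E' x], for the entire function [E] below whose
    derivative has the coefficients [pseries_diffs bcoef]. *)
Definition fcoef (k : nat) : R := if k is k'.+1 then pseries_diffs bcoef k' else 0.

Definition besselF x := limn (pseries fcoef x).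

Lemma besselJ0E z : besselJ0 z = besselE ((z / 2) ^+ 2).
Proof.
congr (limn _); congr series; apply/funext => k.
by rewrite /bcoef/= -exprM.
Qed.

Lemma fact_ge1 k : 1 <= (k`!%:R : R). Proof. by rewrite ler1n fact_gt0. Qed.

Lemma bcoef_diffs k : pseries_diffs bcoef k = - (bcoef k / k.+1%:R).
Proof.
rewrite /pseries_diffs /bcoef factS natrM exprS exprMn.
have k1 : k.+1%:R != 0 :> R by rewrite pnatr_eq0.
have kf : k`!%:R != 0 :> R by rewrite pnatr_eq0 -lt0n fact_gt0.
by move: k1 kf; move: (_ %:R) (_ %:R) => p q p0 q0; field; rewrite p0 q0.
Qed.

Lemma fcoef_diffs k : pseries_diffs fcoef k = - bcoef k.
Proof.
by rewrite {1}/pseries_diffs /fcoef bcoef_diffs mulrN mulrCA divff ?mulr1// pnatr_eq0.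
Qed.

(** A decay that makes the radius of convergence infinite and, unlike the bound by
    the coefficients of the exponential, is stable under derivation of the series. *)
Definition fast_decay c := forall k, `|c k| <= (k`!%:R ^+ 2)^-1.

Lemma fast_decay_le c k : fast_decay c -> `|c k| <= (k`!%:R)^-1.
Proof.
have f1 := fact_ge1 k; have f0 : 0 < (k`!%:R : R) by exact: lt_le_trans f1.
move=> /(_ k)/le_trans; apply; rewrite lef_pV2 ?posrE ?exprn_gt0//.
by rewrite expr2 ler_peMr// ltW.
Qed.

Lemma diffs_le c k : fast_decay c -> `|pseries_diffs c k| <= (k`!%:R * k.+1`!%:R)^-1.
Proof.
move=> cP; rewrite /pseries_diffs normrM normr_nat.
apply: (@le_trans _ _ (k.+1%:R * (k.+1`!%:R ^+ 2)^-1)); first by rewrite ler_wpM2l.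
have k1 : k.+1%:R != 0 :> R by rewrite pnatr_eq0.
have kf : k`!%:R != 0 :> R by rewrite pnatr_eq0 -lt0n fact_gt0.
rewrite factS natrM; move: k1 kf; move: (k.+1%:R : R) (k`!%:R : R) => p q p0 q0.
by rewrite le_eqVlt; apply/orP; left; apply/eqP; field; rewrite p0 q0.
Qed.

Lemma fast_decay_diffs c : fast_decay c -> fast_decay (pseries_diffs c).
Proof.
move=> cP k; apply: le_trans (diffs_le k cP) _.
have f0 : 0 < (k`!%:R : R) by rewrite ltr0n fact_gt0.
rewrite lef_pV2 ?posrE ?exprn_gt0 ?mulr_gt0 ?ltr0n ?fact_gt0//.
by rewrite expr2 ler_pM2l// ler_nat factS leq_pmull.
Qed.

Lemma bcoef_decay : fast_decay bcoef.
Proof.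
by move=> k; rewrite /bcoef normrM normrX normrN1 expr1n mul1r normfV ger0_norm.
Qed.

Lemma bcoef_le k : `|bcoef k| <= (k`!%:R)^-1.
Proof. exact: fast_decay_le bcoef_decay. Qed.

Lemma fcoef_le k : `|fcoef k| <= (k`!%:R)^-1.
Proof.
case: k => [|k]; first by rewrite /= normr0 invr_ge0.
apply: le_trans (diffs_le k bcoef_decay) _; rewrite invfM ler_piMl ?invr_ge0//.
by rewrite invf_le1 ?fact_ge1// ltr0n fact_gt0.
Qed.

Lemma is_derive_pseries c x : (forall k, `|c k| <= (k`!%:R)^-1) ->
  fast_decay (pseries_diffs c) ->
  is_derive x 1 (fun x => limn (pseries c x)) (limn (pseries (pseries_diffs c) x)).
Proof.
move=> c0 c1; apply: (@pseries_snd_diffs _ c (`|x| + 1)).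
- exact: cvg_pseries_fact.
- by apply: cvg_pseries_fact => k; exact: fast_decay_le.
- by apply: cvg_pseries_fact => k; apply: fast_decay_le; exact: fast_decay_diffs.
- by rewrite [X in _ < X]ger0_norm ?addr_ge0// ltrDl.
Qed.

Lemma is_derive_decay c x : fast_decay c ->
  is_derive x 1 (fun x => limn (pseries c x)) (limn (pseries (pseries_diffs c) x)).
Proof.
move=> cP; apply: is_derive_pseries; last exact: fast_decay_diffs.
by move=> k; exact: fast_decay_le.
Qed.

Lemma is_derive_besselE x :
  is_derive x (1 : R) besselE (limn (pseries (pseries_diffs bcoef) x)).
Proof. exact: is_derive_decay bcoef_decay. Qed.

Lemma diffs_fcoef : pseries_diffs fcoef = (fun k => - bcoef k).
Proof. by apply/funext => k; exact: fcoef_diffs. Qed.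

Lemma pseriesN c x : pseries (fun k => - c k) x = \- pseries c x.
Proof.
apply/funext => n; rewrite /pseries /series /= -sumrN.
by apply: eq_bigr => i _; rewrite mulNr.
Qed.

Lemma is_derive_besselF x : is_derive x (1 : R) besselF (- besselE x).
Proof.
have := @is_derive_pseries fcoef x fcoef_le.
rewrite diffs_fcoef pseriesN limN; last by apply: cvg_pseries_fact; exact: bcoef_le.
by apply=> k; rewrite normrN; exact: bcoef_decay.
Qed.

Lemma besselF_deriv x : besselF x = x * limn (pseries (pseries_diffs bcoef) x).
Proof.
have cb : cvgn (pseries (pseries_diffs bcoef) x).
  apply: cvg_pseries_fact => k; apply: fast_decay_le; exact: fast_decay_diffs bcoef_decay.
apply/cvg_lim => //; rewrite -(cvg_shiftS (pseries fcoef x)).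
have -> : [sequence pseries fcoef x n.+1]_n = (fun n => x * pseries (pseries_diffs bcoef) x n).
  apply/funext => n; rewrite /pseries /series /= big_nat_recl//= mul0r add0r mulr_sumr.
  by apply: eq_bigr => i _; rewrite exprS mulrCA.
by apply: cvgM => //; exact: cvg_cst.
Qed.

Lemma pseries0 c : limn (pseries c 0) = c 0%N.
Proof.
apply/cvg_lim => //; rewrite -(cvg_shiftS (pseries c 0)).
have -> : [sequence pseries c 0 n.+1]_n = (fun=> c 0%N).
  apply/funext => n; rewrite /pseries /series /= big_nat_recl//= expr0 mulr1.
  by rewrite big1 ?addr0// => i _; rewrite exprS mul0r mulr0.
exact: cvg_cst.
Qed.

Lemma besselE0 : besselE 0 = 1.
Proof. by rewrite /besselE pseries0 /bcoef expr0 fact0 expr1n divr1. Qed.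

Lemma besselF0 : besselF 0 = 0. Proof. exact: pseries0. Qed.

Lemma besselE_continuous : continuous besselE.
Proof.
move=> x; apply/differentiable_continuous/derivable1_diffP.
by have [] := is_derive_besselE x.
Qed.

(** The terms of order 0 to 3 add up to [- 2 / 9], the absolute values of the
    following ones to at most [1 / 18], since they start with [1 / 36] and decrease
    at least by halves. *)
Lemma besselE2_lt0 : besselE 2 < 0.
Proof.
have H n : `|bcoef (n + 4)%N * 2 ^+ (n + 4)%N| <= 36^-1 * 2^-1 ^+ n /\
    pseries bcoef 2 (n + 4)%N <= - (2 / 9) + 18^-1 * (1 - 2^-1 ^+ n).
  elim: n => [|n [IH1 IH2]].
    rewrite add0n /pseries /series /= !big_nat_recr//= big_geq// /bcoef !factS fact0.
    split; last by rewrite !expr0 !exprS !expr0; lra.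
    by rewrite ger0_norm !exprS !expr0; lra.
  rewrite addSn; split.
    have -> : bcoef (n + 4)%N.+1 * 2 ^+ (n + 4)%N.+1 =
      - (2 / (n + 4)%N.+1%:R ^+ 2) * (bcoef (n + 4)%N * 2 ^+ (n + 4)%N).
      rewrite /bcoef factS natrM !exprS.
      have k1 : (n + 4)%N.+1%:R != 0 :> R by rewrite pnatr_eq0.
      have kf : (n + 4)%N`!%:R != 0 :> R by rewrite pnatr_eq0 -lt0n fact_gt0.
      move: k1 kf; move: ((n + 4)%N.+1%:R : R) ((n + 4)%N`!%:R : R) => p q p0 q0.
      by field; rewrite p0 q0.
    rewrite normrM (exprS 2^-1) [leRHS]mulrCA ler_pM// normrN ger0_norm ?divr_ge0 ?sqr_ge0//.
    have k4 : 4 <= (n + 4)%N.+1%:R :> R by rewrite ler_nat -addSn leq_addl.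
    by rewrite ler_pdivrMr; [nra|rewrite exprn_gt0//; lra].
  have E : pseries bcoef 2 (n + 4).+1 = pseries bcoef 2 (n + 4)%N + bcoef (n + 4)%N * 2 ^+ (n + 4)%N.
    by rewrite /pseries /series /= big_nat_recr.
  have := le_trans (ler_norm _) IH1; rewrite E (exprS 2^-1); move: IH2.
  by move: (pseries _ _ _) (bcoef _ * _) (2^-1 ^+ n) => u v w; lra.
apply: (@le_lt_trans _ _ (- (2 / 9) + 18^-1)); last by lra.
apply: limr_le; first by apply: cvg_pseries_fact; exact: bcoef_le.
exists 4%N => //= n /= n4; rewrite -(subnK n4).
apply: le_trans (H _).2 _.
have : 0 <= (2^-1 : R) ^+ (n - 4) by rewrite exprn_ge0.
by move: (_ ^+ _) => u; lra.
Qed.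

Section FirstZero.
Variable j1 : R.
Hypothesis hj1 : smallest_positive_zero (@besselJ0 R) j1.

(** The first eigenvalue, in absolute value. *)
Definition eigen : R := (j1 / 2) ^+ 2.

Lemma eigen_gt0 : 0 < eigen.
Proof. by have [j0 _ _] := hj1; rewrite exprn_gt0// divr_gt0. Qed.

Lemma besselE_eigen : besselE eigen = 0.
Proof. by have [_ J0 _] := hj1; rewrite -besselJ0E. Qed.

(** By the intermediate value theorem, [besselE] has a zero before [y], which is
    [(z / 2)^2] for a zero [z] of the Bessel function. *)
Lemma besselE_le0 y : 0 <= y -> besselE y <= 0 -> eigen <= y.
Proof.
have [j0 _ jmin] := hj1; move=> y0 Ey.
have cE : {within `[0, y], continuous besselE}.
  by apply: continuous_subspaceT; exact: besselE_continuous.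
have [] := @IVT R besselE 0 y 0 y0 cE.
  by rewrite besselE0 ge_min Ey orbT le_max ler01.
move=> z; rewrite in_itv/= => /andP[z0 zy] Ez.
have zp : 0 < z.
  rewrite lt_neqAle z0 andbT; apply/eqP => z0'; move: Ez; rewrite -z0' besselE0 => /eqP.
  by rewrite oner_eq0.
have H : (2 * Num.sqrt z / 2) ^+ 2 = z by rewrite mulrAC mulfV// mul1r sqr_sqrtr.
apply: le_trans zy; rewrite /eigen -[leRHS]H; apply: sqr_le; first by rewrite divr_ge0// ltW.
rewrite ler_pM2r ?invr_gt0//; apply: jmin; first by rewrite mulr_gt0// sqrtr_gt0.
by rewrite besselJ0E H.
Qed.

Lemma eigen_lt2 : eigen < 2.
Proof.
have E2 := besselE2_lt0.
rewrite lt_neqAle besselE_le0// ?andbT; last exact: ltW.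
by apply/eqP => E; rewrite -E besselE_eigen ltxx in E2.
Qed.

Lemma besselE_gt0 y : 0 <= y < eigen -> 0 < besselE y.
Proof.
move=> /andP[y0 ym]; rewrite ltNge; apply/negP => /(besselE_le0 y0).
by rewrite leNgt ym.
Qed.

Local Notation J := (`]0, 1[%classic : set R).
Local Notation TR := (measurableTypeR R).
Local Notation V := (L2space (0 : R)).
Local Notation ip := (@L2ip R 0).
Local Notation nrm := (nrm (@L2ip R 0)).
Let ipP : semi_inner_product ip := L2ip_semi_inner 0.
Local Notation K := (KV (@ltr01 R)).
Let m0 := eigen_gt0.

(** The first eigenfunction, [J0 (j1 sqrt y)]. *)
Definition phi y := besselE (eigen * y).

Lemma is_derive_phi y :
  is_derive y (1 : R) phi (eigen * limn (pseries (pseries_diffs bcoef) (eigen * y))).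
Proof.
have /= dE := is_derive_besselE (eigen * y).
have dm : is_derive y (1 : R) (fun y : R => eigen * y) eigen.
  by apply: is_derive_eq; rewrite /GRing.scale/= ?mulr0 ?mulr1 ?addr0 ?add0r.
rewrite mulrC; exact: (@is_derive1_comp R besselE (fun y => eigen * y) y _ _ dE dm).
Qed.

Lemma is_derive_flux y :
  is_derive y (1 : R) (fun y => - eigen^-1 * besselF (eigen * y)) (phi y).
Proof.
have /= dE := is_derive_besselF (eigen * y).
have dm : is_derive y (1 : R) (fun y : R => eigen * y) eigen.
  by apply: is_derive_eq; rewrite /GRing.scale/= ?mulr0 ?mulr1 ?addr0 ?add0r.
have d2 := @is_derive1_comp R besselF (fun y => eigen * y) y _ _ dE dm.
have := @is_deriveZ R R^o R^o (besselF \o (fun y => eigen * y)) (- eigen^-1) y 1 _ d2.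
have -> : - eigen^-1 *: (- besselE (eigen * y) * eigen) = phi y => //.
by rewrite /GRing.scale/= !mulNr mulrN opprK mulrC mulfK// gt_eqF.
Qed.

Lemma phi_continuous : continuous phi.
Proof.
move=> y; apply/differentiable_continuous/derivable1_diffP.
by have [] := is_derive_phi y.
Qed.

Lemma continuous_bounded01 (f : R -> R) : {within `[0, 1], continuous f} ->
  exists M, forall x, 0 <= x <= 1 -> `|f x| <= M.
Proof.
move=> cf; have /compact_bounded[M [_ MP]] := continuous_compact cf (@segment_compact R 0 1).
exists (M + 1) => x xI; apply: (MP (M + 1)); first by rewrite ltrDl.
by exists x => //; rewrite /= in_itv.
Qed.

Lemma L2_continuous (f : R -> R) : {within `[0, 1], continuous f} -> L2 0 f.
Proof.
move=> cf; have [M MP] := continuous_bounded01 cf.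
apply: (L2_bounded (M := M)).
  apply: (@measurable_funS _ _ _ _ (`[0%R, 1%R]%classic : set R)) => //.
    exact: subset_itv_oo_cc.
  exact: subspace_continuous_measurable_fun.
by move=> x /andP[x0 x1]; apply: MP; rewrite !ltW.
Qed.

Lemma Prim_FTC (F f : R -> R) : continuous f -> (forall x, is_derive x (1 : R) F (f x)) ->
  forall x, 0 <= x <= 1 -> Prim 0 f x = F x - F 0.
Proof.
move=> cf dF x /andP[x0 x1].
have [->|xp] := eqVneq x 0; first by rewrite Prim_a subrr.
have {}xp : 0 < x by rewrite lt_neqAle eq_sym xp.
have iL : intR J f by apply: L2_integrable; apply: L2_continuous; exact: continuous_subspaceT.
have ic : intR `[0, x] f.
  by apply: continuous_compact_integrable; [exact: segment_compact|exact: continuous_subspaceT].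
have -> : Prim 0 f x = \int[mu]_(t in `[0, x]) f t.
  rewrite /Prim -Rintegral_itv_obnd_cbnd; last exact: intR_ext.
  rewrite -Rintegral_itv_bndo_bndc; last exact: intR_ext.
  rewrite -[RHS]Rintegral_itv_obnd_cbnd; last first.
    by apply: intRS ic => //; exact: subset_itv_oc_cc.
  rewrite -[RHS]Rintegral_itv_bndo_bndc; last first.
    by apply: intRS ic => //; exact: subset_itv_oo_cc.
  by apply: Rint_eq => t /=; rewrite in_itv/= => /andP[t0 tx]; rewrite extE// t0 (lt_le_trans tx).
rewrite /Rintegral (@continuous_FTC2 R f F 0 x)//.
- exact: continuous_subspaceT.
- by apply: derivable_LR; [exact: ltW|move=> t _; have [] := dF t].
- by move=> t _; rewrite derive1E; have [_ ->] := dF t.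
Qed.

Definition phiV : V := toL2 (L2_continuous (continuous_subspaceT phi_continuous)).

Lemma Prim_phi y : 0 <= y <= 1 -> Prim 0 phi y = - eigen^-1 * besselF (eigen * y).
Proof.
move=> yI; rewrite (Prim_FTC phi_continuous is_derive_flux)//.
by rewrite mulr0 besselF0 mulr0 subr0.
Qed.

Lemma dphi_continuous :
  continuous (fun y => eigen * limn (pseries (pseries_diffs bcoef) (eigen * y))).
Proof.
move=> y; have cP : {for eigen * y, continuous (fun x => limn (pseries (pseries_diffs bcoef) x))}.
  apply/differentiable_continuous/derivable1_diffP.
  by have [] // := is_derive_decay (eigen * y) (fast_decay_diffs bcoef_decay).
apply: (@continuousM R _ (fun=> eigen)
  (fun y => limn (pseries (pseries_diffs bcoef) (eigen * y)))); first exact: cst_continuous.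
by apply: (@continuous_comp _ _ _ (fun y => eigen * y) _ y) cP; exact: mulrl_continuous.
Qed.

(** Two integrations of [(x E')' = - E], rescaled by [eigen]. *)
Lemma Kfun_phi y : 0 <= y <= 1 -> Kfun 0 phi y = - eigen^-1 * phi y.
Proof.
pose psi y := eigen * limn (pseries (pseries_diffs bcoef) (eigen * y)).
have E t : 0 < t < 1 -> dK 0 phi t = - eigen^-1 * psi t.
  move=> /andP[t0 t1]; rewrite /dK Prim_phi ?ltW// ?(ltW t0) ?ltW//.
  rewrite besselF_deriv subr0 /psi; have m_ := lt0r_neq0 m0.
  by move: (limn _) => l; field; rewrite m_ gt_eqF.
have ipsi : intR J psi.
  by apply: L2_integrable; apply: L2_continuous; apply: continuous_subspaceT; exact: dphi_continuous.
have EP z : 0 <= z <= 1 -> Prim 0 (dK 0 phi) z = - eigen^-1 * (phi z - phi 0).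
  move=> zI; rewrite -(Prim_FTC dphi_continuous is_derive_phi)// -PrimZ//.
  apply: Prim_eq.
  - by apply: aeW => t; rewrite /= in_itv/=; exact: E.
  - exact: (intR_dK (@ltr01 R) phiV).
  - exact: intRZ.
move=> yI; rewrite /Kfun !EP ?ler01 ?lexx//.
have -> : phi 1 = 0 by rewrite /phi mulr1 besselE_eigen.
ring.
Qed.

Lemma L2space_eq_null (f g : V) : (forall y, 0 < y < 1 -> f y = g y) -> null_eq ip f g.
Proof.
move=> fg; apply: null_eq_ip => // h; apply: Rint_eq => y /=.
by rewrite in_itv/= => /fg ->.
Qed.

Lemma KV_phi : null_eq ip (K phiV) (- eigen^-1 *: phiV).
Proof.
apply: L2space_eq_null => y /andP[y0 y1].
by rewrite /= Kfun_phi// ?ltW// (ltW y0) ltW.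
Qed.

Lemma phi_gt0 y : 0 <= y < 1 -> 0 < phi y.
Proof.
move=> /andP[y0 y1]; apply: besselE_gt0.
by rewrite mulr_ge0 ?(ltW m0)//= -{2}[eigen]mulr1 ltr_pM2l.
Qed.

Definition oneV : V := toL2 (L2_cst 0 1).

Lemma ip_one_phi : 0 < ip oneV phiV.
Proof.
have p0 t : J t -> 0 < phi t.
  by rewrite /= in_itv/= => /andP[t0 t1]; rewrite phi_gt0// (ltW t0).
have iphi : intR J phi := intR_val phiV.
have E : ip oneV phiV = \int[mu]_(t in J) phi t by apply: Rint_eq => t _; rewrite /= mul1r.
rewrite E lt_neqAle eq_sym Rintegral_ge0 ?andbT; last by move=> t /p0/ltW.
apply/eqP => I0.
have ae0 := Rint0_ae (measurable_I 0) (intR_measurable iphi) (fun t Jt => ltW (p0 t Jt)) iphi I0.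
have aez : {ae mu, forall t : TR, 0 < t < 1 -> phi t = 0}.
  by apply: filterS ae0 => t H tI; apply: H; rewrite /= in_itv.
(* A null integral of the positive [phi] would make it vanish at 1 / 2. *)
have Z : phi 2^-1 = 0.
  apply: (ae_eq_continuous (c := 0) (d := 1) (f := phi) (g := fun=> 0) aez).
  - by move=> t _; exact: phi_continuous.
  - by move=> t _; exact: cst_continuous.
  - by rewrite invr_gt0 ltr0n/= invf_lt1// ltr1n.
have := p0 2^-1; rewrite Z ltxx /= in_itv/= => H; suff : false by [].
by apply: H; rewrite invr_gt0 ltr0n/= invf_lt1// ltr1n.
Qed.

Lemma nrm_phi_gt0 : 0 < nrm phiV.
Proof.
rewrite lt_neqAle nrm_ge0 andbT; apply/eqP => N0.
have := ip_le_nrm ipP oneV phiV; rewrite -N0 mulr0 => H.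
have := le_trans (ler_norm _) H; rewrite leNgt; move/negP; apply.
exact: ip_one_phi.
Qed.

Let KP := KV_negative_inverse (@ltr01 R).

(** Bessel's inequality for two orthogonal vectors, cleared of denominators so that
    they may be null. *)
Lemma bessel_two (e f g : V) : ip f g = 0 ->
  nrm g ^+ 2 * ip e f ^+ 2 + nrm f ^+ 2 * ip e g ^+ 2 <=
  nrm f ^+ 2 * nrm g ^+ 2 * nrm e ^+ 2.
Proof.
move=> fg; have fE := sqr_ip_le ipP e f; have gE := sqr_ip_le ipP e g.
have := ip_ge0 ipP ((ip f f * ip g g) *: e - (ip g g * ip e f) *: f - (ip f f * ip e g) *: g).
rewrite !(ipE ipP) !(ipC ipP f e) !(ipC ipP g e) (ipC ipP g f) fg !(sqr_nrm ipP).
have := ip_ge0 ipP f; have := ip_ge0 ipP g; have := ip_ge0 ipP e; move: fE gE.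
move: (ip f f) (ip g g) (ip e e) (ip e f) (ip e g) => N M E p r pE rE E0 M0 N0 H.
have sqr0 (x : R) : x ^+ 2 <= 0 -> x ^+ 2 = 0.
  by move=> x0; apply/eqP; rewrite eq_le x0 sqr_ge0.
have [Nz|Nz] := eqVneq N 0.
  by move: pE; rewrite Nz mulr0 => /sqr0 ->; rewrite !mul0r mulr0 addr0.
have [Mz|Mz] := eqVneq M 0.
  by move: rE; rewrite Mz mulr0 => /sqr0 ->; rewrite !(mulr0, mul0r) addr0.
have NM : 0 < N * M by rewrite mulr_gt0// lt_neqAle eq_sym ?Nz ?Mz.
by rewrite -(ler_pM2l NM); lra.
Qed.

Lemma energyE (f : V) : - ip f (K f) = \int[mu]_(x in J) (dK 0 f x * Prim 0 f x).
Proof. by rewrite (ipC ipP f) (ip_KV (@ltr01 R) f f) opprK. Qed.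

(** Bessel's inequality for the indicators of [0, x], divided by [x] and
    integrated over ]0, 1[: orthogonal vectors share the trace of [- K], which is 1. *)
Lemma energy_orthogonal (f g : V) : ip f g = 0 ->
  nrm g ^+ 2 * - ip f (K f) + nrm f ^+ 2 * - ip g (K g) <= nrm f ^+ 2 * nrm g ^+ 2.
Proof.
move=> fg; set N := nrm f ^+ 2; set M := nrm g ^+ 2.
have N0 : 0 <= N by exact: sqr_ge0. have M0 : 0 <= M by exact: sqr_ge0.
have point x : J x -> M * (dK 0 f x * Prim 0 f x) + N * (dK 0 g x * Prim 0 g x) <= N * M.
  rewrite /= in_itv/= => /andP[x0 x1].
  have xI : 0 <= x <= 1 by rewrite !ltW.
  have F := ip_ind f xI; have G := ip_ind g xI; have X := sqr_nrm_ind xI.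
  have := bessel_two (indV 0 x) fg; rewrite !(ipC ipP (indV 0 x)) F G X subr0 -/M -/N => H.
  rewrite /dK subr0 -(ler_pM2r x0); apply: le_trans H.
  rewrite le_eqVlt; apply/orP; left; apply/eqP.
  have x_ : x != 0 by rewrite gt_eqF.
  by move: (Prim 0 f x) (Prim 0 g x) => p q; field.
have iE (h : V) : intR J (fun x => dK 0 h x * Prim 0 h x) by exact: intR_energy.
have H : M * \int[mu]_(x in J) (dK 0 f x * Prim 0 f x) +
    N * \int[mu]_(x in J) (dK 0 g x * Prim 0 g x) <= N * M.
  rewrite -!RintZ// -RintD//; try exact: intRZ.
  apply: (@le_trans _ _ (\int[mu]_(x in J) (N * M))).
    apply: Rint_le => //; first by apply: intRD => //; exact: intRZ.
    by apply: L2_integrable; exact: L2_cst.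
  by rewrite Rint_cst// subr0 mulr1.
by rewrite -(energyE f) -(energyE g) in H.
Qed.

Lemma energy_le_half f : ip f phiV = 0 -> - ip f (K f) <= 2^-1 * nrm f ^+ 2.
Proof.
move=> fphi; have phif : ip phiV f = 0 by rewrite (ipC ipP).
have := energy_orthogonal phif; rewrite (ip_null_eqr ipP KV_phi) (ipZr ipP) -(sqr_nrm ipP).
have m2 := eigen_lt2; have p0 : 0 < nrm phiV ^+ 2 by rewrite exprn_gt0// nrm_phi_gt0.
have mi : 2^-1 < eigen^-1 by rewrite ltf_pV2 ?posrE.
move: (sqr_ge0 (nrm f)) p0 mi; move: (nrm f ^+ 2) (nrm phiV ^+ 2) (eigen^-1) (ip f (K f)).
move=> A B e k A0 B0 eh H.
have H' : e * A - k <= A by rewrite -(ler_pM2l B0); lra.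
have eh' : 0 <= e - 2^-1 by rewrite subr_ge0 ltW.
have := mulr_ge0 eh' A0; lra.
Qed.

(** The form [- ip x (K y)] is positive, and Cauchy-Schwarz for [g] and [K g] turns
    the bound on the form at [K g] into one at [g]. *)
Lemma spectral_gap g : ip g phiV = 0 -> ip g (K g) <= - 2 * nrm (K g) ^+ 2.
Proof.
move=> gphi; pose q (x y : V) := - ip x (K y).
have qP : semi_inner_product q.
  split.
  - by move=> x y; rewrite /q -(ninv_sym KP) (ipC ipP).
  - by move=> c x y z; rewrite /q !(ipE ipP); ring.
  - by move=> x; rewrite oppr_ge0; exact: (ninv_le0 KP).
have := sqr_ip_le qP g (K g).
have Kphi : ip (K g) phiV = 0.
  by rewrite (ninv_sym KP) (ip_null_eqr ipP KV_phi) (ipZr ipP) gphi mulr0.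
have := energy_le_half Kphi; have := ninv_le0 KP g.
rewrite /q -(ninv_sym KP g (K g)) -(sqr_nrm ipP).
move: (sqr_ge0 (nrm (K g))); move: (nrm (K g) ^+ 2) (ip g (K g)) (ip (K g) (K (K g))).
move=> A b c A0 b0 cA H; have [->|AN] := eqVneq A 0; first by lra.
have Ap : 0 < A by rewrite lt_neqAle eq_sym AN.
have H' : A * A <= (- b) * (2^-1 * A) by nra.
have : A * A <= (- b / 2) * A by lra.
rewrite ler_pM2r//; lra.
Qed.

End FirstZero.

End Bessel.

(** * The datum and the boundary flux *)

Section InitialDatum.
Variable R : realType.
Local Notation TR := (measurableTypeR R).
Local Notation J := (`]0, 1[%classic : set R).
Local Notation V := (L2space (0 : R)).
Local Notation ip := (@L2ip R 0).
Local Notation nrm := (nrm (@L2ip R 0)).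
Let ipP : semi_inner_product ip := L2ip_semi_inner 0.
Local Notation K := (KV (@ltr01 R)).

Lemma within_dil (f : R -> R) a : 0 <= a < 1 -> {within `[0, 1], continuous f} ->
  {within `[0, 1], continuous (f \o dil a)}.
Proof.
move=> /andP[a0 a1] /subspace_continuousP cf; apply/subspace_continuousP => y yI.
have dI z : `[0, 1]%classic z -> `[0, 1]%classic (dil a z).
  by rewrite /= !in_itv/= /dil => /andP[z0 z1]; apply/andP; split; nra.
have /cvgrPdist_lt H := cf _ (dI _ yI).
apply/cvgrPdist_lt => e e0; have := H e e0; rewrite !near_withinE => He.
have cd : {for y, continuous (dil a)}.
  by apply: (@continuousD _ _ _ (fun=> a) (fun z => (1 - a) * z));
    [exact: cst_continuous|exact: mulrl_continuous].
have Hd : \forall z \near y, `[0, 1]%classic (dil a z) -> `|f (dil a y) - f (dil a z)| < e.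
  exact: (cd _ He).
near=> z => zI; have Hz : `[0, 1]%classic (dil a z) -> `|f (dil a y) - f (dil a z)| < e.
  by near: z.
by apply: Hz; exact: dI.
Unshelve. all: by end_near.
Qed.

(** A total embedding, with value 0 on functions that are not square integrable. *)
Definition toV (f : R -> R) : V := if pselect (L2 0 f) is left H then toL2 H else 0.

Lemma toVE f : L2 0 f -> toV f = f :> (R -> R).
Proof. by move=> Lf; rewrite /toV; case: pselect. Qed.

(** A source bounded by [C] has a primitive bounded by [C x], so [dK] is bounded by
    [C]. *)
Lemma Kfun_lipschitz (v : V) (C : R) : (forall x, 0 < x < 1 -> `|v x| <= C) ->
  forall x y, 0 <= x <= 1 -> 0 <= y <= 1 -> `|Kfun 0 v x - Kfun 0 v y| <= C * `|x - y|.
Proof.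
move=> vC.
have C0 : 0 <= C by apply: le_trans (vC 2^-1 _); rewrite // invr_gt0 ltr0n invf_lt1// ltr1n.
have P1 (r : R) : intR J (fun=> r) by apply: L2_integrable; exact: L2_cst.
have Pc (r x : R) : 0 <= x <= 1 -> Prim 0 (fun=> r) x = r * x.
  move=> xI; have dF (z : R) : is_derive z (1 : R) (fun x : R => r * x) r.
    by apply: is_derive_eq; rewrite /GRing.scale/= ?mulr0 ?mulr1 ?addr0 ?add0r.
  have cr : continuous (fun _ : R => r) by move=> z; exact: cvg_cst.
  by rewrite (Prim_FTC cr dF)// mulr0 subr0.
have dKC t : 0 < t < 1 -> `|dK 0 v t| <= C.
  move=> /andP[t0 t1]; rewrite /dK subr0 normrM normfV (gtr0_norm t0) ler_pdivrMr//.
  have tI : 0 <= t <= 1 by rewrite !ltW.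
  have := @PrimB_le R 0 v (fun=> C) 0 t.
  by rewrite !Prim_a !subr0 Pc// lexx (ltW t0); apply => //; exact: intR_val.
have main x y : 0 <= x -> x <= y -> y <= 1 -> `|Kfun 0 v x - Kfun 0 v y| <= C * `|x - y|.
  move=> x0 xy y1; rewrite distrC.
  have -> : Kfun 0 v y - Kfun 0 v x = Prim 0 (dK 0 v) y - Prim 0 (dK 0 v) x.
    by rewrite /Kfun; ring.
  apply: le_trans (PrimB_le (k := fun=> C) _ _ (P1 C) dKC) _.
  - by rewrite x0.
  - exact: intR_dK (@ltr01 R) v.
  - rewrite !Pc ?x0 ?(le_trans x0)// ?(le_trans xy)//.
    by rewrite -mulrBr ler_wpM2l// distrC ler_norm.
move=> x y /andP[x0 x1] /andP[y0 y1]; have [xy|yx] := leP x y; first exact: main.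
by rewrite distrC (distrC x); apply: main => //; exact: ltW.
Qed.

Lemma Kfun_sup (v : V) (C : R) : (forall x, 0 < x < 1 -> `|v x| <= C) ->
  forall x, 0 <= x <= 1 -> `|Kfun 0 v x| <= C.
Proof.
move=> vC x xI; have C0 : 0 <= C.
  by apply: le_trans (vC 2^-1 _); rewrite // invr_gt0 ltr0n invf_lt1// ltr1n.
have := Kfun_lipschitz vC xI (y := 1); rewrite Kfun_1 subr0 ler01 lexx => /(_ isT)/le_trans; apply.
have /andP[x0 x1] := xI; rewrite ler_piMr// distrC ger0_norm ?subr_ge0//.
by rewrite gerBl.
Qed.

Variables (u0 : R -> R) (hu0 : {within `[0, 1], continuous u0}).

Definition datum a : V := toV (u0 \o dil a).

Lemma datumE a : 0 <= a < 1 -> datum a = u0 \o dil a :> (R -> R).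
Proof. by move=> a01; apply: toVE; apply: L2_continuous; exact: within_dil. Qed.

(** The substitution [y = s^2 / j1^2]. *)
Lemma U10E j1 a : smallest_positive_zero (@besselJ0 R) j1 -> 0 <= a < 1 ->
  U10 j1 u0 a = (j1 ^+ 2 / 2) * ip (datum a) (phiV j1).
Proof.
move=> [j0 _ _] a01; have j20 : 0 < j1 ^+ 2 by rewrite exprn_gt0.
pose F (s : R) := s ^+ 2 / j1 ^+ 2; pose G (y : R) := j1 ^+ 2 / 2 * (u0 (dil a y) * phi j1 y).
have dF (s : R) : is_derive s (1 : R) F (2 * s / j1 ^+ 2).
  apply: is_derive_eq; rewrite /GRing.scale/=; ring.
have F' : derive1 F = (fun s => 2 * s / j1 ^+ 2).
  by apply/funext => s; rewrite derive1E; have [_ ->] := dF s.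
have F0 : F 0 = 0 by rewrite /F expr0n mul0r.
have F1 : F j1 = 1 by rewrite /F divff// gt_eqF.
have cF' : continuous (derive1 F).
  rewrite F' => s; have -> : (fun s : R => 2 * s / j1 ^+ 2) = (fun s => (2 / j1 ^+ 2) * s).
    by apply/funext => r; ring.
  exact: mulrl_continuous.
have cG : {within `[0, 1], continuous G}.
  apply: (@within_continuous_comp R R R _ (fun y => u0 (dil a y) * phi j1 y)
    (fun r => j1 ^+ 2 / 2 * r)); first by move=> r _; exact: mulrl_continuous.
  move=> y; apply: continuousM; first exact: (within_dil a01 hu0).
  by apply: continuous_subspaceT; exact: phi_continuous.
have LG := L2_continuous cG.
have : (\int[mu]_(x in `[F 0%R, F j1]) (G x)%:E)%E =
  (\int[mu]_(x in `[0%R, j1]) (((G \o F) * derive1 F)%R x)%:E)%E.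
  apply: integration_by_substitution_increasing.
  - exact: ltW.
  - move=> x y; rewrite !in_itv/= => /andP[x0 _] /andP[y0 _] xy.
    by rewrite /F ltr_pM2r ?invr_gt0// ltr_pXn2r.
  - by move=> x _; exact: cF'.
  - by apply/cvg_ex; exists (derive1 F 0); apply: cvg_at_right_filter; exact: cF'.
  - by apply/cvg_ex; exists (derive1 F j1); apply: cvg_at_left_filter; exact: cF'.
  - by apply: derivable_LR; [exact: ltW|move=> t _; have [] := dF t].
  - by rewrite F0 F1.
rewrite F0 F1 => H.
have iG : intR `[0, 1] G.
  by apply: continuous_compact_integrable => //; exact: segment_compact.
have E : \int[mu]_(y in `[0, 1]) G y = j1 ^+ 2 / 2 * ip (datum a) (phiV j1).
  rewrite -Rintegral_itv_obnd_cbnd; last first.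
    by apply: intRS iG => //; exact: subset_itv_oc_cc.
  rewrite -Rintegral_itv_bndo_bndc; last first.
    by apply: intRS iG => //; exact: subset_itv_oo_cc.
  rewrite -RintZ//; last exact: L2_mulr_integrable (L2space_L2 _) (L2space_L2 _).
  by apply: Rint_eq => y _; rewrite datumE.
rewrite -E /Rintegral H /U10 /Rintegral; congr fine; apply: eq_integral => s _; congr EFin.
transitivity (G (F s) * derive1 F s); last by [].
rewrite F' /G /F /dil besselJ0E /phi /eigen.
have -> : (j1 / 2) ^+ 2 * (s ^+ 2 / j1 ^+ 2) = (s / 2) ^+ 2 by field; rewrite gt_eqF.
by move: (u0 _) (besselE _) => p q; field; rewrite gt_eqF.
Qed.

(** The solution at time [t] and [Kfun a] of the rescaled [q] are equal almost
    everywhere, hence everywhere by continuity, and the latter has a known slope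
    at 1. *)
Lemma left_derivative_solution (a : R) S (w : R -> R) (t : R) q : 0 <= a < 1 -> is_exp_A a S ->
  0 < t -> ae_eq1 a w (S t u0) -> {within `]a, 1], continuous w} -> w 1 = 0 ->
  null_eq ip (rescaled a S (t / (1 - a)) (datum a)) (K q) ->
  left_derivative w 1 = (1 - a)^-1 * ip q (oneV R).
Proof.
move=> a01 SA t0 wS cw w1 qE; have /andP[a0 a1] := a01.
have ka : 1 - a != 0 by rewrite gt_eqF// subr_gt0.
have tau0 : 0 <= t / (1 - a) by rewrite divr_ge0 ?subr_ge0 ?ltW.
have E : rescaled a S (t / (1 - a)) (datum a) = S t u0 \o dil a :> (R -> R).
  rewrite rescaledE// mulrC divfK// datumE//.
  have -> // : (u0 \o dil a) \o undil a = u0.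
  by apply/funext => x /=; rewrite undilK.
have LS : L2 a (S t u0).
  have := S_L2 a1 SA (datum a) tau0; rewrite mulrC divfK// datumE//.
  have -> // : (u0 \o dil a) \o undil a = u0.
  by apply/funext => x /=; rewrite undilK.
have LG : L2 a (fun x => (1 - a)^-1 * q (undil a x)).
  by apply: L2Z; apply: (L2_undil a1); exact: L2space_L2.
pose G : L2space a := toL2 LG.
have GK y : 0 <= y <= 1 -> Kfun a G (dil a y) = Kfun 0 q y.
  by move=> yI; rewrite (Kfun_dil a1 (1 - a)^-1 q yI) mulfV// mul1r.
have LK : L2 a (Kfun a G) by exact: Kfun_L2.
pose D x := S t u0 x - Kfun a G x.
have LD : L2 a D by exact: L2B.
have D0 : \int[mu]_(x in `]a, 1[) (D x ^+ 2) = 0.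
  have N : nrm (rescaled a S (t / (1 - a)) (datum a) - K q) = (Num.sqrt (1 - a))^-1 * L2norm a D.
    apply: nrm_dil => // y /andP[y0 y1].
    by rewrite /GRing.add /GRing.opp /= /D E/= GK// !ltW.
  have s0 : Num.sqrt (1 - a) != 0 by rewrite gt_eqF// sqrtr_gt0 subr_gt0.
  have /esym/eqP := N; rewrite qE mulf_eq0 invr_eq0 (negbTE s0)/=.
  rewrite /L2norm sqrtr_eq0 => H; apply/eqP; rewrite eq_le H Rintegral_ge0//.
  by move=> x _; exact: sqr_ge0.
have Dae : {ae mu, forall x : TR, (`]a, 1[%classic : set R) x -> D x ^+ 2 = 0}.
  apply: Rint0_ae => //; last by have /L2P[] := LD.
    by apply: measurable_funX; exact: L2_measurable LD.
  by move=> x _; exact: sqr_ge0.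
have wae : {ae mu, forall x : TR, a < x < 1 -> w x = Kfun a G x}.
  apply: (@filterS2 _ _ (ae_filter_ringOfSetsType mu) _ _ _ _ wS Dae) => x wx Dx xI.
  have Ix : (`]a, 1[%classic : set R) x by rewrite /= in_itv.
  rewrite wx//; apply/eqP; rewrite -subr_eq0; have /eqP := Dx Ix.
  by rewrite sqrf_eq0.
have cw1 (s : R) : a < s < 1 -> {for s, continuous w} by move=> sI; exact: (within_oc_at cw sI).
have cK (s : R) : a < s < 1 -> {for s, continuous (Kfun a G)}.
  by move=> sI; exact: (within_oc_at (@Kfun_within_oc R a a1 G) sI).
have wK x : a < x < 1 -> w x = Kfun a G x := ae_eq_continuous wae cw1 cK (t := x).
rewrite (left_derivative_Kfun a1 w1 wK); congr (_ * _).
rewrite (Rint_dil a1 (intR_val G)) -RintZ//; last first.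
  by apply/(intR_dilP a1); [exact: intR_measurable (intR_val G)|exact: intR_val G].
by apply: Rint_eq => y _; rewrite /= dilK// mulr1 mulVKf.
Qed.

Variable M : R.
Hypothesis u0M : forall x, 0 <= x <= 1 -> `|u0 x| <= M.

Let M0 : 0 <= M.
Proof. by apply: le_trans (u0M (x := 0) _); rewrite // lexx ler01. Qed.

Lemma nrm_datum a : 0 <= a < 1 -> nrm (datum a) <= M.
Proof.
move=> a01; have /andP[a0 a1] := a01.
have := nrm_le_sup (@ltr01 R) (f := datum a) M0; rewrite subr0 sqrtr1 mulr1; apply.
move=> x; rewrite datumE//= -(dil_in a1) => /andP[ax x1].
by apply: u0M; rewrite (le_trans a0 (ltW ax)) ltW.
Qed.

(** The factor [1 - a] makes this the integral over ]a, 1[ of [u0] against [psi]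
    read in the variable of ]a, 1[. *)
Definition pairing (psi : V) a := (1 - a) * ip (datum a) psi.

Lemma pairingE (psi : V) a : 0 <= a < 1 ->
  pairing psi a = \int[mu]_(x in `]a, 1[) (u0 x * psi (undil a x)) /\
  intR (`]a, 1[%classic : set R) (fun x => u0 x * psi (undil a x)).
Proof.
move=> a01; have /andP[a0 a1] := a01.
have i1 : intR (`]a, 1[%classic : set R) (fun x => u0 x * psi (undil a x)).
  have := L2_mulr_integrable (L2_undil a1 (L2space_L2 (datum a))) (L2_undil a1 (L2space_L2 psi)).
  by apply: intR_eq => // x _; rewrite /= datumE//= undilK.
split => //; rewrite (Rint_dil a1 i1) /pairing; congr (_ * _).
by apply: Rint_eq => y _; rewrite datumE//= dilK.
Qed.

(** After the dilation, [a] enters through the interval of integration and through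
    the argument of [K v], and no longer through [u0]. *)
Lemma pairing_lipschitz (v : V) (C b a : R) : (forall x, 0 < x < 1 -> `|v x| <= C) ->
  0 <= a -> a <= b -> b < 1 ->
  `|pairing (K v) a - pairing (K v) b| <= 2 * (M * C) * (b - a).
Proof.
move=> vC a0 ab b1; have a1 := le_lt_trans ab b1; have b0 := le_trans a0 ab.
have C0 : 0 <= C by apply: le_trans (vC 2^-1 _); rewrite // invr_gt0 ltr0n invf_lt1// ltr1n.
pose psi := Kfun 0 v.
pose ha x := u0 x * psi (undil a x); pose hb x := u0 x * psi (undil b x).
have [-> ia] := pairingE (K v) (a := a) (introT andP (conj a0 a1)).
have [-> ib] := pairingE (K v) (a := b) (introT andP (conj b0 b1)).
rewrite -/psi -/ha -/hb.
have iab : intR (`]b, 1[%classic : set R) ha.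
  by apply: intRS ia => // x /=; rewrite !in_itv/= => /andP[bx ->]; rewrite (le_lt_trans ab).
have MC0 : 0 <= M * C by exact: mulr_ge0.
have cst (c d r : R) : intR (`]c, d[%classic : set R) (fun=> r).
  apply: (intR_bounded (M := `|r|)) => //.
  by rewrite lebesgue_measure_itv/=; case: ifP => // _; rewrite -EFinB ltry.
have psiC y : 0 <= y <= 1 -> `|psi y| <= C by exact: Kfun_sup.
have split_ : \int[mu]_(x in `]a, 1[) ha x =
    \int[mu]_(x in `]a, b[) ha x + \int[mu]_(x in `]b, 1[) ha x.
  rewrite -(Prim_1 a ha) -(subrK (Prim a ha b) (Prim a ha 1)) addrC; congr (_ + _).
    rewrite -[LHS]subr0 -(Prim_a a ha) PrimB ?lexx ?ab//.
    rewrite -Rintegral_itv_bndo_bndc; last exact: intR_ext.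
    apply: Rint_eq => x /=; rewrite in_itv/= => /andP[ax xb].
    by rewrite extE// ax (lt_trans xb).
  rewrite PrimB ?ab ?ltW//.
  rewrite -Rintegral_itv_bndo_bndc; last exact: intR_ext.
  apply: Rint_eq => x /=; rewrite in_itv/= => /andP[bx x1].
  by rewrite extE// x1 (le_lt_trans ab).
have left_ : `|\int[mu]_(x in `]a, b[) ha x| <= M * C * (b - a).
  rewrite -Rint_cst//; apply: Rint_le_norm => //.
    apply: (measurable_funS (E := `]a, 1[%classic)) => //; last exact: intR_measurable ia.
    by move=> x /=; rewrite !in_itv/= => /andP[-> xb]; rewrite (lt_trans xb).
  move=> x /=; rewrite in_itv/= => /andP[ax xb]; have x1 := lt_trans xb b1.
  have := undil_in a1 x; rewrite ax x1 => /andP[y0 y1].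
  rewrite normrM ler_pM//; first by apply: u0M; rewrite (le_trans a0 (ltW ax)) ltW.
  by apply: psiC; rewrite !ltW.
have right_ : `|\int[mu]_(x in `]b, 1[) (ha x - hb x)| <= M * C * (b - a).
  have -> : M * C * (b - a) = M * C * ((b - a) / (1 - b)) * (1 - b).
    by rewrite -!mulrA mulVf ?mulr1// gt_eqF// subr_gt0.
  rewrite -Rint_cst; last exact: ltW.
  apply: Rint_le_norm => //.
    by apply: measurable_funB; [exact: intR_measurable iab|exact: intR_measurable ib].
  move=> x /=; rewrite in_itv/= => /andP[bx x1]; have ax := le_lt_trans ab bx.
  have := undil_in a1 x; rewrite ax x1 => /andP[y0 y1].
  have := undil_in b1 x; rewrite bx x1 => /andP[z0 z1].
  rewrite /ha /hb -mulrBr normrM -mulrA ler_pM//.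
    by apply: u0M; rewrite (le_trans a0 (ltW ax)) ltW.
  apply: le_trans (Kfun_lipschitz vC _ _) _; try by rewrite !ltW.
  rewrite ler_wpM2l//.
  have -> : undil a x - undil b x = (b - a) / (1 - b) * ((1 - x) / (1 - a)).
    by rewrite /undil; field; rewrite !gt_eqF ?subr_gt0.
  have bma : 0 <= (b - a) / (1 - b) by rewrite divr_ge0// subr_ge0// ltW.
  rewrite ger0_norm; last by rewrite mulr_ge0// divr_ge0// subr_ge0 ltW.
  by rewrite ler_piMr// ler_pdivrMr ?subr_gt0// mul1r lerB// ltW.
rewrite split_ -addrA -RintB//.
apply: le_trans (ler_normD _ _) _; lra.
Qed.

End InitialDatum.

(** * Lower bound for a two-term expansion *)

Section RealEstimates.
Variable R : realType.
Implicit Types a b t m : R.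

(** The size of the first mode in the boundary flux. *)
Definition amplitude m a t : R := (1 - a) ^- 2 * expR (- (m * (t / (1 - a)))).

(** The exponent changes by at least [m t y], with [y = (b - a) / (1 - b)], and the
    prefactor by at most [e^(2 y)]; half of the exponent absorbs the prefactor when
    [m t >= 4]. *)
Lemma amplitude_decay m a b t : 0 <= a -> a <= b -> b < 1 -> 4 <= m * t ->
  amplitude m b t <= amplitude m a t * expR (- (m * t / 2 * (b - a))).
Proof.
move=> a0 ab b1 mt; have kb : 0 < 1 - b by rewrite subr_gt0.
have ka : 0 < 1 - a by rewrite subr_gt0 (le_lt_trans ab).
pose y := (b - a) / (1 - b).
have y0 : 0 <= y by rewrite divr_ge0 ?subr_ge0// ltW.
have ratio : (1 - a) / (1 - b) <= expR y.
  have -> : (1 - a) / (1 - b) = 1 + y by rewrite /y; field; rewrite gt_eqF.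
  exact: expR_ge1Dx.
have ratio2 : (1 - b) ^- 2 <= (1 - a) ^- 2 * expR (y + y).
  have -> : (1 - b) ^- 2 = (1 - a) ^- 2 * ((1 - a) / (1 - b)) ^+ 2.
    by field; rewrite !gt_eqF.
  rewrite ler_wpM2l ?invr_ge0 ?sqr_ge0// expRD -expr2; apply: sqr_le => //.
  by rewrite divr_ge0// ltW.
have mt0 : 0 <= m * t by lra.
have hy : b - a <= y.
  by rewrite /y ler_pdivlMr// ler_piMr ?subr_ge0// gerBl (le_trans a0).
have gap : m * t * y <= m * (t / (1 - b)) - m * (t / (1 - a)).
  have -> : m * (t / (1 - b)) - m * (t / (1 - a)) = m * t * y * (1 - a)^-1.
    by rewrite /y; field; rewrite !gt_eqF.
  rewrite ler_peMr ?(mulr_ge0 mt0)//.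
  by rewrite invf_ge1// gerBl.
rewrite /amplitude; apply: le_trans (ler_wpM2r (expR_ge0 _) ratio2) _.
rewrite -!mulrA ler_wpM2l ?invr_ge0 ?sqr_ge0// -!expRD ler_expR.
have H1 := ler_wpM2r y0 mt; have H2 := ler_wpM2l mt0 hy.
move: gap H1 H2; rewrite -!mulrA; clearbody y.
by move: (m * (t / (1 - a))) (m * (t / (1 - b))) => p q; lra.
Qed.

Lemma one_sub_expN_ge (k h : R) : 1 <= k -> 0 <= h <= 1 -> h / 2 <= 1 - expR (- (k * h)).
Proof.
move=> k1 /andP[h0 h1]; have kh0 : 0 <= k * h by rewrite mulr_ge0// (le_trans ler01).
have := expR_ge1Dx (k * h); rewrite expRN; have e0 := expR_gt0 (k * h).
move: (expR _) e0 => e e0 ge; rewrite lerBrDr -lerBrDl.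
have -> : 1 - h / 2 = (1 - h / 2) by [].
rewrite -div1r ler_pdivrMr//; nra.
Qed.

(** With [x = m t (b - a) / 2], the decrease of the amplitude contributes
    [d (1 - e^-x)] and the variation of [W] at most [L (b - a) e^-x]. As
    [x e^-x <= 1 - e^-x], the latter is at most half of the former for large [t]. *)
Lemma main_term_lower (m a b t L d Wa Wb : R) : 0 <= a -> a <= b -> b < 1 ->
  4 <= m * t -> 0 < d -> 0 <= L -> 4 * L <= m * t * d ->
  d <= `|Wa| -> `|Wa - Wb| <= L * (b - a) ->
  d / 4 * (b - a) * expR (- (m * (t / (1 - a)))) <=
  `|amplitude m a t * Wa - amplitude m b t * Wb|.
Proof.
move=> a0 ab b1 mt d0 L0 Lmt dW WL.
have ka : 0 < 1 - a by rewrite subr_gt0 (le_lt_trans ab).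
have dec := amplitude_decay a0 ab b1 mt.
have E0 c : 0 <= amplitude m c t by rewrite mulr_ge0 ?expR_ge0// invr_ge0 sqr_ge0.
pose k := m * t / 2; pose h := b - a; pose s := expR (- (k * h)).
have h0 : 0 <= h by rewrite subr_ge0.
have h1 : h <= 1 by rewrite /h; lra.
have k2 : 2 <= k by rewrite /k; lra.
have s0 : 0 <= s by exact: expR_ge0.
have kh0 : 0 <= k * h by rewrite mulr_ge0//; lra.
have sh : h / 2 <= 1 - s by apply: one_sub_expN_ge; [lra|rewrite h0].
have ks : k * h * s <= 1 - s.
  have := ler_wpM2r s0 (expR_ge1Dx (k * h)); rewrite /s -expRD subrr expR0; lra.
have Ea : expR (- (m * (t / (1 - a)))) <= amplitude m a t.
  rewrite /amplitude ler_peMl ?expR_ge0// invf_ge1 ?exprn_gt0//.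
  by rewrite expr_le1 ?gerBl// ltW.
apply: (@le_trans _ _ (d / 4 * h * amplitude m a t)).
  by rewrite ler_wpM2l// mulr_ge0// divr_ge0// ltW.
have T1 : d * (amplitude m a t - amplitude m b t) - L * h * amplitude m b t <=
    `|amplitude m a t * Wa - amplitude m b t * Wb|.
  have -> : amplitude m a t * Wa - amplitude m b t * Wb =
    (amplitude m a t - amplitude m b t) * Wa - amplitude m b t * - (Wa - Wb) by ring.
  apply: le_trans (lerB_dist _ _); apply: lerB.
    rewrite normrM mulrC ler_pM ?(ltW d0)//; last by rewrite ler_norm.
    rewrite subr_ge0; apply: le_trans dec _; rewrite ler_piMr// expR_le1 oppr_le0.
    by move: kh0; rewrite /k /h.
  by rewrite normrM normrN (ger0_norm (E0 b)) mulrC ler_wpM2r.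
apply: le_trans T1.
have Lk : 2 * L <= k * d by rewrite /k; lra.
have decs : amplitude m b t <= amplitude m a t * s by [].
move: (E0 a) (E0 b) decs; move: (amplitude m a t) (amplitude m b t) => A B A0 B0 BA.
have c0 : 0 <= d + L * h by rewrite addr_ge0 ?mulr_ge0// ltW.
have H1 : (d + L * h) * B <= (d + L * h) * (A * s) by rewrite ler_wpM2l.
have H2 : L * h * s <= d / 2 * (1 - s).
  have : 2 * L * (h * s) <= k * d * (h * s) by rewrite ler_wpM2r// mulr_ge0.
  have : d * (k * h * s) <= d * (1 - s) by rewrite ler_wpM2l// ltW.
  lra.
have H3 : d / 4 * h <= d * (1 - s) - L * h * s.
  have : d * (h / 2) <= d * (1 - s) by rewrite ler_wpM2l// ltW.
  lra.
have := ler_wpM2r A0 H3; lra.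
Qed.

Lemma linear_expN_le (e D c t : R) : 0 < e -> e <= 1 -> 0 <= D -> 0 < c -> 0 < t ->
  D / (e ^+ 2 * c) <= t -> D * (1 + t) * expR (- (2 * e * t)) <= c.
Proof.
move=> e0 e1 D0 c0 t0; rewrite ler_pdivrMr ?mulr_gt0 ?exprn_gt0// => Dt.
have et0 : 0 <= e * t by rewrite mulr_ge0// ltW.
have e2 : (1 + e * t) ^+ 2 <= expR (2 * e * t).
  have -> : 2 * e * t = e * t + e * t by ring.
  by rewrite expRD -expr2; apply: sqr_le; [rewrite addr_ge0|exact: expR_ge1Dx].
rewrite expRN ler_pdivrMr ?expR_gt0//.
apply: le_trans (ler_wpM2l (ltW c0) e2).
have H : e * (1 + t) <= 1 + e * t by lra.
have H' : e * t <= 1 + e * t by lra.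
have u0 : 0 <= 1 + e * t by rewrite addr_ge0.
have S1 := ler_wpM2l D0 H.
have S2 := ler_wpM2r u0 Dt.
have S3 : (e * t) * (e * c * (1 + e * t)) <= (1 + e * t) * (e * c * (1 + e * t)).
  by rewrite ler_wpM2r// mulr_ge0// mulr_ge0// ltW.
rewrite -(ler_pM2l e0); lra.
Qed.

(** The remainder is compared with the main term through the ratio
    [e^(- (2 - m) t / (1 - a))], which beats the factor [1 + t]. *)
Lemma expansion_lower_bound (m beta kappa L d D : R) (W : R -> R) (rho F : R -> R -> R) :
  0 < m -> m < 2 -> beta < 1 -> kappa != 0 -> 0 < d -> 0 <= L -> 0 <= D ->
  (forall a t, 0 <= a <= beta -> 1 <= t ->
    F a t = kappa * (amplitude m a t * W a) + rho a t) ->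
  (forall a, 0 <= a <= beta -> d <= `|W a|) ->
  (forall a b, 0 <= a -> a <= b -> b <= beta -> `|W a - W b| <= L * (b - a)) ->
  (forall a b t, 0 <= a -> a <= b -> b <= beta -> 1 <= t ->
    `|rho a t - rho b t| <= D * (1 + t) * expR (- (2 * (t / (1 - a)))) * (b - a)) ->
  exists2 T, 0 < T & forall t1, T < t1 -> exists2 C, 0 < C &
    forall t, T <= t <= t1 -> forall a1 a2, 0 <= a1 <= beta -> 0 <= a2 <= beta ->
      `|a2 - a1| <= C * `|F a2 t - F a1 t|.
Proof.
move=> m0 m2 beta1 k0 d0 L0 D0 FE Wd WL rhoD.
have kp : 0 < `|kappa| by rewrite normr_gt0.
pose e := (2 - m) / 2; have e0 : 0 < e by rewrite /e; lra.
have e1 : e <= 1 by rewrite /e; lra.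
pose c := `|kappa| * (d / 8); have c0 : 0 < c by rewrite mulr_gt0// divr_gt0.
(* The summands ensure [1 <= t], [4 <= m t], [4 L <= m t d] and a remainder of size at most half of the main term. *)
pose T := 1 + 4 / m + 4 * L / (m * d) + D / (e ^+ 2 * c).
have q1 : 0 <= 4 / m by rewrite divr_ge0// ltW.
have q2 : 0 <= 4 * L / (m * d) by apply: divr_ge0; apply: mulr_ge0 => //; exact: ltW.
have q3 : 0 <= D / (e ^+ 2 * c).
  by apply: divr_ge0 => //; apply: mulr_ge0; [exact: sqr_ge0|exact: ltW].
have T1 : 1 <= T by rewrite /T; lra.
exists T; first exact: lt_le_trans T1.
move=> t1 _; have be : 0 < 1 - beta by rewrite subr_gt0.
pose C := c * expR (- (m * (t1 / (1 - beta)))).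
have C0 : 0 < C by rewrite mulr_gt0// expR_gt0.
exists C^-1; first by rewrite invr_gt0.
move=> t /andP[Tt tt1].
have main a b : 0 <= a -> a <= b -> b <= beta -> C * (b - a) <= `|F a t - F b t|.
  move=> a0 ab bb; have t1' : 1 <= t := le_trans T1 Tt.
  have t0 : 0 < t := lt_le_trans ltr01 t1'.
  have aI : 0 <= a <= beta by rewrite a0 (le_trans ab).
  have bI : 0 <= b <= beta by rewrite bb (le_trans a0).
  have a1 : a < 1 by have /andP[_ ?] := aI; exact: le_lt_trans beta1.
  have ka : 0 < 1 - a by rewrite subr_gt0.
  have mt : 4 <= m * t by rewrite mulrC -ler_pdivrMr//; apply: le_trans Tt; rewrite /T; lra.
  have Lmt : 4 * L <= m * t * d.
    have -> : m * t * d = t * (m * d) by ring.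
    by rewrite -ler_pdivrMr ?mulr_gt0//; apply: le_trans Tt; rewrite /T; lra.
  have small : D * (1 + t) * expR (- (2 * e * t)) <= c.
    by apply: linear_expN_le => //; apply: le_trans Tt; rewrite /T; lra.
  have := main_term_lower a0 ab (le_lt_trans bb beta1) mt d0 L0 Lmt (Wd _ aI) (WL _ _ a0 ab bb).
  have := rhoD _ _ _ a0 ab bb t1'.
  rewrite !FE//; set X := amplitude m a t * W a; set Y := amplitude m b t * W b.
  set g := expR (- (m * (t / (1 - a)))) => rhoab XY.
  have g0 : 0 <= g by exact: expR_ge0.
  have h0 : 0 <= b - a by rewrite subr_ge0.
  have tau : t <= t / (1 - a).
    by rewrite ler_pdivlMr// ler_piMr// ?gerBl// ltW.
  have eg : expR (- (2 * (t / (1 - a)))) <= g * expR (- (2 * e * t)).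
    rewrite /g -expRD ler_expR.
    have : (2 - m) * t <= (2 - m) * (t / (1 - a)) by rewrite ler_wpM2l// subr_ge0 ltW.
    by rewrite /e; move: (t / (1 - a)) => p; lra.
  have Cg : C * (b - a) <= c * g * (b - a).
    apply: ler_wpM2r => //; apply: ler_wpM2l; first exact: ltW.
    rewrite /g ler_expR lerN2 ler_wpM2l ?(ltW m0)//.
    have : t / (1 - a) <= t / (1 - beta).
      by rewrite ler_wpM2l ?(ltW t0)// lef_pV2// lerB//; have /andP[] := aI.
    move/le_trans; apply; by rewrite ler_wpM2r// invr_ge0 ltW.
  have rho2 : `|rho a t - rho b t| <= c * g * (b - a).
    apply: le_trans rhoab _; apply: ler_wpM2r => //.
    have D1 : 0 <= D * (1 + t) by rewrite mulr_ge0// addr_ge0// ltW.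
    apply: le_trans (ler_wpM2l D1 eg) _.
    by have := ler_wpM2r g0 small; lra.
  have main2 : 2 * (c * g * (b - a)) <= `|kappa * X - kappa * Y|.
    rewrite -mulrBr normrM /c; have := ler_wpM2l (ltW kp) XY; lra.
  have -> : kappa * X + rho a t - (kappa * Y + rho b t) =
     (kappa * X - kappa * Y) - (rho b t - rho a t) by ring.
  apply: le_trans (lerB_dist _ _); rewrite (distrC (rho b t)); lra.
move=> a1 a2 /andP[a10 a1b] /andP[a20 a2b]; rewrite mulrC ler_pdivlMr// mulrC.
have [le|/ltW le] := leP a1 a2.
  by rewrite ger0_norm ?subr_ge0// (distrC (F a2 t)); exact: main.
by rewrite distrC ger0_norm ?subr_ge0//; exact: main.
Qed.

End RealEstimates.

(** * Stability *)

Lemma sqr_diff_le (R : realType) (p q r h : R) : 0 <= p -> p <= q -> q <= r -> 1 <= r ->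
  0 <= h -> q - p = p * q * h -> `|p ^+ 2 - q ^+ 2| <= 2 * r ^+ 4 * h.
Proof.
move=> p0 pq qr r1 h0 qp; have pr := le_trans pq qr; have q0 := le_trans p0 pq.
have r0 := le_trans q0 qr.
have -> : p ^+ 2 - q ^+ 2 = - ((p + q) * (q - p)) by ring.
have pq0 : 0 <= (p + q) * (p * q) by apply: mulr_ge0; [exact: addr_ge0|exact: mulr_ge0].
rewrite normrN qp mulrA ger0_norm; last exact: mulr_ge0.
apply: ler_wpM2r => //; apply: (@le_trans _ _ (2 * r * (r * r))).
  apply: ler_pM; [exact: addr_ge0|exact: mulr_ge0|by lra|].
  exact: ler_pM.
by rewrite -mulrA ler_wpM2l// -expr2 -exprS ler_weXn2l.
Qed.

Section Remainder.
Variable R : realType.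
Local Notation J := (`]0, 1[%classic : set R).
Local Notation V := (L2space (0 : R)).
Local Notation ip := (@L2ip R 0).
Local Notation nrm := (nrm (@L2ip R 0)).
Let ipP : semi_inner_product ip := L2ip_semi_inner 0.
Local Notation K := (KV (@ltr01 R)).
Let KP := KV_negative_inverse (@ltr01 R).
Variables (u0 : R -> R) (hu0 : {within `[0, 1], continuous u0}).
Variable M : R.
Hypothesis u0M : forall x, 0 <= x <= 1 -> `|u0 x| <= M.

Let M0 : 0 <= M.
Proof. by apply: le_trans (u0M (x := 0) _); rewrite // lexx ler01. Qed.

Lemma pairingB (f g : V) a : pairing u0 (f - g) a = pairing u0 f a - pairing u0 g a.
Proof. by rewrite /pairing !(ipE ipP) mulrBr. Qed.

Lemma pairing_le (f : V) a : 0 <= a < 1 -> `|pairing u0 f a| <= M * nrm f.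
Proof.
move=> a01; have /andP[a0 a1] := a01.
have k0 : 0 <= 1 - a by rewrite subr_ge0 ltW.
rewrite /pairing normrM (ger0_norm k0) -[leRHS]mul1r ler_pM// ?gerBl//.
apply: le_trans (ip_le_nrm ipP _ _) _; apply: ler_wpM2r; first exact: nrm_ge0.
exact: (nrm_datum hu0 u0M).
Qed.

Variables (z : R -> V) (C beta : R).
Hypothesis beta1 : beta < 1.
Hypothesis z_le : forall t, 1 <= t -> nrm (z t) <= C * expR (- (2 * t)).
Hypothesis z_lip : forall t t', 1 <= t -> t <= t' ->
  nrm (K (K (z t')) - K (K (z t))) <= C * expR (- (2 * t)) * (t' - t).

Definition remainder a t :=
  (1 - a) ^- 2 * pairing u0 (K (K (z (t / (1 - a))))) a.

(** The parameter enters through the prefactor, the datum and the time, and each of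
    the three variations is bounded by the size of [z] or by that of its increments. *)
Lemma remainder_lipschitz : exists2 D, 0 <= D & forall a b t,
  0 <= a -> a <= b -> b <= beta -> 1 <= t ->
  `|remainder a t - remainder b t| <=
    D * (1 + t) * expR (- (2 * (t / (1 - a)))) * (b - a).
Proof.
have C0 : 0 <= C.
  by have := le_trans (nrm_ge0 ip _) (z_le (lexx 1)); rewrite pmulr_lge0// expR_gt0.
pose k0 := \int[mu]_(t in J) rsqrt 0 t.
have k00 : 0 <= k0 by apply: Rintegral_ge0 => t _; rewrite invr_ge0 sqrtr_ge0.
pose r := (1 - beta)^-1; have r0 : 0 <= r by rewrite invr_ge0 subr_ge0 ltW.
exists (r ^+ 2 * (2 * (M * k0)) * C + r ^+ 4 * M * C + 2 * r ^+ 4 * M * k0 ^+ 2 * C).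
  have r2 : 0 <= r ^+ 2 by exact: sqr_ge0.
  have r4 : 0 <= r ^+ 4 by rewrite exprn_ge0.
  have k2 : 0 <= k0 ^+ 2 by exact: sqr_ge0.
  by rewrite !addr_ge0// !mulr_ge0// !mulr_ge0.
move=> a b t a0 ab bb t1.
have a1 : a < 1 by exact: le_lt_trans ab (le_lt_trans bb beta1).
have b1 : b < 1 := le_lt_trans bb beta1.
have ka : 0 < 1 - a by rewrite subr_gt0.
have kb : 0 < 1 - b by rewrite subr_gt0.
have kbeta : 0 < 1 - beta by rewrite subr_gt0.
pose p := (1 - a)^-1; pose q := (1 - b)^-1.
have p0 : 0 <= p by rewrite invr_ge0 ltW.
have pq : p <= q by rewrite lef_pV2// lerB.
have qr : q <= r by rewrite lef_pV2// lerB.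
have p1 : 1 <= p by rewrite invf_ge1// gerBl.
have h0 : 0 <= b - a by rewrite subr_ge0.
have qp : q - p = p * q * (b - a) by rewrite /p /q; field; rewrite !gt_eqF.
have t0 : 0 <= t := le_trans ler01 t1.
have ta1 : 1 <= t * p by rewrite -[1]mulr1 ler_pM.
have tab : t * p <= t * q by rewrite ler_wpM2l.
have tb1 : 1 <= t * q := le_trans ta1 tab.
pose e := expR (- (2 * (t * p))).
have e0 : 0 <= e by exact: expR_ge0.
pose za := z (t * p); pose zb := z (t * q).
have za_ : nrm za <= C * e by exact: z_le.
have zb_ : nrm zb <= C * e.
  apply: le_trans (z_le tb1) _; rewrite ler_wpM2l// ler_expR lerN2.
  by rewrite ler_wpM2l.
have zab : nrm (K (K za) - K (K zb)) <= C * e * (t * (r ^+ 2 * (b - a))).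
  rewrite (nrmC ipP); apply: le_trans (z_lip ta1 tab) _.
  rewrite ler_wpM2l// ?mulr_ge0// -mulrBr ler_wpM2l// qp ler_wpM2r//.
  by rewrite expr2 ler_pM// ?(le_trans p0)// (le_trans pq).
have KB f : nrm (K f) <= k0 * nrm f.
  by have := ninv_bounded KP f; rewrite subr0 sqrtr1 mulr1.
have KKb : nrm (K (K zb)) <= k0 ^+ 2 * (C * e).
  apply: le_trans (KB _) _; rewrite expr2 -mulrA ler_wpM2l//.
  by apply: le_trans (KB _) _; rewrite ler_wpM2l.
have G1 : `|pairing u0 (K (K za)) a - pairing u0 (K (K za)) b| <=
    2 * (M * (k0 * (C * e))) * (b - a).
  apply: (pairing_lipschitz hu0 u0M) => // x /andP[x0 x1].
  apply: (@le_trans _ _ (nrm za * k0)); first by apply: Kfun_le => //; rewrite !ltW.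
  by rewrite mulrC ler_wpM2l.
have b01 : 0 <= b < 1 by rewrite b1 (le_trans a0).
have G2 : `|pairing u0 (K (K za)) b - pairing u0 (K (K zb)) b| <=
    M * (C * e * (t * (r ^+ 2 * (b - a)))).
  rewrite -pairingB; apply: le_trans (pairing_le _ b01) _.
  by rewrite ler_wpM2l.
have G3 : `|pairing u0 (K (K zb)) b| <= M * (k0 ^+ 2 * (C * e)).
  by apply: le_trans (pairing_le _ b01) _; rewrite ler_wpM2l.
have p2 : p ^+ 2 <= r ^+ 2 by apply: sqr_le => //; exact: le_trans qr.
have pq2 : `|p ^+ 2 - q ^+ 2| <= 2 * r ^+ 4 * (b - a).
  by apply: sqr_diff_le => //; exact: le_trans (le_trans pq qr).
rewrite /remainder -/p -/q -/za -/zb -!exprVn -/p -/q -/e.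
set A := pairing u0 (K (K za)) a in G1 *; set B := pairing u0 (K (K za)) b in G1 G2 *.
set B' := pairing u0 (K (K zb)) b in G2 G3 *.
have -> : p ^+ 2 * A - q ^+ 2 * B' =
  p ^+ 2 * (A - B) + p ^+ 2 * (B - B') + (p ^+ 2 - q ^+ 2) * B' by ring.
have n1 : `|p ^+ 2 * (A - B)| <= r ^+ 2 * (2 * (M * (k0 * (C * e))) * (b - a)).
  by rewrite normrM (ger0_norm (sqr_ge0 p)) ler_pM// sqr_ge0.
have n2 : `|p ^+ 2 * (B - B')| <= r ^+ 2 * (M * (C * e * (t * (r ^+ 2 * (b - a))))).
  by rewrite normrM (ger0_norm (sqr_ge0 p)) ler_pM// sqr_ge0.
have n3 : `|(p ^+ 2 - q ^+ 2) * B'| <= 2 * r ^+ 4 * (b - a) * (M * (k0 ^+ 2 * (C * e))).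
  by rewrite normrM ler_pM.
apply: le_trans (ler_normD _ _) _.
apply: le_trans (lerD (ler_normD _ _) (lexx _)) _.
apply: le_trans (lerD (lerD n1 n2) n3) _.
rewrite -subr_ge0.
have -> : (r ^+ 2 * (2 * (M * k0)) * C + r ^+ 4 * M * C + 2 * r ^+ 4 * M * k0 ^+ 2 * C) *
  (1 + t) * e * (b - a) - (r ^+ 2 * (2 * (M * (k0 * (C * e))) * (b - a)) +
  r ^+ 2 * (M * (C * e * (t * (r ^+ 2 * (b - a))))) +
  2 * r ^+ 4 * (b - a) * (M * (k0 ^+ 2 * (C * e)))) =
  M * C * e * (b - a) * (2 * (r ^+ 2 * k0 * t) + r ^+ 4 + 2 * (r ^+ 4 * k0 ^+ 2 * t)) by ring.
have r4 : 0 <= r ^+ 4 by rewrite exprn_ge0.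
apply: mulr_ge0; first by rewrite !mulr_ge0.
by rewrite !addr_ge0// !mulr_ge0// sqr_ge0.
Qed.

End Remainder.

Theorem theorem4p1 (R : realType) (j1 : R)
    (hj1 : smallest_positive_zero (@besselJ0 R) j1)
    (u0 : R -> R) (hu0 : {within `[0, 1], continuous u0})
    (u : R -> R -> R -> R)
    (hu : forall a, 0 <= a < 1 -> is_solution a u0 (u a))
    (beta : R) (hbeta : 0 <= beta < 1)
    (hU : exists2 delta : R, 0 < delta &
      forall a, 0 <= a <= beta -> delta <= `|U10 j1 u0 a|) :
  exists2 T : R, 0 < T &
    forall t1, T < t1 ->
      exists2 C : R, 0 < C &
        forall t, T <= t <= t1 ->
          forall a1 a2, 0 <= a1 <= beta -> 0 <= a2 <= beta ->
            `|a2 - a1| <=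
              C * `|left_derivative (u a2 ^~ t) 1 - left_derivative (u a1 ^~ t) 1|.
Proof.
have /andP[beta0 beta1] := hbeta; have [delta delta0 Udelta] := hU.
have [M u0M] := continuous_bounded01 hu0.
have ipP := L2ip_semi_inner (0 : R); have KP := KV_negative_inverse (@ltr01 R).
have complV := @L2_complete R 0.
have j0 : 0 < j1 by have [] := hj1.
have m0 := eigen_gt0 hj1; have m2 := eigen_lt2 hj1.
have [S0 S0A _] := sol_semigroup (hu 0 (introT andP (conj (lexx 0) ltr01))).
have SP := rescaled_semigroup (@ltr01 R) S0A.
set m := eigen j1 in m0 m2 *; pose c := L2ip (oneV R) (phiV j1) / nrm (@L2ip R 0) (phiV j1) ^+ 2.
have c0 : 0 < c by rewrite divr_gt0 ?ip_one_phi// exprn_gt0// nrm_phi_gt0.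
have [C [z zP]] := sgo_asymptotics ipP complV KP SP m0 (KV_phi hj1) (nrm_phi_gt0 hj1)
  (ler0n R 2) (@spectral_gap R j1 hj1) (oneV R).
have z_le t : 1 <= t -> nrm (@L2ip R 0) (z t) <= C * expR (- (2 * t)).
  by move=> t1; have [] := zP t t1.
have z_lip t t' : 1 <= t -> t <= t' ->
    nrm (@L2ip R 0) (KV (@ltr01 R) (KV (@ltr01 R) (z t')) - KV (@ltr01 R) (KV (@ltr01 R) (z t))) <=
    C * expR (- (2 * t)) * (t' - t).
  by move=> t1; have [_ _] := zP t t1; exact.
have [D D0 rhoD] := remainder_lipschitz hu0 u0M beta1 z_le z_lip.
have lt1 a : 0 <= a <= beta -> 0 <= a < 1.
  by move=> /andP[-> ab]; exact: le_lt_trans beta1.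
(* The first eigenfunction is itself in the range of K. *)
pose v : L2space (0 : R) := - m *: phiV j1.
have vE : null_eq (@L2ip R 0) (phiV j1) (KV (@ltr01 R) v).
  apply/(null_eqP ipP) => h; rewrite (ip_TZ ipP (ninv_linear KP)).
  by rewrite (ip_null_eq ipP (KV_phi hj1)) (ipZl ipP) mulrA mulrNN mulfV ?mul1r// gt_eqF.
have WE a : pairing u0 (phiV j1) a = pairing u0 (KV (@ltr01 R) v) a.
  by rewrite /pairing (ip_null_eqr ipP vE).
have [Mv vM] : exists Mv, forall x, 0 < x < 1 -> `|v x| <= Mv.
  have [B phiB] := continuous_bounded01 (continuous_subspaceT (@phi_continuous R j1)).
  exists (m * B) => x /andP[x0 x1].
  have -> : v x = - (m * phi j1 x) by rewrite -mulNr.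
  by rewrite normrN normrM (gtr0_norm m0) ler_wpM2l ?(ltW m0)// phiB// !ltW.
have M0 : 0 <= M by apply: le_trans (u0M 0 _); rewrite // lexx ler01.
have Mv0 : 0 <= Mv.
  by apply: le_trans (vM 2^-1 _); rewrite // invr_gt0 ltr0n invf_lt1// ltr1n.
pose d := (1 - beta) * (delta / (j1 ^+ 2 / 2)).
have j2 : 0 < j1 ^+ 2 / 2 by rewrite divr_gt0// exprn_gt0.
have d0 : 0 < d by rewrite mulr_gt0 ?subr_gt0// divr_gt0.
apply: (@expansion_lower_bound R m beta (- (m * c)) (2 * (M * Mv)) d D
  (pairing u0 (phiV j1)) (remainder u0 z) (fun a t => left_derivative (u a ^~ t) 1)) => //.
- by rewrite oppr_eq0 mulf_neq0// gt_eqF.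
- by rewrite !mulr_ge0.
- move=> a t /lt1 a01 t1; have /andP[a0 a1] := a01.
  have t0 : 0 < t := lt_le_trans ltr01 t1.
  have tau1 : 1 <= t / (1 - a).
    by rewrite ler_pdivlMr ?subr_gt0// mul1r (le_trans _ t1)// gerBl.
  have tau0 : 0 < t / (1 - a) := lt_le_trans ltr01 tau1.
  have sol := hu a a01; have [S SA uS] := sol_semigroup sol.
  have [q qE] := sgo_in_range ipP complV KP SP (datum u0 a) tau0.
  have qE' : null_eq (@L2ip R 0) (rescaled a S (t / (1 - a)) (datum u0 a)) (KV (@ltr01 R) q).
    apply: (null_eq_trans ipP) qE.
    exact: (sgo_unique ipP complV KP _ (rescaled_semigroup a1 SA) SP (ltW tau0)).
  rewrite (left_derivative_solution hu0 a01 SA t0 (uS _ (ltW t0)) (sol_continuous sol t0)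
    (sol_dirichlet sol t0) qE').
  have [wE _ _] := zP _ tau1.
  rewrite (ip_inverse_sgo ipP complV KP SP tau0 qE wE) /remainder /pairing /amplitude.
  rewrite (ipDr ipP) !(ipZr ipP) -/c -/m.
  by move: (expR _) (L2ip _ (phiV j1)) (L2ip _ (KV _ _)) => e x y; field; rewrite gt_eqF// subr_gt0.
- move=> a aI; have a01 := lt1 a aI; have /andP[a0 a1] := a01; have /andP[_ ab] := aI.
  have := Udelta a aI; rewrite (U10E hu0 hj1 a01) normrM (gtr0_norm j2) => Ud.
  rewrite /pairing normrM ger0_norm ?subr_ge0 ?(ltW a1)//.
  apply: ler_pM; first by rewrite subr_ge0 ltW.
  + by rewrite divr_ge0// ltW.
  + exact: lerB.
  + by rewrite ler_pdivrMr// mulrC.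
- move=> a b a0 ab bb; rewrite !WE; apply: (pairing_lipschitz hu0 u0M vM) => //.
  exact: le_lt_trans beta1.
Qed.
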